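(* Let $F_n=f_n\circ\cdots\circ f_1$, $n\in\mathbb{N}$, where the $f_n$ are inner functions, and let $F_0$ be the identity map. For $n\in\mathbb{N}$ let \[ \lambda_n=\frac{\rho_{\mathbb{D}}(F_n(0))\,|f_n'(F_{n-1}(0))|}{\rho_{\mathbb{D}}(F_{n-1}(0))},\qquad \mu_n=1-\lambda_n . \] If \[ \sum_{n=1}^\infty\mu_n(1-|F_n(0)|)=\infty, \] then $(F_n(\zeta))$ is dense in $\partial\mathbb{D}$ for almost every $\zeta\in\partial\mathbb{D}$, and the Denjoy--Wolff set of $(F_n)$ has measure $0$.
   Context: $\mathbb{D}=\{z\in\mathbb{C}:|z|<1\}$ and $\rho_{\mathbb{D}}(z)=2/(1-|z|^2)$ is the hyperbolic density on $\mathbb{D}$. An inner function is a holomorphic map $f:\mathbb{D}\to\mathbb{D}$ whose radial boundary extension (also denoted $f$, defined at almost every point of $\partial\mathbb{D}$) takes values in $\partial\mathbb{D}$ almost everywhere. Compositions on the boundary are compositions of radial boundary extensions, defined almost everywhere. Measure on $\partial\mathbb{D}$ is arc length (Lebesgue) measure. The Denjoy--Wolff set of $(F_n)$ is the set of points $\zeta\in\partial\mathbb{D}$ such that $|F_n(\zeta)-F_n(0)|\to0$ as $n\to\infty$. *)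

(* Defs.v *)
From HB Require Import structures.
From mathcomp Require Import all_boot all_order all_algebra.
From mathcomp Require Import all_classical all_reals all_analysis.
From mathcomp Require Import complex.

Set Implicit Arguments.
Unset Strict Implicit.
Unset Printing Implicit Defensive.

Import Order.TTheory GRing.Theory Num.Theory.
Import numFieldNormedType.Exports.

Local Open Scope classical_set_scope.
Local Open Scope ring_scope.
Local Open Scope complex_scope.

(* MathComp-Analysis over an arbitrary [R : realType], with [R[i]] as the
   complex plane. The norm [`|z|] of [R[i]] takes values in [R[i]]; its
   real-valued version is [Normc.normc z], with [`|z| = (Normc.normc z)%:C]. *)

(* The library puts its topology and norm on [K^o] for a [numFieldType K]; this
   transports them to [R[i]], as it does itself for [R : realType]. *)
#[non_forgetful_inheritance]
HB.instance Definition _ (R : realType) := NormedModule.copy R[i] R[i]^o.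

Section Disc.
Context {R : realType}.
Implicit Types (f : R[i] -> R[i]) (z zeta : R[i]) (A : set R[i]).

Definition unit_disc : set R[i] := [set z | `|z| < 1].

Definition unit_circle : set R[i] := [set z | `|z| = 1].

Definition hyp_density z : R := 2 / (1 - Normc.normc z ^+ 2).

Definition circle_point (t : R) : R[i] := cos t +i* sin t.

(* [negligible] means contained in a measurable set of measure zero, so this
   is nullity for the completed arc length measure; no measurability of [A]
   is presupposed. *)
Definition arc_null A : Prop :=
  (@lebesgue_measure R).-negligible
    [set t | 0 <= t < 2 * pi /\ A (circle_point t)].

Definition circle_ae (P : R[i] -> Prop) : Prop :=
  arc_null [set zeta | unit_circle zeta /\ ~ P zeta].

(* Functions are total on [R[i]], but only their values on the disc matter:
   the disc is open, and [r * zeta] lies in it for [r] in a left neighbourhood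
   of 1. Differentiability is over the field [R[i]], i.e. complex. *)
Definition holomorphic_on_disc f : Prop :=
  forall z, unit_disc z -> derivable f z 1.

Definition cderiv f z : R[i] := derive1 f z.

(* The radial boundary extension is a partial function on the unit circle:
   [radial_ext f zeta] is meaningful when [radial_dom f zeta]. *)
Definition radial_dom f : set R[i] :=
  [set zeta | unit_circle zeta /\ cvg (f (r%:C * zeta) @[r --> (1 : R)^'-])].

Definition radial_ext f zeta : R[i] :=
  lim (f (r%:C * zeta) @[r --> (1 : R)^'-]).

Definition inner_function f : Prop :=
  [/\ holomorphic_on_disc f,
      (forall z, unit_disc z -> unit_disc (f z)) &
      circle_ae (fun zeta => radial_dom f zeta /\
                             unit_circle (radial_ext f zeta))].

End Disc.

Section ForwardComposition.
Context {R : realType}.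
Variable f : nat -> R[i] -> R[i].

(* [f 0] is never used: the sequence of maps is f_1, f_2, ... *)
Fixpoint forward_comp (n : nat) : R[i] -> R[i] :=
  if n is m.+1 then f m.+1 \o forward_comp m else id.

Definition hyp_distortion (n : nat) : R :=
  hyp_density (forward_comp n 0)
    * Normc.normc (cderiv (f n) (forward_comp n.-1 0))
    / hyp_density (forward_comp n.-1 0).

Fixpoint boundary_comp (n : nat) : R[i] -> R[i] :=
  if n is m.+1 then radial_ext (f m.+1) \o boundary_comp m else id.

(* The points of the circle at which every boundary composition is defined
   (all of its successive values then lie on the circle). *)
Definition boundary_dom : set R[i] :=
  [set zeta | forall n, radial_dom (f n.+1) (boundary_comp n zeta)].

Definition Denjoy_Wolff_set : set R[i] :=
  [set zeta | boundary_dom zeta /\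
     Normc.normc (boundary_comp n zeta - forward_comp n 0)
       @[n --> \oo] --> (0 : R)].

End ForwardComposition.

(* Main.v *)
(* In the angular coordinate, the boundary map [g] of an inner function [f]
   transports harmonic measure: [hm z (g^-1 B) = hm (f z) B].  Indeed, [Re] of
   the Herglotz kernel is positive and harmonic, so composing it with [r f] and
   letting [r -> 1] gives [<=] on closed arcs, and the total masses agree.

   By the Schwarz-Pick lemma with distortion, each [f_j] contracts the odds
   [x / (1 - x)] of the pseudohyperbolic distance [x] to the orbit of [0] by
   [1 - mu_j / 3].  So, for arcs [I_n], the events [A_n = {F_n in I_n}] satisfy
     [2 pi P(A_n /\ A_m) <= P(A_m) (P(A_n) + K Q_m / Q_n)],  [n < m],
   with [Q_n = prod_(j <= n) (1 - mu_j / 18)].  As [sum_(n < m) mu_n Q_m / Q_n]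
   is at most [18], the sum of [mu_n 1_(A_n)] has second moment comparable to the
   square of its mean; the mean diverges for arcs of fixed length since
   [P(A_n) >= c (1 - |F_n(0)|)].  Hence almost every point lies in infinitely many
   [A_n].  Fixed arcs give density; arcs [I_n] away from [F_n(0)] show that the
   Denjoy-Wolff set is null. *)

Require Import Defs.
From HB Require Import structures.
From mathcomp Require Import all_boot all_order all_algebra.
From mathcomp Require Import all_classical all_reals all_analysis.
From mathcomp Require Import complex.
From mathcomp Require Import ring lra measurable_realfun.
Import Order.TTheory GRing.Theory Num.Theory.
Import numFieldNormedType.Exports.
Local Open Scope classical_set_scope.
Local Open Scope ring_scope.
Local Open Scope complex_scope.

Set Implicit Arguments.
Unset Strict Implicit.
Unset Printing Implicit Defensive.

(** * Goursat's lemma for closed forms on a rectangle *)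

(** Two demands shape the correlation bound. Its error must carry the factor [P(A_m)], which may be
    arbitrarily small, and it must be linear in [q = Q_m / Q_n], so that the weighted sum
    telescopes. A sharp arc cannot be followed through the later maps: only harmonic measures seen
    from points of the disc are transported. So the event [F_n in I_n] is replaced by an average of
    Poisson kernels. In the angular coordinate centred at [a = F_n(0)], a kernel of radius [r] times
    the density seen from [a] is the density seen from a point at pseudohyperbolic distance [r] from
    [a]. The later maps bring all these points close to [F_m(0)], where Harnack's inequality gives a
    multiplicative comparison. The exponents balance as follows. With [r = 1 - q^3] the odds are
    about [q^-3], so a contraction of the odds by [q^6] leaves a Harnack error of order [q^3];
    widening the arc by [q] on both sides leaves a kernel tail of order [q^3 / q^2 = q]. *)

Section Bisect.
Context {R : realType}.
Local Notation box := (R * R * R * R)%type.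

Definition quarter (i j : bool) (q : box) : box :=
  let: (a, b, c, d) := q in
  let m := (a + b) / 2 in let n := (c + d) / 2 in
  (if i then m else a, if i then b else m, if j then n else c, if j then d else n).

(** Compactness in the form of Cousin's principle. If [P] failed, repeated quartering would produce
    nested failing rectangles that shrink to a point, and the local hypothesis at that point would
    contradict this. *)
Lemma bisection (P : R -> R -> R -> R -> Prop) (a b c d : R) :
  a <= b -> c <= d ->
  (forall a' b' c' d', a <= a' -> a' <= b' -> b' <= b ->
     c <= c' -> c' <= d' -> d' <= d ->
     let m := (a' + b') / 2 in let n := (c' + d') / 2 in
     P a' m c' n -> P m b' c' n -> P a' m n d' -> P m b' n d' -> P a' b' c' d') ->
  (forall x y, a <= x <= b -> c <= y <= d -> exists2 e, 0 < e &
     forall a' b' c' d', a <= a' -> a' <= x <= b' -> b' <= b ->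
       c <= c' -> c' <= y <= d' -> d' <= d ->
       b' - a' < e -> d' - c' < e -> P a' b' c' d') ->
  P a b c d.
Proof.
move=> ab cd sub loc; apply: contrapT => nP.
pose inv (q : box) := let: (a', b', c', d') := q in
  [/\ a <= a', a' <= b', b' <= b & [/\ c <= c', c' <= d' & d' <= d]] /\
  ~ P a' b' c' d'.
have step q : inv q -> exists ij : bool * bool, inv (quarter ij.1 ij.2 q).
  case: q => [[[a' b'] c'] d'] [[h1 h2 h3 [h4 h5 h6]] nPq].
  apply: contrapT => nex; apply: nPq; apply: sub => //=.
  - apply: contrapT => nPi; apply: nex; exists (false, false) => /=.
    by split=> //; split; [lra|lra|lra|split; lra].
  - apply: contrapT => nPi; apply: nex; exists (true, false) => /=.
    by split=> //; split; [lra|lra|lra|split; lra].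
  - apply: contrapT => nPi; apply: nex; exists (false, true) => /=.
    by split=> //; split; [lra|lra|lra|split; lra].
  - apply: contrapT => nPi; apply: nex; exists (true, true) => /=.
    by split=> //; split; [lra|lra|lra|split; lra].
(* A failing rectangle is sent to one of its failing quarters; other quadruples stay put, so that
   [nxt] is total and can be iterated. *)
pose nxt q := if pselect (inv q) is left h then
  quarter (projT1 (cid (step q h))).1 (projT1 (cid (step q h))).2 q else q.
have nxtinv q : inv q -> inv (nxt q).
  move=> h; rewrite /nxt; case: pselect => // h'; exact: (projT2 (cid (step q h'))).
have nxtq q : inv q -> exists i j, nxt q = quarter i j q.
  by move=> h; rewrite /nxt; case: pselect => // h'; do 2 eexists.
pose q n := iter n nxt (a, b, c, d).
have qinv n : inv (q n).
  elim: n => [|n IH] /=; last exact: nxtinv.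
  by split=> //; split=> //; split.
pose A n := (q n).1.1.1; pose B n := (q n).1.1.2.
pose Cc n := (q n).1.2; pose Dd n := (q n).2.
have qE n : q n = (A n, B n, Cc n, Dd n) by rewrite /A /B /Cc /Dd; case: (q n) => [[[]]].
have invE n : [/\ a <= A n, A n <= B n, B n <= b & [/\ c <= Cc n, Cc n <= Dd n & Dd n <= d]] /\
  ~ P (A n) (B n) (Cc n) (Dd n).
  by have := qinv n; rewrite qE.
have stepE n : [/\ A n <= A n.+1, B n.+1 <= B n, Cc n <= Cc n.+1, Dd n.+1 <= Dd n
   & B n.+1 - A n.+1 = (B n - A n) / 2 /\ Dd n.+1 - Cc n.+1 = (Dd n - Cc n) / 2].
  have [i [j]] := nxtq _ (qinv n).
  have -> : nxt (q n) = q n.+1 by [].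
  have [[h1 h2 h3 [h4 h5 h6]] _] := invE n.
  rewrite (qE n.+1) (qE n) /= => -[-> -> -> ->].
  have [m1 m2] := midf_le h2; have [n1 n2] := midf_le h5.
  by case: i; case: j; split=> //; split; field.
have wid n : B n - A n = (b - a) / 2 ^+ n /\ Dd n - Cc n = (d - c) / 2 ^+ n.
  elim: n => [|n [IH1 IH2]]; first by rewrite expr0 !divr1.
  have [_ _ _ _ [-> ->]] := stepE n; rewrite IH1 IH2 exprSr.
  by split; field; rewrite expf_neq0.
have mono n m : (n <= m)%N -> [/\ A n <= A m, B m <= B n, Cc n <= Cc m & Dd m <= Dd n].
  move=> /subnK <-; elim: (m - n)%N => [|k [h1 h2 h3 h4]]; first by rewrite add0n; split.
  by have [] := stepE (k + n)%N; rewrite addSn => g1 g2 g3 g4 _; split;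
    [exact: le_trans g1|exact: le_trans h2|exact: le_trans g3|exact: le_trans h4].
have le_ab n m : A n <= B m /\ Cc n <= Dd m.
  have [g1 _ g3 _] := mono _ _ (leq_maxl n m).
  have [_ g2 _ g4] := mono _ _ (leq_maxr n m).
  have [[h1 h2 h3 [h4 h5 h6]] _] := invE (maxn n m).
  by split; lra.
(* Every left end lies below every right end, so the suprema of the left and lower ends give a point
   common to all rectangles. *)
pose x := sup (range A); pose y := sup (range Cc).
have hx n : A n <= x <= B n.
  apply/andP; split.
    apply: ub_le_sup; last by exists n.
    by exists (B 0%N) => _ [m _ <-]; exact: (le_ab m 0%N).1.
  apply: sup_le_ub; first by exists (A 0%N); exists 0%N.
  by move=> _ [m _ <-]; exact: (le_ab m n).1.
have hy n : Cc n <= y <= Dd n.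
  apply/andP; split.
    apply: ub_le_sup; last by exists n.
    by exists (Dd 0%N) => _ [m _ <-]; exact: (le_ab m 0%N).2.
  apply: sup_le_ub; first by exists (Cc 0%N); exists 0%N.
  by move=> _ [m _ <-]; exact: (le_ab m n).2.
have [|//|e e0 he] := loc x y; [exact: (hx 0%N)|exact: (hy 0%N)|].
have [n hn] : exists n : nat, (b - a) / 2 ^+ n < e /\ (d - c) / 2 ^+ n < e.
  pose K := (b - a) + (d - c) + 1.
  have K0 : 0 < K by rewrite /K; lra.
  have := archi_boundP (ltW (divr_gt0 K0 e0)).
  set n := Num.Def.archi_bound _ => hn; exists n.
  have h2n : n%:R <= 2 ^+ n :> R by rewrite -natrX ler_nat ltnW// ltn_expl.
  have p0 : 0 < 2 ^+ n :> R by rewrite exprn_gt0.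
  rewrite !ltr_pdivrMr//.
  have : K < e * 2 ^+ n.
    by rewrite mulrC -ltr_pdivrMr//; exact: lt_le_trans hn h2n.
  by rewrite /K; lra.
have [[h1 h2 h3 [h4 h5 h6]] nPn] := invE n; apply: nPn; apply: he => //; [by have [-> _] := wid n; case: hn|by have [_ ->] := wid n; case: hn].
Qed.
End Bisect.

Section IntervalIntegrals.
Context {R : realType}.
Local Notation mu := (@lebesgue_measure R).
Implicit Types (f g : R -> R) (a b c : R).

Lemma within_continuousP a b f :
  (forall x, a <= x <= b -> forall e, 0 < e -> exists2 d, 0 < d &
     forall y, a <= y <= b -> `|y - x| < d -> `|f y - f x| <= e) ->
  {within `[a, b], continuous f}.
Proof.
move=> H; apply/subspace_continuousP => x xab.
apply/cvgrPdist_le => e e0.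
have [|d d0 hd] := H x _ e e0; first by move: xab => /=; rewrite in_itv.
apply/nbhs_ballP; exists d => //= y xy yab; rewrite distrC; apply: hd.
  by move: yab; rewrite /= in_itv.
by move: xy; rewrite /ball/= distrC.
Qed.

Lemma integrable_within a b f : {within `[a, b], continuous f} ->
  mu.-integrable `[a, b] (EFin \o f).
Proof. by move=> cf; apply: continuous_compact_integrable => //; exact: segment_compact. Qed.

Lemma Rintegral_split a b c f : a <= b -> b <= c ->
  {within `[a, c], continuous f} ->
  \int[mu]_(t in `[a, c]) f t =
    \int[mu]_(t in `[a, b]) f t + \int[mu]_(t in `[b, c]) f t.
Proof.
move=> ab bc cf; have fi := integrable_within cf.
have := @Rintegral_itvB R f (BLeft a) (BRight c) b fi.
rewrite !bnd_simp => /(_ ab bc) /eqP; rewrite subr_eq => /eqP ->.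
rewrite addrC; congr (_ + _).
apply: Rintegral_itv_obnd_cbnd.
by apply: integrableS fi => //; apply: subset_itvr; rewrite bnd_simp.
Qed.

Lemma Rintegral_cst_itv a b (k : R) : a <= b ->
  \int[mu]_(t in `[a, b]) k = k * (b - a).
Proof.
move=> ab; rewrite -[LHS]/(\int[mu]_(t in `[a, b]) (cst k t)) Rintegral_cst//=.
by rewrite lebesgue_measure_itv/= lte_fin; move: ab; rewrite le_eqVlt => /predU1P[->|->] //; rewrite ltxx subrr.
Qed.

Lemma le_norm_Rintegral a b f (M : R) : a <= b -> 
  {within `[a, b], continuous f} -> (forall t, a <= t <= b -> `|f t| <= M) ->
  `|\int[mu]_(t in `[a, b]) f t| <= M * (b - a).
Proof.
move=> ab cf hM; apply: le_trans (le_normr_Rintegral _ (integrable_within cf)) _ => //.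
have -> : M * (b - a) = \int[mu]_(t in `[a, b]) (cst M t).
  by rewrite Rintegral_cst_itv.
apply: le_Rintegral => //.
- apply: integrable_within; move=> x; apply: continuous_comp; last exact: norm_continuous.
  exact: cf.
- by apply: integrable_within => x; exact: cvg_cst.
Qed.

Lemma RintegralB_within a b f g : {within `[a, b], continuous f} ->
  {within `[a, b], continuous g} ->
  \int[mu]_(t in `[a, b]) (f t - g t) =
  \int[mu]_(t in `[a, b]) f t - \int[mu]_(t in `[a, b]) g t.
Proof. by move=> cf cg; rewrite -RintegralB//; exact: integrable_within. Qed.

End IntervalIntegrals.

Section Goursat.
Context {R : realType}.
Local Notation mu := (@lebesgue_measure R).

(** Total differentiability relative to the closed box, hence one-sided on its boundary. Nothing is
    asked of how [ux] and [uy] vary from point to point. *)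
Definition differentiable_on_box (u : R -> R -> R) (ux uy : R -> R -> R) (a b c d : R) :=
  forall x y, a <= x <= b -> c <= y <= d -> forall e, 0 < e ->
  exists2 r, 0 < r & forall x' y', a <= x' <= b -> c <= y' <= d ->
    `|x' - x| < r -> `|y' - y| < r ->
    `|u x' y' - u x y - ux x y * (x' - x) - uy x y * (y' - y)| <=
      e * (`|x' - x| + `|y' - y|).

Lemma differentiable_on_box_continuous u ux uy a b c d :
  differentiable_on_box u ux uy a b c d ->
  (forall x, a <= x <= b -> {within `[c, d], continuous (u x)}) /\
  (forall y, c <= y <= d -> {within `[a, b], continuous (u^~ y)}).
Proof.
move=> H; split.
- move=> x xab; apply: within_continuousP => y ycd e e0.
  have [r r0 hr] := H x y xab ycd 1 ltr01.
  pose K := `|uy x y| + 1.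
  have K0 : 0 < K by rewrite /K ltr_wpDl.
  exists (Num.min r (e / K)); first by rewrite lt_min r0 divr_gt0.
  move=> y' y'cd; rewrite lt_min => /andP[h1 h2].
  have := hr x y' xab y'cd; rewrite subrr normr0 => /(_ r0 h1).
  rewrite mulr0 subr0 add0r mul1r => h.
  rewrite -[_ - _](subrK (uy x y * (y' - y))).
  apply: (@le_trans _ _ (K * `|y' - y|)); last first.
    by rewrite mulrC -ler_pdivlMr// ltW.
  by apply: le_trans (ler_normD _ _) _; rewrite /K mulrDl mul1r addrC normrM lerD2l.
- move=> y ycd; apply: within_continuousP => x xab e e0.
  have [r r0 hr] := H x y xab ycd 1 ltr01.
  pose K := `|ux x y| + 1.
  have K0 : 0 < K by rewrite /K ltr_wpDl.
  exists (Num.min r (e / K)); first by rewrite lt_min r0 divr_gt0.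
  move=> x' x'ab; rewrite lt_min => /andP[h1 h2].
  have := hr x' y x'ab ycd h1; rewrite subrr normr0 => /(_ r0).
  rewrite mulr0 subr0 addr0 mul1r => h.
  rewrite -[_ - _](subrK (ux x y * (x' - x))).
  apply: (@le_trans _ _ (K * `|x' - x|)); last first.
    by rewrite mulrC -ler_pdivlMr// ltW.
  by apply: le_trans (ler_normD _ _) _; rewrite /K mulrDl mul1r addrC normrM lerD2l.
Qed.

Lemma within_continuous_subitv (f : R -> R) a b a' b' : a <= a' -> b' <= b ->
  {within `[a, b], continuous f} -> {within `[a', b'], continuous f}.
Proof.
move=> h1 h2; apply: continuous_subspaceW => x /=.
by rewrite !in_itv/= => /andP[g1 g2]; rewrite (le_trans h1)//= (le_trans _ h2).
Qed.

Lemma dist_itv (a b x z : R) : a <= x <= b -> a <= z <= b -> `|z - x| <= b - a.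
Proof. by move=> /andP[? ?] /andP[? ?]; rewrite ler_norml; apply/andP; split; lra. Qed.

(** The affine part of [w] at [(x, y)] contributes exactly [p * (b - a) * (d - c)], because its [q]
    term is equal on the two vertical sides and cancels. The differentiability error, taken once per
    side, gives the bound. *)
Lemma increment_bound (w : R -> R -> R) (p q e x y a b c d : R) : 0 <= e ->
  a <= x <= b -> c <= y <= d ->
  {within `[c, d], continuous (w a)} -> {within `[c, d], continuous (w b)} ->
  (forall x' y', a <= x' <= b -> c <= y' <= d ->
    `|w x' y' - w x y - p * (x' - x) - q * (y' - y)| <= e * (`|x' - x| + `|y' - y|)) ->
  `|\int[mu]_(t in `[c, d]) w b t - \int[mu]_(t in `[c, d]) w a t
      - p * (b - a) * (d - c)| <= 2 * e * ((b - a) + (d - c)) * (d - c).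
Proof.
move=> e0 xab ycd ca cb H.
have ab : a <= b by case/andP: xab => /le_trans; apply.
have cd : c <= d by case/andP: ycd => /le_trans; apply.
have cba : {within `[c, d], continuous (fun t => w b t - w a t)}.
  by move=> t; apply: cvgB; [exact: cb|exact: ca].
have ck : {within `[c, d], continuous (fun=> p * (b - a))} by move=> t; exact: cvg_cst.
rewrite -Rintegral_cst_itv// -RintegralB_within// -RintegralB_within//.
apply: le_norm_Rintegral => //; first by move=> t; apply: cvgB; [exact: cba|exact: ck].
move=> t tcd.
have aab : a <= a <= b by rewrite lexx.
have bab : a <= b <= b by rewrite lexx ab.
have bd z : a <= z <= b -> e * (`|z - x| + `|t - y|) <= e * ((b - a) + (d - c)).
  by move=> zab; rewrite ler_wpM2l// lerD// dist_itv.
have w1 := le_trans (H b t bab tcd) (bd b bab).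
have w2 := le_trans (H a t aab tcd) (bd a aab).
have -> : w b t - w a t - p * (b - a) =
  (w b t - w x y - p * (b - x) - q * (t - y)) -
  (w a t - w x y - p * (a - x) - q * (t - y)) by ring.
apply: le_trans (ler_normB _ _) _; apply: le_trans (lerD w1 w2) _.
by rewrite -mulrA mulr2n mulrDl mul1r.
Qed.

(* Bisection, as in Goursat's proof: the partial derivatives of the closed form
   [u dy + v dx] need not be continuous. *)
Lemma goursat (u v ux uy vx : R -> R -> R) (a b c d : R) : a <= b -> c <= d ->
  differentiable_on_box u ux uy a b c d ->
  differentiable_on_box v vx ux a b c d ->
  \int[mu]_(y in `[c, d]) u b y - \int[mu]_(y in `[c, d]) u a y =
  \int[mu]_(x in `[a, b]) v x d - \int[mu]_(x in `[a, b]) v x c.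
Proof.
move=> ab cd Hu Hv.
have [cu _] := differentiable_on_box_continuous Hu.
have [_ cv] := differentiable_on_box_continuous Hv.
pose X a b c d := (\int[mu]_(y in `[c, d]) u b y - \int[mu]_(y in `[c, d]) u a y) -
  (\int[mu]_(x in `[a, b]) v x d - \int[mu]_(x in `[a, b]) v x c).
(* The bound is chosen to be additive under quartering: each quarter has half the semiperimeter, and
   four times a quarter of the square is the square. *)
suff H e : 0 < e -> `|X a b c d| <= e * ((b - a) + (d - c)) ^+ 2.
  apply/eqP; rewrite -subr_eq0 -normr_le0 -[leLHS]/(`|X a b c d|).
  apply/ler_addgt0Pl => e e0; rewrite addr0.
  pose D := (b - a) + (d - c).
  have D0 : 0 < D ^+ 2 + 1 by rewrite ltr_wpDl ?sqr_ge0.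
  apply: le_trans (H (e / (D ^+ 2 + 1)) _) _; first by rewrite divr_gt0.
  rewrite -/D -mulrA ger_pMr// ler_pdivrMl// mulr1.
  lra.
move=> e0.
apply: (@bisection _ (fun a b c d => `|X a b c d| <= e * ((b - a) + (d - c)) ^+ 2)) => //.
  move=> a' b' c' d' h1 h2 h3 h4 h5 h6 m n; rewrite /m /n => {m n}.
  set m := (a' + b') / 2; set n := (c' + d') / 2 => k1 k2 k3 k4.
  have [m1 m2] := midf_le h2; have [n1 n2] := midf_le h5; rewrite -/m -/n in m1 m2 n1 n2.
  have cu' x : a' <= x <= b' -> {within `[c', d'], continuous (u x)}.
    by move=> /andP[x1 x2]; apply: within_continuous_subitv (cu x _) => //; rewrite (le_trans h1) ?(le_trans x2).
  have cv' y : c' <= y <= d' -> {within `[a', b'], continuous (v^~ y)}.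
    by move=> /andP[y1 y2]; apply: within_continuous_subitv (cv y _) => //; rewrite (le_trans h4) ?(le_trans y2).
  have -> : X a' b' c' d' = X a' m c' n + X m b' c' n + X a' m n d' + X m b' n d'.
    rewrite /X (Rintegral_split n1 n2 (cu' b' _)) ?(Rintegral_split n1 n2 (cu' a' _))
      ?(Rintegral_split m1 m2 (cv' d' _)) ?(Rintegral_split m1 m2 (cv' c' _)) ?lexx ?h2 ?h5//.
    by ring.
  apply: le_trans (ler_normD _ _) _.
  apply: le_trans (lerD (ler_normD _ _) (lexx _)) _.
  apply: le_trans (lerD (lerD (ler_normD _ _) (lexx _)) (lexx _)) _.
  apply: le_trans (lerD (lerD (lerD k1 k2) k3) k4) _.
  by rewrite le_eqVlt; apply/orP; left; apply/eqP; rewrite /m /n; field.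
move=> x y xab ycd.
(* Each of the two applications of [increment_bound] doubles the error; with [e / 4] they add up to
   half of the allowed amount. *)
have e4 : 0 < e / 4 by rewrite divr_gt0.
have [r r0 hr] := Hu x y xab ycd _ e4.
have [s s0 hs] := Hv x y xab ycd _ e4.
exists (Num.min r s); first by rewrite lt_min r0.
move=> a' b' c' d' h1 h2 h3 h4 h5 h6; rewrite !lt_min => /andP[p1 p2] /andP[p3 p4].
have ab' : a' <= b' by case/andP: h2 => /le_trans; apply.
have cd' : c' <= d' by case/andP: h5 => /le_trans; apply.
have sx z : a' <= z <= b' -> a <= z <= b.
  by move=> /andP[z1 z2]; rewrite (le_trans h1)//= (le_trans z2).
have sy z : c' <= z <= d' -> c <= z <= d.
  by move=> /andP[z1 z2]; rewrite (le_trans h4)//= (le_trans z2).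
have cu' z : a' <= z <= b' -> {within `[c', d'], continuous (u z)}.
  by move=> /sx zab; exact: within_continuous_subitv (cu z zab).
have cv' z : c' <= z <= d' -> {within `[a', b'], continuous (v^~ z)}.
  by move=> /sy zcd; exact: within_continuous_subitv (cv z zcd).
have e40 := ltW e4.
have E1 := increment_bound e40 h2 h5 (cu' a' _) (cu' b' _) (p := ux x y) (q := uy x y).
have E2 := increment_bound (w := fun s t => v t s) e40 h5 h2 (cv' c' _) (cv' d' _)
  (p := ux x y) (q := vx x y).
have {}E1 := E1 ltac:(by rewrite lexx) ltac:(by rewrite lexx ab')
  (fun x' y' x1 y1 => hr x' y' (sx _ x1) (sy _ y1)
    (le_lt_trans (dist_itv h2 x1) p1) (le_lt_trans (dist_itv h5 y1) p3)).
have {}E2 := E2 ltac:(by rewrite lexx) ltac:(by rewrite lexx cd').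
have {}E2 : `|\int[mu]_(t in `[a', b']) v t d' - \int[mu]_(t in `[a', b']) v t c'
      - ux x y * (d' - c') * (b' - a')| <= 2 * (e / 4) * ((d' - c') + (b' - a')) * (b' - a').
  apply: E2 => s' t s1 t1; rewrite addrAC [X in _ <= _ * X]addrC addrAC.
  have := hs t s' (sx _ t1) (sy _ s1) (le_lt_trans (dist_itv h2 t1) p2) (le_lt_trans (dist_itv h5 s1) p4).
  by rewrite (addrAC _ (- (vx x y * _))).
set D := (b' - a') + (d' - c') in E1 *; rewrite (addrC (d' - c')) -/D in E2.
have D0 : 0 <= D by rewrite addr_ge0 ?subr_ge0.
(* Closedness enters here: [ux] is the first partial of [u] and also the second partial of [v], so
   the two affine contributions are the same number and cancel. *)
have -> : X a' b' c' d' =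
  (\int[mu]_(t in `[c', d']) u b' t - \int[mu]_(t in `[c', d']) u a' t - ux x y * (b' - a') * (d' - c')) -
  (\int[mu]_(t in `[a', b']) v t d' - \int[mu]_(t in `[a', b']) v t c' - ux x y * (d' - c') * (b' - a')).
  by rewrite /X; ring.
apply: le_trans (ler_normB _ _) _; apply: le_trans (lerD E1 E2) _.
have -> : 2 * (e / 4) * D * (d' - c') + 2 * (e / 4) * D * (b' - a') = e * D ^+ 2 / 2.
  by rewrite /D; field.
have : 0 <= e * D ^+ 2 by rewrite mulr_ge0 ?exprn_ge0// ltW.
lra.
Qed.

End Goursat.

(** * Complex derivatives in epsilon form *)

Section ComplexDerivative.
Context {R : realType}.
Local Notation C := R[i].
Local Notation nc := (@Normc.normc R).
Local Notation e_ := (@circle_point R).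
Implicit Types (z w : C) (f g h : C -> C).

Lemma normCE z : `|z| = (nc z)%:C. Proof. by case: z. Qed.

Lemma nc_ge0 z : 0 <= nc z. Proof. by case: z => a b /=; exact: sqrtr_ge0. Qed.

Lemma ncD z w : nc (z + w) <= nc z + nc w.
Proof. by rewrite -lecR -normCE rmorphD/= -!normCE ler_normD. Qed.

Lemma ncM z w : nc (z * w) = nc z * nc w. Proof. exact: Normc.normcM. Qed.

Lemma ncV z : nc z^-1 = (nc z)^-1. Proof. exact: Normc.normcV. Qed.

Lemma ncN z : nc (- z) = nc z.
Proof. by apply: (@complexI R); rewrite -!normCE normrN. Qed.

Lemma ncB z w : nc (z - w) <= nc z + nc w.
Proof. by rewrite -(ncN w); exact: ncD. Qed.

Lemma ncBC z w : nc (z - w) = nc (w - z). Proof. by rewrite -ncN opprB. Qed.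

Lemma nc0 : nc 0 = 0. Proof. exact: Normc.normc0. Qed.

Lemma nc1 : nc 1 = 1. Proof. exact: Normc.normc1. Qed.

Lemma nc_eq0 z : (nc z == 0) = (z == 0).
Proof. by rewrite -(inj_eq (@complexI R)) -normCE normr_eq0. Qed.

Lemma nc_gt0 z : (0 < nc z) = (z != 0).
Proof. by rewrite lt_def nc_ge0 andbT nc_eq0. Qed.

Lemma nc_real (x : R) : nc x%:C = `|x|.
Proof. by rewrite /= expr0n/= addr0 sqrtr_sqr. Qed.

Lemma nc_sqr z : nc z ^+ 2 = complex.Re z ^+ 2 + complex.Im z ^+ 2.
Proof. by case: z => a b /=; rewrite sqr_sqrtr// addr_ge0// sqr_ge0. Qed.

Lemma nc_conj z : nc (conjc z) = nc z.
Proof. by case: z => a b /=; rewrite sqrrN. Qed.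

Lemma mul_conj z : z * conjc z = (nc z ^+ 2)%:C.
Proof. by rewrite nc_sqr; case: z => a b /=; simpc; congr (_ +i* _); ring. Qed.

Lemma Re_le_nc z : `|complex.Re z| <= nc z.
Proof.
by case: z => a b /=; rewrite -sqrtr_sqr ler_sqrt ?lerDl ?sqr_ge0// addr_ge0// sqr_ge0.
Qed.

Lemma Im_le_nc z : `|complex.Im z| <= nc z.
Proof.
by case: z => a b /=; rewrite -sqrtr_sqr ler_sqrt ?lerDr ?sqr_ge0// addr_ge0// sqr_ge0.
Qed.

Lemma nc_le_ReIm z : nc z <= `|complex.Re z| + `|complex.Im z|.
Proof.
rewrite -(@ler_pXn2r _ 2%N) ?nnegrE ?nc_ge0 ?addr_ge0// nc_sqr sqrrD !real_normK ?num_real//.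
by rewrite lerD2r lerDl mulrn_wge0// mulr_ge0.
Qed.

Lemma ReB z w : complex.Re (z - w) = complex.Re z - complex.Re w.
Proof. by case: z; case: w. Qed.

Lemma ImB z w : complex.Im (z - w) = complex.Im z - complex.Im w.
Proof. by case: z; case: w. Qed.

Lemma nc_circle t : nc (e_ t) = 1.
Proof. by rewrite /= cos2Dsin2 sqrtr1. Qed.

(** A division-free formulation with real-valued norms: product, quotient and chain rules become
    inequalities in [R]. *)
Definition has_cderiv f z l := forall e : R, 0 < e -> exists2 d : R, 0 < d &
  forall w, nc (w - z) < d -> nc (f w - f z - l * (w - z)) <= e * nc (w - z).

Lemma derivable_has_cderiv f z : derivable f z 1 -> has_cderiv f z (cderiv f z).
Proof.
move=> df e e0.
have e0C : 0 < e%:C :> C by rewrite ltcR.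
move: (df); rewrite /derivable => /cvg_ex[l hl].
have {df} -> : cderiv f z = l.
  rewrite /cderiv derive1E /derive; apply: cvg_lim hl; exact: norm_hausdorff.
move/cvgrPdist_le : hl => /(_ e%:C e0C).
rewrite near_withinE /= => /nbhs_ballP[d d0 hd].
(* A positive element of [R[i]] has imaginary part 0, so the radius is a real number. *)
have dE : d = (complex.Re d)%:C.
  by move: d0; rewrite /= ltcE => /andP[/eqP/=]; case: d {hd} => a b /= ->.
exists (complex.Re d); first by rewrite -ltcR -dE.
move=> w wz; have [->|nwz] := eqVneq w z; first by rewrite !subrr mulr0 subrr nc0 mulr0.
have := hd (w - z); rewrite -ball_normE /= sub0r normrN normCE {1}dE ltcR wz.
rewrite subr_eq0 nwz => /(_ isT isT).
rewrite /GRing.scale/= mulr1 subrK.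
rewrite -[leLHS]normrN opprB normCE lecR => h.
have hwz : w - z != 0 by rewrite subr_eq0.
rewrite -[X in nc X]mulr1 -(mulVf hwz) mulrA [X in X * _]mulrC ncM ler_wpM2r ?nc_ge0//.
by move: h; rewrite [in leRHS]/=; congr (nc _ <= _); field.
Qed.

Lemma has_cderiv_cst k z : has_cderiv (fun=> k) z 0.
Proof.
by move=> e e0; exists 1 => // w _; rewrite subrr mul0r subrr nc0 mulr_ge0 ?nc_ge0 ?ltW.
Qed.

Lemma has_cderiv_id z : has_cderiv id z 1.
Proof.
by move=> e e0; exists 1 => // w _; rewrite mul1r subrr nc0 mulr_ge0 ?nc_ge0 ?ltW.
Qed.

Lemma has_cderiv_lip f z l : has_cderiv f z l -> exists2 d : R, 0 < d &
  forall w, nc (w - z) < d -> nc (f w - f z) <= (nc l + 1) * nc (w - z).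
Proof.
move=> /(_ 1 ltr01)[d d0 hd]; exists d => // w /hd; rewrite mul1r => h.
rewrite -[f w - f z](subrK (l * (w - z))) addrC mulrDl mul1r -ncM.
by apply: le_trans (ncD _ _) _; rewrite lerD2l.
Qed.

Lemma has_cderiv_cont f z l : has_cderiv f z l -> forall e : R, 0 < e ->
  exists2 d : R, 0 < d & forall w, nc (w - z) < d -> nc (f w - f z) < e.
Proof.
move=> /has_cderiv_lip[d d0 hd] e e0.
have K0 : 0 < nc l + 1 by rewrite ltr_wpDl ?nc_ge0.
exists (Num.min d (e / (nc l + 1))); first by rewrite lt_min d0 divr_gt0.
move=> w; rewrite lt_min => /andP[/hd h1 h2].
by apply: le_lt_trans h1 _; rewrite mulrC -ltr_pdivlMr.
Qed.

Lemma has_cderivD f g z k l : has_cderiv f z k -> has_cderiv g z l ->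
  has_cderiv (fun w => f w + g w) z (k + l).
Proof.
move=> hf hg e e0; have e2 : 0 < e / 2 by rewrite divr_gt0.
have [d d0 hd] := hf _ e2; have [d' d0' hd'] := hg _ e2.
exists (Num.min d d'); first by rewrite lt_min d0.
move=> w; rewrite lt_min => /andP[/hd h1 /hd' h2].
have -> : f w + g w - (f z + g z) - (k + l) * (w - z) =
  (f w - f z - k * (w - z)) + (g w - g z - l * (w - z)) by ring.
apply: le_trans (ncD _ _) _; lra.
Qed.

Lemma has_cderivM f g z k l : has_cderiv f z k -> has_cderiv g z l ->
  has_cderiv (fun w => f w * g w) z (k * g z + f z * l).
Proof.
move=> hf hg e e0.
pose K := nc (g z) + nc (f z) + nc l + 1.
have K0 : 0 < K by rewrite /K ltr_wpDl// !addr_ge0 ?nc_ge0.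
have eK : 0 < e / (3 * K) by rewrite divr_gt0// mulr_gt0.
have [d d0 hd] := hf _ eK; have [d' d0' hd'] := hg _ eK.
have m0 : 0 < Num.min (e / (3 * (nc k + 1))) 1.
  by rewrite lt_min ltr01 andbT divr_gt0// mulr_gt0// ltr_wpDl ?nc_ge0.
have [d1 d01 hd1] := has_cderiv_cont hg m0.
have [d2 d02 hd2] := has_cderiv_lip hf.
exists (Num.min (Num.min d d') (Num.min d1 d2)); first by rewrite !lt_min d0 d0' d01.
move=> w; rewrite !lt_min => /andP[/andP[/hd h1 /hd' h2] /andP[/hd1 h3 /hd2 h4]].
have -> : f w * g w - f z * g z - (k * g z + f z * l) * (w - z) =
  (f w - f z - k * (w - z)) * g z + f z * (g w - g z - l * (w - z)) +
  (f w - f z) * (g w - g z) by ring.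
move: h3; rewrite lt_min => /andP[h3 _].
have n0 := nc_ge0 (w - z).
apply: le_trans (ncD _ _) _; apply: le_trans (lerD (ncD _ _) (lexx _)) _; rewrite !ncM.
have q1 : nc (f w - f z - k * (w - z)) * nc (g z) <= e / 3 * nc (w - z).
  apply: le_trans (ler_wpM2r (nc_ge0 _) h1) _.
  have -> : e / (3 * K) * nc (w - z) * nc (g z) = e / 3 * nc (w - z) * (nc (g z) / K).
    by field; rewrite gt_eqF.
  rewrite ler_piMr ?mulr_ge0 ?divr_ge0 ?(ltW e0)//.
  by rewrite ler_pdivrMr// mul1r /K; move: (nc_ge0 (f z)) (nc_ge0 l); lra.
have q2 : nc (f z) * nc (g w - g z - l * (w - z)) <= e / 3 * nc (w - z).
  apply: le_trans (ler_wpM2l (nc_ge0 _) h2) _.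
  have -> : nc (f z) * (e / (3 * K) * nc (w - z)) = e / 3 * nc (w - z) * (nc (f z) / K).
    by field; rewrite gt_eqF.
  rewrite ler_piMr ?mulr_ge0 ?divr_ge0 ?(ltW e0)//.
  by rewrite ler_pdivrMr// mul1r /K; move: (nc_ge0 (g z)) (nc_ge0 l); lra.
have q3 : nc (f w - f z) * nc (g w - g z) <= e / 3 * nc (w - z).
  have kk : 0 < nc k + 1 by rewrite ltr_wpDl ?nc_ge0.
  apply: le_trans (ler_pM (nc_ge0 _) (nc_ge0 _) h4 (ltW h3)) _.
  have -> // : (nc k + 1) * nc (w - z) * (e / (3 * (nc k + 1))) = e / 3 * nc (w - z).
  by field; rewrite gt_eqF.
lra.
Qed.

Lemma has_cderiv_comp f g z k l : has_cderiv f z k -> has_cderiv g (f z) l ->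
  has_cderiv (fun w => g (f w)) z (l * k).
Proof.
move=> hf hg e e0.
have K0 : 0 < nc k + 1 by rewrite ltr_wpDl ?nc_ge0.
have L0 : 0 < nc l + 1 by rewrite ltr_wpDl ?nc_ge0.
have [d d0 hd] := hg _ (divr_gt0 e0 (mulr_gt0 (ltr0Sn R 1) K0) : 0 < e / (2 * (nc k + 1))).
have [d1 d01 hd1] := hf _ (divr_gt0 e0 (mulr_gt0 (ltr0Sn R 1) L0) : 0 < e / (2 * (nc l + 1))).
have [d2 d02 hd2] := has_cderiv_cont hf d0.
have [d3 d03 hd3] := has_cderiv_lip hf.
exists (Num.min d1 (Num.min d2 d3)); first by rewrite !lt_min d01 d02.
move=> w; rewrite !lt_min => /and3P[/hd1 h1 /hd2 /hd h2 /hd3 h3].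
have -> : g (f w) - g (f z) - l * k * (w - z) =
 (g (f w) - g (f z) - l * (f w - f z)) + l * (f w - f z - k * (w - z)) by ring.
apply: le_trans (ncD _ _) _; rewrite ncM.
have n0 := nc_ge0 (w - z).
have q1 : nc (g (f w) - g (f z) - l * (f w - f z)) <= e / 2 * nc (w - z).
  apply: le_trans h2 _; apply: le_trans (ler_wpM2l _ h3) _; first by rewrite divr_ge0 ?mulr_ge0// ltW.
  by rewrite le_eqVlt; apply/orP; left; apply/eqP; field; rewrite gt_eqF.
have q2 : nc l * nc (f w - f z - k * (w - z)) <= e / 2 * nc (w - z).
  apply: le_trans (ler_wpM2l (nc_ge0 _) h1) _.
  have -> : nc l * (e / (2 * (nc l + 1)) * nc (w - z)) = e / 2 * nc (w - z) * (nc l / (nc l + 1)).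
    by field; rewrite gt_eqF.
  rewrite ler_piMr ?mulr_ge0 ?divr_ge0 ?(ltW e0)//.
  by rewrite ler_pdivrMr// mul1r lerDl.
lra.
Qed.

Lemma has_cderivV z : z != 0 -> has_cderiv (fun w => w^-1) z (- (z ^- 2)).
Proof.
move=> z0 e e0.
have p0 : 0 < nc z by rewrite nc_gt0.
exists (Num.min (nc z / 2) (e * nc z ^+ 3 / 2)).
  by rewrite lt_min !divr_gt0 ?mulr_gt0 ?exprn_gt0.
move=> w; rewrite lt_min => /andP[h1 h2].
have w2 : nc z / 2 <= nc w.
  have := ncB w (w - z); rewrite opprB addrC subrK; lra.
have w0 : w != 0 by rewrite -nc_gt0; lra.
have -> : w^-1 - z^-1 - - z ^- 2 * (w - z) = (w - z) ^+ 2 * (z ^- 2 * w^-1).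
  by field; rewrite z0 w0.
rewrite expr2 !ncM !ncV expr2 ncM -mulrA mulrC ler_wpM2r ?nc_ge0//.
rewrite -expr2 -invfM ler_pdivrMr; last by rewrite mulr_gt0 ?exprn_gt0// nc_gt0.
apply: le_trans (ltW h2) _; rewrite -mulrA ler_pM2l//.
have -> : nc z ^+ 3 / 2 = nc z ^+ 2 * (nc z / 2) by field.
by rewrite ler_pM2l ?exprn_gt0.
Qed.

Lemma has_cderiv_ext f g z l (r : R) : 0 < r ->
  (forall w, nc (w - z) < r -> f w = g w) -> has_cderiv f z l -> has_cderiv g z l.
Proof.
move=> r0 fg hf e e0; have [d d0 hd] := hf e e0.
exists (Num.min d r); first by rewrite lt_min d0.
move=> w; rewrite lt_min => /andP[h1 h2]; rewrite -!fg ?subrr ?nc0//.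
exact: hd.
Qed.

Lemma has_cderiv_div f g z k l : has_cderiv f z k -> has_cderiv g z l -> g z != 0 ->
  has_cderiv (fun w => f w / g w) z (k / g z + f z * (- (g z ^- 2) * l)).
Proof.
move=> hf hg g0; apply: (has_cderivM hf).
exact: (has_cderiv_comp hg (has_cderivV g0)).
Qed.

(** This is [exp (s + i t)]. In these coordinates an annulus about 0 becomes a rectangle, to which
    [goursat] applies. *)
Definition polar_exp (s t : R) : C := (expR s)%:C * e_ t.

Lemma derive_eps (f : R -> R) (x l : R) : is_derive x (1 : R) f l -> forall e, 0 < e ->
  exists2 d, 0 < d & forall y, `|y - x| < d -> `|f y - f x - l * (y - x)| <= e * `|y - x|.
Proof.
move=> [df fl] e e0; move: df; rewrite /derivable => df.
have : h^-1 *: (f (h *: 1 + x) - f x) @[h --> 0^'] --> l by rewrite -fl; exact: df.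
move/cvgrPdist_le => /(_ e e0); rewrite near_withinE /= => /nbhs_ballP[d d0 hd].
exists d => // y yx; have [->|nyx] := eqVneq y x; first by rewrite !subrr mulr0 subrr normr0 mulr0.
have := hd (y - x); rewrite -ball_normE /= sub0r normrN yx subr_eq0 nyx => /(_ isT isT).
rewrite /GRing.scale/= mulr1 subrK => h.
have hwz : y - x != 0 by rewrite subr_eq0.
rewrite -[X in `|X|]mulr1 -(mulVf hwz) mulrA [X in X * _]mulrC normrM ler_wpM2r//.
by rewrite -normrN; move: h; congr (Num.norm _ <= _); field.
Qed.

Lemma circle_eps t e : 0 < e -> exists2 d : R, 0 < d & forall t', `|t' - t| < d ->
  nc (e_ t' - e_ t - 'i * e_ t * (t' - t)%:C) <= e * `|t' - t|.
Proof.
move=> e0; have e2 : 0 < e / 2 by rewrite divr_gt0.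
have [d d0 hd] := derive_eps (is_derive_cos t) e2.
have [d' d0' hd'] := derive_eps (is_derive_sin t) e2.
exists (Num.min d d'); first by rewrite lt_min d0.
move=> t'; rewrite lt_min => /andP[/hd h1 /hd' h2].
apply: le_trans (nc_le_ReIm _) _; rewrite /circle_point; simpc => /=.
move: h1 h2; rewrite mulNr opprK; lra.
Qed.

Lemma polar_exp_eps s t e : 0 < e -> exists2 d : R, 0 < d &
  forall s' t', `|s' - s| < d -> `|t' - t| < d ->
  nc (polar_exp s' t' - polar_exp s t - polar_exp s t * ((s' - s) +i* (t' - t)))
    <= e * (`|s' - s| + `|t' - t|).
Proof.
move=> e0; set E := expR s.
have E0 : 0 < E by exact: expR_gt0.
have [d d0 hd] := derive_eps (is_derive_expR s) (divr_gt0 e0 (ltr0Sn R 2) : 0 < e / 3).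
have [d' d0' hd'] := circle_eps t (divr_gt0 e0 (mulr_gt0 (ltr0Sn R 2) E0) : 0 < e / (3 * E)).
have [d1 d10 hd1] := circle_eps t ltr01.
exists (Num.min (Num.min d d') (Num.min d1 (e / (6 * E)))).
  by rewrite !lt_min d0 d0' d10 divr_gt0// mulr_gt0.
move=> s' t'; rewrite !lt_min => /andP[/andP[/hd h1 _] _] /andP[/andP[_ /hd' h2] /andP[/hd1 h3 h4]].
have -> : polar_exp s' t' - polar_exp s t - polar_exp s t * ((s' - s) +i* (t' - t)) =
  (expR s' - E - E * (s' - s))%:C * e_ t' + (E * (s' - s))%:C * (e_ t' - e_ t) +
  E%:C * (e_ t' - e_ t - 'i * e_ t * (t' - t)%:C).
  by rewrite /polar_exp -/E /circle_point; simpc; congr (_ +i* _); ring.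
apply: le_trans (ncD _ _) _; apply: le_trans (lerD (ncD _ _) (lexx _)) _; rewrite !ncM !nc_real nc_circle mulr1.
have a0 := normr_ge0 (s' - s); have b0 := normr_ge0 (t' - t).
have q1 : `|expR s' - E - E * (s' - s)| <= e / 3 * `|s' - s| by [].
have q2 : `|E * (s' - s)| * nc (e_ t' - e_ t) <= e / 3 * `|s' - s|.
  have : nc (e_ t' - e_ t) <= 2 * `|t' - t|.
    rewrite -[_ - _ in leLHS](subrK ('i * e_ t * (t' - t)%:C)).
    apply: le_trans (ncD _ _) _; move: h3; rewrite !ncM nc_real nc_circle.
    have -> : nc 'i = 1 by rewrite /= expr0n expr1n add0r sqrtr1.
    lra.
  move=> h; have {}h := le_trans h (ler_wpM2l (ler0n R 2) (ltW h4)).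
  rewrite normrM (gtr0_norm E0) [leRHS]mulrC mulrAC [X in X <= _]mulrC ler_wpM2l//.
  apply: le_trans (ler_wpM2l (ltW E0) h) _.
  by rewrite le_eqVlt; apply/orP; left; apply/eqP; field; rewrite gt_eqF.
have q3 : `|E| * nc (e_ t' - e_ t - 'i * e_ t * (t' - t)%:C) <= e / 3 * `|t' - t|.
  rewrite gtr0_norm//; apply: le_trans (ler_wpM2l (ltW E0) h2) _.
  by rewrite le_eqVlt; apply/orP; left; apply/eqP; field; rewrite gt_eqF.
have := mulr_ge0 (ltW e0) b0; have := mulr_ge0 (ltW e0) a0.
lra.
Qed.

End ComplexDerivative.

(** * Mean value property and Poisson formula *)

Section MeanValue.
Context {R : realType}.
Local Notation C := R[i].
Local Notation nc := (@Normc.normc R).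
Local Notation e_ := (@circle_point R).
Local Notation mu := (@lebesgue_measure R).
Implicit Types (z w : C) (f g h : C -> C).

Lemma nc_polar_exp (s t : R) : nc (polar_exp s t) = expR s.
Proof. by rewrite /polar_exp ncM nc_real nc_circle mulr1 gtr0_norm ?expR_gt0. Qed.

Lemma has_cderiv_polar_exp h l (s t : R) : has_cderiv h (polar_exp s t) l ->
  forall e, 0 < e -> exists2 d : R, 0 < d & forall s' t',
  `|s' - s| < d -> `|t' - t| < d ->
  nc (h (polar_exp s' t') - h (polar_exp s t) -
      l * polar_exp s t * ((s' - s) +i* (t' - t))) <= e * (`|s' - s| + `|t' - t|).
Proof.
set z := polar_exp s t => hh e e0.
have K0 : 0 < nc z + 1 by rewrite ltr_wpDl ?nc_ge0.
have L0 : 0 < nc l + 1 by rewrite ltr_wpDl ?nc_ge0.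
have [d d0 hd] := hh _ (divr_gt0 e0 (mulr_gt0 (ltr0Sn R 1) K0) : 0 < e / (2 * (nc z + 1))).
have [d1 d10 hd1] := polar_exp_eps s t (divr_gt0 e0 (mulr_gt0 (ltr0Sn R 1) L0) : 0 < e / (2 * (nc l + 1))).
have [d2 d20 hd2] := polar_exp_eps s t ltr01.
exists (Num.min (Num.min d1 d2) (d / (2 * (nc z + 1)))).
  by rewrite !lt_min d10 d20 divr_gt0 ?mulr_gt0.
move=> s' t'; rewrite !lt_min => /andP[/andP[a1 a2] a3] /andP[/andP[b1 b2] b3].
set z' := polar_exp s' t'; set D := `|s' - s| + `|t' - t|.
have D0 : 0 <= D by rewrite addr_ge0.
have h1 := hd1 s' t' a1 b1; have h2 := hd2 s' t' a2 b2.
have ncD' : nc ((s' - s) +i* (t' - t)) <= D by exact: (nc_le_ReIm ((s' - s) +i* (t' - t))).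
have h3 : nc (z' - z) <= (nc z + 1) * D.
  rewrite -[z' - z](subrK (z * ((s' - s) +i* (t' - t)))).
  apply: le_trans (ncD _ _) _; rewrite ncM mulrDl addrC lerD//.
  by rewrite ler_wpM2l ?nc_ge0.
have zd : nc (z' - z) < d.
  apply: le_lt_trans h3 _; rewrite mulrC -ltr_pdivlMr//.
  have -> : d / (nc z + 1) = d / (2 * (nc z + 1)) + d / (2 * (nc z + 1)).
    by field; rewrite gt_eqF.
  exact: ltrD.
have -> : h z' - h z - l * z * ((s' - s) +i* (t' - t)) = (h z' - h z - l * (z' - z)) +
   l * (z' - z - z * ((s' - s) +i* (t' - t))) by ring.
apply: le_trans (ncD _ _) _; rewrite ncM.
have q1 : nc (h z' - h z - l * (z' - z)) <= e / 2 * D.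
  apply: le_trans (hd _ zd) _; apply: le_trans (ler_wpM2l _ h3) _.
    by rewrite divr_ge0 ?mulr_ge0// ltW.
  by rewrite le_eqVlt; apply/orP; left; apply/eqP; field; rewrite gt_eqF.
have q2 : nc l * nc (z' - z - z * ((s' - s) +i* (t' - t))) <= e / 2 * D.
  apply: le_trans (ler_wpM2l (nc_ge0 _) h1) _.
  have -> : nc l * (e / (2 * (nc l + 1)) * D) = e / 2 * D * (nc l / (nc l + 1)).
    by field; rewrite gt_eqF.
  rewrite ler_piMr ?mulr_ge0 ?divr_ge0 ?(ltW e0)//.
  by rewrite ler_pdivrMr// mul1r lerDl.
lra.
Qed.

(** The Cauchy-Riemann equations in logarithmic polar coordinates. The shared partial
    [complex.Re (F s t)] is what makes the form [Re h dt + Im h ds] closed. *)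
Lemma differentiable_on_box_polar h (l : C -> C) (a b c d : R) :
  (forall s t, a <= s <= b -> has_cderiv h (polar_exp s t) (l (polar_exp s t))) ->
  let F s t := l (polar_exp s t) * polar_exp s t in
  differentiable_on_box (fun s t => complex.Re (h (polar_exp s t)))
    (fun s t => complex.Re (F s t)) (fun s t => - complex.Im (F s t)) a b c d /\
  differentiable_on_box (fun s t => complex.Im (h (polar_exp s t)))
    (fun s t => complex.Im (F s t)) (fun s t => complex.Re (F s t)) a b c d.
Proof.
move=> hh F; split=> s t sab tcd e e0;
    have [r r0 hr] := has_cderiv_polar_exp (hh s t sab) e0;
    exists r => // s' t' _ _ sr tr; apply: le_trans (hr s' t' sr tr).
- apply: le_trans (Re_le_nc _); rewrite !ReB.
  rewrite /F; case: (l _ * _) => x y /=; simpc => /=.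
  rewrite le_eqVlt; apply/orP; left; apply/eqP; congr (`|_|); ring.
- apply: le_trans (Im_le_nc _); rewrite !ImB.
  rewrite /F; case: (l _ * _) => x y /=; simpc => /=.
  rewrite le_eqVlt; apply/orP; left; apply/eqP; congr (`|_|); ring.
Qed.

Lemma circle_point_periodic (t : R) : e_ (t + 2 * pi) = e_ t.
Proof.
by rewrite /circle_point mulr_natl cosD2pi sinD2pi.
Qed.

(** Goursat on the rectangle of logarithmic polar coordinates: the sides at angles [c] and
    [c + 2 * pi] carry the same values of [h] and cancel, leaving the two circular means. *)
Lemma circle_mean_cst h (a b c : R) : a <= b ->
  (forall w, expR a <= nc w <= expR b -> exists l, has_cderiv h w l) ->
  \int[mu]_(t in `[c, c + 2 * pi]) complex.Re (h (polar_exp b t)) =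
  \int[mu]_(t in `[c, c + 2 * pi]) complex.Re (h (polar_exp a t)).
Proof.
move=> ab hh.
pose l w := if pselect (exists l, has_cderiv h w l) is left hl then projT1 (cid hl) else 0.
have hl s t : a <= s <= b -> has_cderiv h (polar_exp s t) (l (polar_exp s t)).
  move=> /andP[h1 h2]; have ex := hh (polar_exp s t).
  rewrite /l; case: pselect => [ex'|nex]; first exact: (projT2 (cid ex')).
  by exfalso; apply: nex; apply: ex; rewrite nc_polar_exp !ler_expR h1.
have cpi : c <= c + 2 * pi by rewrite lerDl mulr_ge0// pi_ge0.
have [H1 H2] := @differentiable_on_box_polar h l a b c (c + 2 * pi) hl.
apply/eqP; rewrite -subr_eq0; apply/eqP; rewrite (goursat ab cpi H1 H2).
apply/eqP; rewrite subr_eq0; apply/eqP; apply: eq_Rintegral => s _.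
by rewrite /polar_exp circle_point_periodic.
Qed.

Lemma polar_exp_ln (r t : R) : 0 < r -> polar_exp (ln r) t = r%:C * e_ t.
Proof. by move=> r0; rewrite /polar_exp lnK// posrE. Qed.

Lemma continuous_on_circles h (rho r a b : R) : 0 < r < rho ->
  (forall w, 0 < nc w < rho -> exists l, has_cderiv h w l) ->
  {within `[a, b], continuous (fun t => complex.Re (h (r%:C * e_ t)))}.
Proof.
move=> /andP[r0 rrho] hh; apply: within_continuousP => t tab e e0.
have [|l hl] := hh (r%:C * e_ t); first by rewrite ncM nc_real nc_circle mulr1 gtr0_norm ?r0.
have [d d0 hd] := has_cderiv_cont hl e0.
have [d' d0' hd'] := circle_eps t ltr01.
exists (Num.min d' (d / (2 * r))); first by rewrite lt_min d0' divr_gt0// mulr_gt0.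
move=> t' _; rewrite lt_min => /andP[/hd' h1 h2].
rewrite -ReB; apply: le_trans (Re_le_nc _) (ltW (hd _ _)).
rewrite -mulrBr ncM nc_real gtr0_norm//.
have h3 : nc (e_ t' - e_ t) <= 2 * `|t' - t|.
  rewrite -[_ - _ in leLHS](subrK ('i * e_ t * (t' - t)%:C)).
  apply: le_trans (ncD _ _) _; move: h1; rewrite !ncM nc_real nc_circle.
  have -> : nc 'i = 1 by rewrite /= expr0n expr1n add0r sqrtr1.
  lra.
move: h2; rewrite ltr_pdivlMr ?mulr_gt0// => h2.
by apply: le_lt_trans (ler_wpM2l (ltW r0) h3) _; rewrite mulrA mulrC [r * 2]mulrC.
Qed.

(** Circular means do not depend on the radius and tend to the value at the centre. Asking only for
    a limit [L] at 0 lets the theorem be applied to quotients such as [G w / w], without removing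
    the singularity first. *)
Theorem mean_value h (L : C) (rho r c : R) : 0 < r < rho ->
  (forall w, 0 < nc w < rho -> exists l, has_cderiv h w l) ->
  (forall e, 0 < e -> exists2 d : R, 0 < d &
     forall w, 0 < nc w < d -> nc (h w - L) <= e) ->
  \int[mu]_(t in `[c, c + 2 * pi]) complex.Re (h (r%:C * e_ t)) = 2 * pi * complex.Re L.
Proof.
move=> /andP[r0 rrho] hh hL.
have cpi : c <= c + 2 * pi by rewrite lerDl mulr_ge0// pi_ge0.
have pi2 : 0 < 2 * pi :> R by rewrite mulr_gt0// pi_gt0.
apply/eqP; rewrite -subr_eq0 -normr_le0; apply/ler_addgt0Pl => e e0; rewrite addr0.
have [d d0 hd] := hL (e / (2 * pi)) (divr_gt0 e0 pi2).
(* Half of [r] keeps the new circle inside the old one; half of [d] puts it where [h] is close to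
   [L]. *)
pose r' := Num.min (r / 2) (d / 2).
have r'0 : 0 < r' by rewrite lt_min !divr_gt0.
have r'r : r' <= r / 2 by rewrite ge_min lexx.
have r'd : r' <= d / 2 by rewrite ge_min lexx orbT.
have -> : \int[mu]_(t in `[c, c + 2 * pi]) complex.Re (h (r%:C * e_ t)) =
  \int[mu]_(t in `[c, c + 2 * pi]) complex.Re (h (r'%:C * e_ t)).
  under eq_Rintegral do rewrite -polar_exp_ln//.
  under [RHS]eq_Rintegral do rewrite -polar_exp_ln//.
  apply: circle_mean_cst; first by rewrite ler_ln ?posrE//; lra.
  by move=> w; rewrite !lnK ?posrE// => ?; apply: hh; lra.
have -> : 2 * pi * complex.Re L = \int[mu]_(t in `[c, c + 2 * pi]) complex.Re L.
  by rewrite Rintegral_cst_itv// addrAC subrr add0r mulrC.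
have r'h : 0 < r' < rho by rewrite r'0/=; lra.
have cL : {within `[c, c + 2 * pi], continuous (fun=> complex.Re L)} by move=> x; exact: cvg_cst.
have ch := @continuous_on_circles h rho r' c (c + 2 * pi) r'h hh.
rewrite -RintegralB_within//.
have -> : e = e / (2 * pi) * (c + 2 * pi - c).
  by rewrite addrAC subrr add0r divfK ?lt0r_neq0.
apply: le_norm_Rintegral => //.
  by move=> x; apply: cvgB; [exact: ch|exact: cL].
move=> t _; rewrite -ReB; apply: le_trans (Re_le_nc _) _; apply: hd.
by rewrite ncM nc_real nc_circle mulr1 gtr0_norm// r'0/=; lra.
Qed.

End MeanValue.

(** * Moebius maps of the disc, the Poisson kernel and Harnack's inequality *)

Section Moebius.
Context {R : realType}.
Local Notation C := R[i].
Local Notation nc := (@Normc.normc R).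
Local Notation e_ := (@circle_point R).
Local Notation cj := (@conjc R).
Implicit Types (a b z w : C).

Definition mob a z : C := (z - a) / (1 - cj a * z).

(* The Poisson kernel; [pkr] below is its form in polar coordinates. *)
Definition pk z w : R := (1 - nc z ^+ 2) / nc (w - z) ^+ 2.

Lemma mob_den_gt0 a z : nc a < 1 -> nc z <= 1 -> 0 < nc (1 - cj a * z).
Proof.
move=> a1 z1; have h : nc (cj a * z) < 1.
  by rewrite ncM nc_conj; apply: le_lt_trans a1; rewrite ler_piMr ?nc_ge0.
have := ncD (1 - cj a * z) (cj a * z); rewrite subrK nc1; lra.
Qed.

Lemma mob_den_neq0 a z : nc a < 1 -> nc z <= 1 -> 1 - cj a * z != 0.
Proof. by move=> a1 z1; rewrite -nc_gt0 mob_den_gt0. Qed.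

Lemma nc_sqr_lt1 z : nc z < 1 -> nc z ^+ 2 < 1.
Proof. by move=> z1; rewrite expr_lt1 ?nc_ge0. Qed.

Lemma mob_norm_id a z :
  nc (1 - cj a * z) ^+ 2 - nc (z - a) ^+ 2 = (1 - nc a ^+ 2) * (1 - nc z ^+ 2).
Proof. by rewrite !nc_sqr; case: a => a1 a2; case: z => z1 z2; simpc => /=; ring. Qed.

Lemma nc_mob a z : nc a < 1 -> nc z <= 1 ->
  1 - nc (mob a z) ^+ 2 = (1 - nc a ^+ 2) * (1 - nc z ^+ 2) / nc (1 - cj a * z) ^+ 2.
Proof.
move=> a1 z1; have d0 := mob_den_gt0 a1 z1.
rewrite -mob_norm_id /mob ncM ncV; field; rewrite gt_eqF//.
Qed.

Lemma nc_mob_lt1 a z : nc a < 1 -> nc z < 1 -> nc (mob a z) < 1.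
Proof.
move=> a1 z1; have d0 := mob_den_gt0 a1 (ltW z1).
rewrite -(@ltr_pXn2r _ 2%N) ?nnegrE ?nc_ge0// expr1n -subr_gt0 (nc_mob a1 (ltW z1)).
by rewrite divr_gt0 ?exprn_gt0// mulr_gt0 ?subr_gt0 ?nc_sqr_lt1.
Qed.

Lemma nc_mob1 a z : nc a < 1 -> nc z = 1 -> nc (mob a z) = 1.
Proof.
move=> a1 z1; have := nc_mob a1; move=> /(_ z); rewrite z1 lexx => /(_ isT).
rewrite expr1n subrr mulr0 mul0r => /eqP; rewrite subr_eq0 eq_sym => /eqP.
by move=> h; apply/eqP; rewrite -(@eqrXn2 _ 2%N) ?nc_ge0// h expr1n.
Qed.

Lemma mobK a z : nc a < 1 -> nc z <= 1 -> mob (- a) (mob a z) = z.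
Proof.
move=> a1 z1; have d0 := mob_den_neq0 a1 z1.
have a2 : 1 - cj a * a != 0 by apply: mob_den_neq0 => //; exact: ltW.
rewrite /mob rmorphN; field; rewrite ?d0/=.
by have -> : 1 - cj a * z - - cj a * (z - a) = 1 - cj a * a by ring.
Qed.

Lemma mobNK a z : nc a < 1 -> nc z <= 1 -> mob a (mob (- a) z) = z.
Proof. by move=> a1 z1; rewrite -{1}(opprK a) mobK// ncN. Qed.

Lemma mob0 a : mob a 0 = - a. Proof. by rewrite /mob mulr0 subr0 invr1 mulr1 sub0r. Qed.

Lemma mobaa a : mob a a = 0. Proof. by rewrite /mob subrr mul0r. Qed.

Lemma one_sub_ncE a : (1 - nc a ^+ 2)%:C = 1 - a * cj a.
Proof. by rewrite mul_conj; simpc. Qed.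

Lemma has_cderiv_mob a z : 1 - cj a * z != 0 ->
  has_cderiv (mob a) z ((1 - nc a ^+ 2)%:C / (1 - cj a * z) ^+ 2).
Proof.
move=> d0.
have h1 := has_cderivD (has_cderiv_id z) (has_cderiv_cst (- a) z).
have h2 := has_cderivD (has_cderiv_cst 1 z) (has_cderivM (has_cderiv_cst (- cj a) z) (has_cderiv_id z)).
have -> : (1 - nc a ^+ 2)%:C / (1 - cj a * z) ^+ 2 =
   (1 + 0) / (1 + - cj a * id z) + (id z - a) * (- ((1 + - cj a * id z) ^- 2) * (0 + (0 * id z + - cj a * 1))).
  by rewrite one_sub_ncE /= mulNr; field.
have := has_cderiv_div h1 h2; rewrite /= mulNr => /(_ d0).
apply: (has_cderiv_ext ltr01) => w _ /=; by rewrite mulNr.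
Qed.

Lemma pk_gt0 z w : nc z < 1 -> nc w = 1 -> 0 < pk z w.
Proof.
move=> z1 w1; rewrite /pk divr_gt0 ?subr_gt0 ?nc_sqr_lt1// exprn_gt0//.
have := ncD (w - z) z; rewrite subrK; lra.
Qed.

Lemma nc_unit_den a w : nc w = 1 -> nc (1 - cj a * w) = nc (w - a).
Proof.
move=> w1; apply/eqP; rewrite -(@eqrXn2 _ 2%N) ?nc_ge0//.
by rewrite -subr_eq0 mob_norm_id w1 expr1n subrr mulr0.
Qed.

(** Conformal covariance of the Poisson kernel; the divisor [pk a w] is the boundary derivative of
    [mob a]. Harnack's inequality and the change of base point both rest on this. *)
Lemma pk_mob a z w : nc a < 1 -> nc z < 1 -> nc w = 1 ->
  pk (mob a z) (mob a w) = pk z w / pk a w.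
Proof.
move=> a1 z1 w1; have d0 := mob_den_neq0 a1 (ltW z1).
have d1 : 1 - cj a * w != 0 by apply: mob_den_neq0 => //; rewrite w1.
have E : mob a w - mob a z = (w - z) * (1 - nc a ^+ 2)%:C / ((1 - cj a * w) * (1 - cj a * z)).
  by rewrite one_sub_ncE /mob; field; rewrite d0.
have wa : nc (w - a) != 0 by rewrite -nc_unit_den// nc_eq0.
have wz : nc (w - z) != 0 by rewrite -nc_unit_den// nc_eq0 mob_den_neq0 ?w1.
have a2 : 1 - nc a ^+ 2 != 0 by rewrite subr_eq0 gt_eqF ?nc_sqr_lt1.
have dz : nc (1 - cj a * z) != 0 by rewrite nc_eq0.
rewrite /pk (nc_mob a1 (ltW z1)) E !ncM ncV ncM nc_real gtr0_norm ?subr_gt0 ?nc_sqr_lt1//.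
by rewrite (nc_unit_den a w1); field; rewrite a2 wa wz dz.
Qed.

Lemma pk_bounds z w : nc z < 1 -> nc w = 1 ->
  (1 - nc z) / (1 + nc z) <= pk z w <= (1 + nc z) / (1 - nc z).
Proof.
move=> z1 w1; have z0 := nc_ge0 z.
have p1 : 1 - nc z <= nc (w - z) by have := ncD (w - z) z; rewrite subrK; lra.
have p2 : nc (w - z) <= 1 + nc z by have := ncB w z; lra.
have -> : pk z w = (1 - nc z) * (1 + nc z) / nc (w - z) ^+ 2 by rewrite /pk; congr (_ / _); ring.
have u0 : 0 < 1 - nc z by lra.
have v0 : 0 < 1 + nc z by lra.
have n0 : 0 < nc (w - z) by lra.
apply/andP; split.
  rewrite ler_pdivlMr ?exprn_gt0// mulrAC ler_pdivrMr// -mulrA ler_wpM2l//; first lra.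
  by rewrite -expr2 lerXn2r ?nnegrE; lra.
rewrite ler_pdivrMr ?exprn_gt0// mulrAC ler_pdivlMr// mulrAC mulrC ler_wpM2l//; first lra.
by rewrite -expr2 lerXn2r ?nnegrE; lra.
Qed.

(** The map [mob b] sends [b] to 0, where the kernel is constantly 1, and [pk_bounds] compares with
    the value there. *)
Lemma pk_harnack b z w (x : R) : nc b < 1 -> nc z < 1 -> nc w = 1 ->
  x = nc (mob b z) ->
  (1 - x) / (1 + x) * pk b w <= pk z w <= (1 + x) / (1 - x) * pk b w.
Proof.
move=> b1 z1 w1 ->; have := pk_bounds (nc_mob_lt1 b1 z1) (nc_mob1 b1 w1).
rewrite (pk_mob b1 z1 w1); have p0 := pk_gt0 b1 w1.
by move=> /andP[h1 h2]; apply/andP; split; [rewrite -ler_pdivlMr|rewrite -ler_pdivrMr].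
Qed.

Lemma pk_sym (r : R) w v : nc w = 1 -> nc v = 1 -> pk (r%:C * w) v = pk (r%:C * v) w.
Proof.
move=> w1 v1; rewrite /pk !ncM w1 v1; congr (_ / _).
have : nc w ^+ 2 = nc v ^+ 2 by rewrite w1 v1.
by rewrite !nc_sqr; case: w {w1} => w1 w2; case: v {v1} => v1 v2; simpc => /= h; nra.
Qed.

(* [mob a (e^(it)) = e^(it) D^* / D] with [D = 1 - a^* e^(it)] in the right
   half-plane, so this is a continuous lift of [mob a] to angles. *)
Definition mob_angle a (t : R) : R :=
  t - 2 * atan (complex.Im (1 - cj a * e_ t) / complex.Re (1 - cj a * e_ t)).

Lemma mob_den_Re_gt0 a t : nc a < 1 -> 0 < complex.Re (1 - cj a * e_ t).
Proof.
move=> a1; rewrite ReB /= -[X in 0 < X - _]/(1 : R) subr_gt0.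
apply: le_lt_trans (ler_norm _) _; apply: le_lt_trans (Re_le_nc _) _.
by rewrite ncM nc_conj nc_circle mulr1.
Qed.

Lemma mob_angleE a t : nc a < 1 -> mob a (e_ t) = e_ (mob_angle a t).
Proof.
move=> a1; have D0 := mob_den_Re_gt0 t a1.
rewrite /mob_angle; set q := _ / _.
have c0 : cos (atan q) != 0.
  by apply: lt0r_neq0; apply: cos_gt0_pihalf; rewrite atan_gtNpi2 atan_ltpi2.
have cq : cos (atan q) ^+ 2 * (1 + q ^+ 2) = 1.
  by rewrite -[q in _ + q ^+ 2]atanK -cos2_tan2// mulfV// expf_neq0.
have sq : sin (atan q) = q * cos (atan q) by rewrite -{2}[q]atanK /tan divfK.
have DE : 1 - cj a * e_ t = (complex.Re (1 - cj a * e_ t))%:C * (1 +i* q).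
  rewrite /q; case: (1 - _) D0 => X Y /= X0; simpc; congr (_ +i* _); field.
  by rewrite gt_eqF.
have ne : e_ t - a = e_ t * cj (1 - cj a * e_ t).
  have -> : cj (1 - cj a * e_ t) = 1 - a * cj (e_ t).
    by case: (a) => x y; rewrite /circle_point; simpc; congr (_ +i* _); ring.
  rewrite mulrBr mulr1; congr (_ - _).
  by rewrite mulrCA mul_conj nc_circle expr1n mulr1.
(* Writing [D = X (1 + i q)] with [X > 0], the conjugate of [D] divided by [D] is
   [(1 - i q) / (1 + i q)], the rotation by [- 2 * atan q]. *)
have ee : e_ (t - 2 * atan q) = e_ t * (cos (2 * atan q) -i* sin (2 * atan q)).
  by rewrite /circle_point cosB sinB; simpc; congr (_ +i* _); ring.
have D1 : 1 - cj a * e_ t != 0 by rewrite mob_den_neq0 ?nc_circle.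
rewrite /mob ne ee; apply: (mulIf D1); rewrite divfK//.
rewrite -!mulrA; congr (_ * _); rewrite [in RHS]mulrC {}DE; set X := complex.Re _.
rewrite (_ : 2 * atan q = atan q + atan q); last by ring.
rewrite cosD sinD sq.
have -> : cj (X%:C * (1 +i* q)) = X%:C * (1 -i* q) by simpc.
rewrite -mulrA; congr (_ * _); simpc.
have s1 : 1 = cos (atan q) ^+ 2 + q ^+ 2 * cos (atan q) ^+ 2 by rewrite -[LHS]cq; ring.
congr (_ +i* _).
  by rewrite [LHS]s1; ring.
by rewrite -[q in - q]mulr1 {1}s1; ring.
Qed.

(** Hence the harmonic measure seen from [a] becomes plain arc length in the coordinate
    [mob_angle a], and substitution by this map moves the base point to 0. *)
Lemma is_derive_mob_angle a (t : R) : nc a < 1 ->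
  is_derive t (1 : R) (mob_angle a) (pk a (e_ t)).
Proof.
move=> a1; have D0 := mob_den_Re_gt0 t a1.
case: a a1 D0 => a2 b2 a1 D0.
pose X t := 1 - a2 * cos t - b2 * sin t.
pose Y t := b2 * cos t - a2 * sin t.
have DE s : 1 - cj (a2 +i* b2) * e_ s = X s +i* Y s.
  by rewrite /circle_point /X /Y; simpc; congr (_ +i* _); ring.
have X0 : X t != 0 by rewrite gt_eqF//; move: D0; rewrite DE.
have -> : mob_angle (a2 +i* b2) = (fun s => s - 2 * atan (Y s / X s)).
  by apply/funext => s; rewrite /mob_angle DE.
have dX : is_derive t (1 : R) X (- Y t).
  have H : is_derive t (1 : R) X (0 - a2 *: (- sin t) - b2 *: cos t).
    exact: (is_deriveB (is_deriveB (is_derive_cst (1 : R) t (1 : R))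
      (is_deriveZ a2 (is_derive_cos t))) (is_deriveZ b2 (is_derive_sin t))).
  apply: (is_derive_eq H); rewrite /Y /GRing.scale/=; ring.
have dY : is_derive t (1 : R) Y (X t - 1).
  have H : is_derive t (1 : R) Y (b2 *: (- sin t) - a2 *: cos t).
    exact: (is_deriveB (is_deriveZ b2 (is_derive_cos t)) (is_deriveZ a2 (is_derive_sin t))).
  apply: (is_derive_eq H); rewrite /X /GRing.scale/=; ring.
have dq : is_derive t (1 : R) (fun s => Y s / X s) (((X t - 1) * X t + Y t ^+ 2) / X t ^+ 2).
  have H : is_derive t (1 : R) (fun s => Y s / X s)
      (Y t *: (- (X t) ^- 2 *: (- Y t)) + (X t)^-1 *: (X t - 1)).
    exact: (is_deriveM dY (is_deriveV X0 dX)).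
  apply: (is_derive_eq H); rewrite /GRing.scale/=; field.
  by rewrite X0.
have H : is_derive t (1 : R) (fun s => s - 2 * atan (Y s / X s))
    (1 - 2 *: ((1 + (Y t / X t) ^+ 2)^-1 * (((X t - 1) * X t + Y t ^+ 2) / X t ^+ 2))).
  exact: (is_deriveB (is_derive_id t (1 : R))
    (is_deriveZ (2 : R) (is_derive1_comp (is_derive1_atan _) dq))).
apply: (is_derive_eq H); rewrite /GRing.scale/=.
rewrite /pk -nc_unit_den ?nc_circle// DE !nc_sqr/=.
have XY : X t ^+ 2 + Y t ^+ 2 != 0 by rewrite gt_eqF// ltr_wpDr ?sqr_ge0// exprn_even_gt0.
(* Both sides are the squared modulus of [1 - cj a * e_ t]; solving for the squared modulus of [a]
   expresses the numerator of the kernel through [X] and [Y] alone. *)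
have E : X t ^+ 2 + Y t ^+ 2 = 2 * X t - 1 + a2 ^+ 2 + b2 ^+ 2.
  transitivity (1 - 2 * (a2 * cos t + b2 * sin t) + (a2 ^+ 2 + b2 ^+ 2) * (cos t ^+ 2 + sin t ^+ 2)).
    by rewrite /X /Y; ring.
  by rewrite cos2Dsin2 /X; ring.
have -> : 1 - (a2 ^+ 2 + b2 ^+ 2) = 2 * X t - (X t ^+ 2 + Y t ^+ 2) by rewrite E; ring.
field.
by rewrite XY X0.
Qed.

Lemma pk_circle_bound a t : nc a < 1 -> 0 <= pk a (e_ t) <= (1 + nc a) / (1 - nc a).
Proof.
move=> a1; have /andP[_ ->] := pk_bounds a1 (nc_circle t).
by rewrite ltW// pk_gt0 ?nc_circle.
Qed.

Lemma mob_angle_periodic a t : mob_angle a (t + 2 * pi) = mob_angle a t + 2 * pi.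
Proof. by rewrite /mob_angle circle_point_periodic; ring. Qed.

Lemma continuous_pk_circle a : nc a < 1 -> continuous (fun t => pk a (e_ t)).
Proof.
move=> a1; case: a a1 => a2 b2 a1.
pose X t := 1 - a2 * cos t - b2 * sin t.
pose Y t := b2 * cos t - a2 * sin t.
have DE s : 1 - cj (a2 +i* b2) * e_ s = X s +i* Y s.
  by rewrite /circle_point /X /Y; simpc; congr (_ +i* _); ring.
have -> : (fun t => pk (a2 +i* b2) (e_ t)) =
    (fun t => (1 - nc (a2 +i* b2) ^+ 2) / (X t ^+ 2 + Y t ^+ 2)).
  by apply/funext => s; rewrite /pk -nc_unit_den ?nc_circle// DE [in X in _ / X]nc_sqr.
have cc := @continuous_cos R; have cs := @continuous_sin R.
have ck (k : R) (h : R -> R) : continuous h -> continuous (fun t => k * h t).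
  by move=> ch s; apply: cvgM; [exact: cvg_cst|exact: ch].
have cX : continuous X.
  move=> s; apply: cvgB; last exact: ck.
  by apply: cvgB; [exact: cvg_cst|exact: ck].
have cY : continuous Y by move=> s; apply: cvgB; exact: ck.
move=> t; apply: cvgM; first exact: cvg_cst.
apply: cvgV; last first.
  by apply: cvgD; apply: cvgM; do ?[exact: cX|exact: cY].
have := mob_den_gt0 a1; move=> /(_ (e_ t)); rewrite nc_circle lexx => /(_ isT).
by rewrite DE => /(fun h => exprn_gt0 2 h); rewrite nc_sqr/= => /lt0r_neq0.
Qed.

End Moebius.

(** * Poisson's formula by a Moebius change of variable *)

Section Poisson.
Context {R : realType}.
Local Notation C := R[i].
Local Notation nc := (@Normc.normc R).
Local Notation e_ := (@circle_point R).
Local Notation mu := (@lebesgue_measure R).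
Local Notation cj := (@conjc R).
Implicit Types (a b z w : C) (g : C -> C).

Lemma mean_value_disc g (rho r c : R) : 0 < r < rho ->
  (forall w, nc w < rho -> exists l, has_cderiv g w l) ->
  \int[mu]_(t in `[c, c + 2 * pi]) complex.Re (g (r%:C * e_ t)) = 2 * pi * complex.Re (g 0).
Proof.
move=> rr hg; apply: (mean_value _ rr).
  by move=> w /andP[_]; exact: hg.
move=> e e0; have [l hl] := hg 0 (ltac:(rewrite nc0; case/andP: rr; exact: lt_trans)).
have [d d0 hd] := has_cderiv_cont hl e0.
by exists d => // w /andP[_ wd]; apply: ltW; apply: hd; rewrite subr0.
Qed.

Lemma circle_continuous g c d :
  (forall w, nc w = 1 -> exists l, has_cderiv g w l) ->
  {within `[c, d], continuous (fun t => complex.Re (g (e_ t)))}.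
Proof.
move=> hg; apply: within_continuousP => t tab e e0.
have [l hl] := hg _ (nc_circle t).
have [d1 d10 hd] := has_cderiv_cont hl e0.
have [d' d0' hd'] := circle_eps t ltr01.
exists (Num.min d' (d1 / 2)); first by rewrite lt_min d0' divr_gt0.
move=> t' _; rewrite lt_min => /andP[/hd' h1 h2].
rewrite -ReB; apply: le_trans (Re_le_nc _) (ltW (hd _ _)).
rewrite -[_ - _ in ltLHS](subrK ('i * e_ t * (t' - t)%:C)).
apply: le_lt_trans (ncD _ _) _; move: h1; rewrite !ncM nc_real nc_circle.
have -> : nc 'i = 1 by rewrite /= expr0n expr1n add0r sqrtr1.
lra.
Qed.

(** The mean value property will be used on the unit circle itself, so the composite with
    [mob (- z)] has to be holomorphic on a slightly larger disc. *)
Lemma mob_extends z (rho : R) : nc z < 1 -> 1 < rho -> exists2 rho' : R, 1 < rho' &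
  forall w, nc w < rho' -> 1 - cj (- z) * w != 0 /\ nc (mob (- z) w) < rho.
Proof.
move=> z1 rho1; set x := nc z; have x0 : 0 <= x := nc_ge0 z.
(* The first bound keeps the denominator of [mob (- z)] at least [(1 - x) / 2]. The second makes
   [2 * (1 - x) * (3 * d)], the excess of the squared numerator, at most
   [(1 - x) ^+ 2 / 4 * (rho - 1)]. *)
pose d := Num.min ((1 - x) / 2) ((1 - x) * (rho - 1) / 24).
have d0 : 0 < d by rewrite lt_min !divr_gt0 ?mulr_gt0 ?subr_gt0.
have d1 : d <= (1 - x) / 2 by rewrite ge_min lexx.
have d2 : d <= (1 - x) * (rho - 1) / 24 by rewrite ge_min lexx orbT.
exists (1 + d); first by lra.
move=> w wd; have w0 := nc_ge0 w.
have xw : nc (cj (- z) * w) <= x * (1 + d).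
  by rewrite ncM nc_conj ncN ler_wpM2l// ltW.
have D : (1 - x) / 2 <= nc (1 - cj (- z) * w).
  have := ncD (1 - cj (- z) * w) (cj (- z) * w); rewrite subrK nc1.
  have : x * (1 + d) <= x + d by rewrite mulrDr mulr1 lerD2l ler_piMl// ltW.
  by lra.
have D0 : 0 < nc (1 - cj (- z) * w) by apply: lt_le_trans D; rewrite divr_gt0// subr_gt0.
split; first by rewrite -nc_gt0.
have [w1|w1] := ltP (nc w) 1.
  by apply: lt_trans rho1; apply: nc_mob_lt1 => //; rewrite ncN.
have id := mob_norm_id (- z) w; rewrite ncN -/x in id.
rewrite -(@ltr_pXn2r _ 2%N) ?nnegrE ?nc_ge0//; last by lra.
rewrite /mob ncM ncV exprMn exprVn ltr_pdivrMr ?exprn_gt0//.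
have -> : nc (w - - z) ^+ 2 = nc (1 - cj (- z) * w) ^+ 2 + (1 - x ^+ 2) * (nc w ^+ 2 - 1).
  by move: id; lra.
set N := nc (1 - _ * w) in D D0 *.
have h1 : nc w ^+ 2 - 1 <= 3 * d.
  have : nc w ^+ 2 <= (1 + d) ^+ 2 by rewrite lerXn2r ?nnegrE// ?ltW//; lra.
  by nra.
have h2 : (1 - x ^+ 2) <= 2 * (1 - x) by nra.
have h3 : (1 - x) ^+ 2 / 4 <= N ^+ 2.
  have : ((1 - x) / 2) ^+ 2 <= N ^+ 2 by rewrite lerXn2r ?nnegrE ?nc_ge0// divr_ge0// subr_ge0 ltW.
  by rewrite exprMn exprVn; lra.
have h4 : (1 - x ^+ 2) * (nc w ^+ 2 - 1) <= 2 * (1 - x) * (3 * d).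
  apply: ler_pM => //; first by nra.
  by rewrite subr_ge0 exprn_ege1.
have h5 : 2 * (1 - x) * (3 * d) <= (1 - x) ^+ 2 / 4 * (rho - 1).
  by rewrite expr2; nra.
have h6 : (1 - x) ^+ 2 / 4 * (rho - 1) <= N ^+ 2 * (rho - 1) by rewrite ler_wpM2r//; lra.
have N2 : 0 < N ^+ 2 by rewrite exprn_gt0.
have h7 : N ^+ 2 * (rho - 1) + N ^+ 2 < rho ^+ 2 * N ^+ 2.
  by rewrite mulrBr mulr1 subrK mulrC ltr_pM2r// expr2 ltr_pMr//; lra.
lra.
Qed.

Lemma mob_angle_lt a : nc a < 1 -> {homo mob_angle a : x y / x < y}.
Proof.
move=> a1 x y xy.
have [||c _ h] := @MVT R (mob_angle a) (fun t => pk a (e_ t)) x y xy.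
- by move=> t _; exact: is_derive_mob_angle.
- apply: derivable_within_continuous => t _.
  by have [] := is_derive_mob_angle t a1.
by rewrite -subr_gt0 h mulr_gt0 ?subr_gt0// pk_gt0// nc_circle.
Qed.

(** The composite [g \o mob (- z)] takes the value [g z] at 0, so this is its mean value property
    after the substitution by [mob_angle z], whose derivative is the kernel. *)
Theorem poisson_circle g z (rho c : R) : nc z < 1 -> 1 < rho ->
  (forall w, nc w < rho -> exists l, has_cderiv g w l) ->
  \int[mu]_(t in `[c, c + 2 * pi]) (complex.Re (g (e_ t)) * pk z (e_ t)) =
  2 * pi * complex.Re (g z).
Proof.
move=> z1 rho1 hg.
have [rho' rho'1 hrho'] := mob_extends z1 rho1.
have z1' : nc (- z) < 1 by rewrite ncN.
pose h w := g (mob (- z) w).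
have hh w : nc w < rho' -> exists l, has_cderiv h w l.
  move=> /hrho'[D0 /hg[l hl]]; eexists; exact: (has_cderiv_comp (has_cderiv_mob D0) hl).
have r1 : 0 < (1 : R) < rho' by rewrite ltr01.
have := mean_value_disc (mob_angle z c) r1 hh.
rewrite {2}/h mob0 opprK => <-.
under [RHS]eq_Rintegral do rewrite rmorph1 mul1r.
pose F := mob_angle z; pose G x := complex.Re (h (e_ x)).
have dF t : is_derive t (1 : R) F (pk z (e_ t)) by exact: is_derive_mob_angle.
have F'E : F^`()%classic = (fun t => pk z (e_ t)).
  by apply/funext => t; rewrite derive1E derive_val.
have cF' := continuous_pk_circle z1.
have cF : continuous F by move=> t; apply: differentiable_continuous; apply/derivable1_diffP; have [] := dF t.
rewrite -mob_angle_periodic /Rintegral; congr fine; apply/esym.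
have cpi : c <= c + 2 * pi by rewrite lerDl mulr_ge0// pi_ge0.
rewrite (@integration_by_substitution_increasing R F G c (c + 2 * pi)) //.
- apply: eq_integral => t _; rewrite F'E; change ((G (mob_angle z t) * pk z (e_ t))%:E = (complex.Re (g (e_ t)) * pk z (e_ t))%:E).
  by rewrite /G /h -mob_angleE// mobK ?nc_circle.
- by move=> x y _ _; exact: mob_angle_lt.
- by move=> x _; rewrite F'E; exact: cF'.
- by rewrite F'E; apply/cvg_ex; eexists; apply: cvg_at_right_filter; exact: cF'.
- by rewrite F'E; apply/cvg_ex; eexists; apply: cvg_at_left_filter; exact: cF'.
- split; first by move=> t _; have [] := dF t.
  + by apply: cvg_at_right_filter; exact: cF.
  + by apply: cvg_at_left_filter; exact: cF.
- by apply: circle_continuous => w w1; apply: hh; rewrite w1.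
Qed.

Lemma poisson_disc g z (r c : R) : nc z < 1 -> 0 < r < 1 ->
  (forall w, nc w < 1 -> exists l, has_cderiv g w l) ->
  \int[mu]_(t in `[c, c + 2 * pi]) (complex.Re (g (r%:C * e_ t)) * pk z (e_ t)) =
  2 * pi * complex.Re (g (r%:C * z)).
Proof.
move=> z1 /andP[r0 r1] hg.
apply: (@poisson_circle (fun w => g (r%:C * w)) z r^-1) => //; first by rewrite invf_gt1.
move=> w wr; have [|l hl] := hg (r%:C * w).
  by rewrite ncM nc_real gtr0_norm// mulrC -ltr_pdivlMr// div1r.
exists (l * (0 * w + r%:C * 1)).
exact: (has_cderiv_comp (has_cderivM (has_cderiv_cst r%:C w) (has_cderiv_id w)) hl).
Qed.

Lemma pk_total z (c : R) : nc z < 1 ->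
  \int[mu]_(t in `[c, c + 2 * pi]) pk z (e_ t) = 2 * pi.
Proof.
move=> z1; transitivity (2 * pi * complex.Re (1 : C)); last by rewrite mulr1.
rewrite -(@poisson_circle (fun=> 1) z 2 c z1 (ltr1n _ 2)) => [|w _]; last first.
  by exists 0; exact: has_cderiv_cst.
by apply: eq_Rintegral => t _; rewrite mul1r.
Qed.

End Poisson.

(** * Schwarz-Pick lemma with distortion *)

Section Schwarz.
Context {R : realType}.
Local Notation C := R[i].
Local Notation nc := (@Normc.normc R).
Local Notation e_ := (@circle_point R).
Local Notation mu := (@lebesgue_measure R).
Local Notation cj := (@conjc R).
Implicit Types (a b c k v z w : C) (f G : C -> C).

Lemma Re_realM (x : R) z : complex.Re (x%:C * z) = x * complex.Re z.
Proof. by case: z => p q; simpc. Qed.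

Lemma realCM (x y : R) : (x * y)%:C = x%:C * y%:C. Proof. by simpc. Qed.

Lemma realCV (x : R) : (x^-1)%:C = x%:C^-1.
Proof. by rewrite -[LHS]/(real_complex R x^-1) fmorphV. Qed.

Lemma circle_inv t : (e_ t)^-1 = cj (e_ t).
Proof.
have e0 : e_ t != 0 by rewrite -nc_gt0 nc_circle.
by apply: (mulfI e0); rewrite divff// mul_conj nc_circle expr1n.
Qed.

Lemma Re_unit_max z (M : R) : 0 <= M -> (forall c, nc c <= 1 -> complex.Re (c * z) <= M) -> nc z <= M.
Proof.
move=> M0 h; have [->|z0] := eqVneq z 0; first by rewrite nc0.
have p0 : 0 < nc z by rewrite nc_gt0.
have := h ((nc z)^-1%:C * cj z).
rewrite ncM nc_real nc_conj gtr0_norm ?invr_gt0// mulVf ?gt_eqF// lexx => /(_ isT).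
rewrite -mulrA [cj z * z]mulrC mul_conj Re_realM /=; congr (_ <= _).
by field; rewrite gt_eqF.
Qed.

(** * Schwarz lemma with distortion for maps fixing the origin *)

Section FixedOrigin.
Variables (G : C -> C) (k : C).
Hypothesis Gh : forall w, nc w < 1 -> exists l, has_cderiv G w l.
Hypothesis G1 : forall w, nc w < 1 -> nc (G w) <= 1.
Hypothesis G0 : G 0 = 0.
Hypothesis Gk : has_cderiv G 0 k.

Let dil (r : R) (w : C) : has_cderiv (fun w => r%:C * w) w r%:C.
Proof.
have := has_cderivM (has_cderiv_cst r%:C w) (has_cderiv_id w).
by rewrite mul0r add0r mulr1.
Qed.

Let Gr (r : R) w : 0 < r < 1 -> nc w < r^-1 -> exists l, has_cderiv (fun w => G (r%:C * w)) w l.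
Proof.
move=> /andP[r0 r1] wr; have [|l hl] := @Gh (r%:C * w).
  by rewrite ncM nc_real gtr0_norm// mulrC -ltr_pdivlMr// div1r.
by exists (l * r%:C); exact: (has_cderiv_comp (dil r w) hl).
Qed.

(** The mean value property of [c * (G (r w) / w)], whose limit at 0 is [c * (r * k)]; on the unit
    circle [1 / w] is the conjugate of [w]. *)
Lemma fourier_coef1 c (r : R) : 0 < r < 1 ->
  \int[mu]_(t in `[0, 0 + 2 * pi]) complex.Re (c * (G (r%:C * e_ t) * cj (e_ t))) =
  2 * pi * complex.Re (c * (r%:C * k)).
Proof.
move=> r01; have /andP[r0 r1] := r01.
have r1' : 0 < (1 : R) < r^-1 by rewrite ltr01/= invf_gt1.
rewrite -(@mean_value _ (fun w => c * (G (r%:C * w) / w)) (c * (r%:C * k)) _ _ 0 r1').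
- by apply: eq_Rintegral => t _; rewrite rmorph1 mul1r circle_inv.
- move=> w /andP[w0 wr]; have [l hl] := Gr r01 wr.
  have w0' : id w != 0 by rewrite -nc_gt0.
  eexists; exact: (has_cderivM (has_cderiv_cst c w) (has_cderiv_div hl (has_cderiv_id w) w0')).
- move=> e e0; have K0 : 0 < nc c + 1 by rewrite ltr_wpDl ?nc_ge0.
  have Gk' : has_cderiv G (r%:C * 0) k by rewrite mulr0.
  have h0 := has_cderiv_comp (dil r 0) Gk'.
  have [|d d0 hd] := h0 (e / (nc c + 1)); first by rewrite divr_gt0.
  exists d => // w /andP[w0 wd]; have := hd w; rewrite subr0 => /(_ wd).
  rewrite mulr0 G0 subr0 => h.
  have w0' : w != 0 by rewrite -nc_gt0.
  have -> : c * (G (r%:C * w) / w) - c * (r%:C * k) = c * ((G (r%:C * w) - k * r%:C * w) / w).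
    by field.
  rewrite !ncM ncV.
  apply: (@le_trans _ _ (nc c * (e / (nc c + 1)))).
    by rewrite ler_wpM2l ?nc_ge0// ler_pdivrMr.
  by rewrite mulrCA ler_piMr ?ltW// ltr_pdivrMr// mul1r ltrDl.
Qed.

(** Poisson's formula at [v] for [c * G (r w) / w], obtained without a derivative of this quotient
    at 0. Dividing by the constant [v] instead of [w] gives [A], to which [poisson_circle] applies.
    The discrepancy is the real part of [B], which is holomorphic with [B 0 = 0] and so has mean
    zero. *)
Lemma poisson_quotient c v (r : R) : 0 < r < 1 -> nc v < 1 -> v != 0 ->
  \int[mu]_(t in `[0, 0 + 2 * pi])
     (complex.Re (c * (G (r%:C * e_ t) * cj (e_ t))) * pk v (e_ t)) =
  2 * pi * complex.Re (c * (G (r%:C * v) / v)).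
Proof.
move=> r01 v1 v0; have /andP[r0 r1] := r01.
pose A := fun w => c / v * G (r%:C * w).
pose B := fun w => A w * ((1 - nc v ^+ 2)%:C / (1 - cj v * w)).
have hA w : nc w < r^-1 -> exists l, has_cderiv A w l.
  move=> wr; have [l hl] := Gr r01 wr.
  by eexists; exact: (has_cderivM (has_cderiv_cst (c / v) w) hl).
pose rho := Num.min r^-1 (nc v)^-1.
have vp : 0 < nc v by rewrite nc_gt0.
have rho1 : 1 < rho by rewrite lt_min !invf_gt1// r1.
have hB w : nc w < rho -> exists l, has_cderiv B w l.
  rewrite lt_min => /andP[/hA[l hl] wv].
  have D0 : 1 - cj v * w != 0.
    rewrite -nc_gt0; have := ncD (1 - cj v * w) (cj v * w); rewrite subrK nc1.
    have : nc (cj v * w) < 1 by rewrite ncM nc_conj mulrC -ltr_pdivlMr// div1r.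
    lra.
  have h2 : has_cderiv (fun w => 1 - cj v * w) w (0 + - 1 * (0 * w + cj v * 1)).
    have := has_cderivD (has_cderiv_cst 1 w) (has_cderivM (has_cderiv_cst (- 1) w)
      (has_cderivM (has_cderiv_cst (cj v) w) (has_cderiv_id w))).
    by rewrite mul0r add0r; apply: (has_cderiv_ext ltr01) => y _; rewrite mulN1r.
  eexists; exact: (has_cderivM hl (has_cderiv_div (has_cderiv_cst _ w) h2 D0)).
have E t : complex.Re (c * (G (r%:C * e_ t) * cj (e_ t))) * pk v (e_ t) =
   complex.Re (A (e_ t)) * pk v (e_ t) - complex.Re (B (e_ t)).
  have d0 : 1 - cj v * e_ t != 0 by rewrite mob_den_neq0 ?nc_circle.
  have d1 : e_ t - v != 0.
    by rewrite -nc_eq0 -nc_unit_den ?nc_circle// nc_eq0.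
  have e0 : e_ t != 0 by rewrite -nc_gt0 nc_circle.
  have pE : (pk v (e_ t))%:C = (1 - nc v ^+ 2)%:C * e_ t / ((e_ t - v) * (1 - cj v * e_ t)).
    rewrite /pk realCM realCV -mul_conj.
    have -> : cj (e_ t - v) = (1 - cj v * e_ t) / e_ t.
      rewrite mulrBl div1r mulfK// circle_inv.
      by case: (v) => p q; rewrite /circle_point; simpc; congr (_ +i* _); ring.
    by field; rewrite d1 d0 e0.
  have : complex.Re ((pk v (e_ t))%:C * (c * (G (r%:C * e_ t) * cj (e_ t)))) =
     complex.Re ((pk v (e_ t))%:C * A (e_ t) - B (e_ t)).
    congr complex.Re; rewrite -circle_inv pE /B /A; field.
    by rewrite d0 d1 v0 e0.
  by rewrite ReB !Re_realM mulrC => ->; rewrite [in LHS]mulrC.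
under eq_Rintegral do rewrite E.
have cA : {within `[0, 0 + 2 * pi], continuous (fun t => complex.Re (A (e_ t)))}.
  by apply: circle_continuous => w w1; apply: hA; rewrite w1 invf_gt1.
rewrite RintegralB_within; first last.
- by apply: circle_continuous => w w1; apply: hB; rewrite w1.
- move=> t; apply: cvgM; first exact: cA.
  by apply: (@continuous_subspaceT _ _ _ (fun t => pk v (e_ t)) (continuous_pk_circle v1)).
have r1' : 1 < r^-1 by rewrite invf_gt1.
have rho' : 0 < (1 : R) < rho by rewrite ltr01.
rewrite (poisson_circle 0 v1 r1' hA).
have := mean_value_disc 0 rho' hB; under eq_Rintegral do rewrite rmorph1 mul1r.
move=> ->; rewrite /B /A mulr0 G0 mulr0 mul0r mulr0 subr0.
by congr (_ * complex.Re _); field.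
Qed.

Lemma schwarz_mean c (r : R) t : 0 < r < 1 -> nc c <= 1 ->
  complex.Re (c * (G (r%:C * e_ t) * cj (e_ t))) <= 1.
Proof.
move=> /andP[r0 r1] c1; apply: le_trans (ler_norm _) _; apply: le_trans (Re_le_nc _) _.
rewrite !ncM nc_conj nc_circle mulr1 -[leRHS]mulr1 ler_pM ?nc_ge0// G1//.
by rewrite ncM nc_real nc_circle mulr1 gtr0_norm.
Qed.

Let cont c (r : R) : 0 < r < 1 -> {within `[0, 0 + 2 * pi],
  continuous (fun t => complex.Re (c * (G (r%:C * e_ t) * cj (e_ t))))}.
Proof.
move=> r01; have /andP[r0 r1] := r01.
under [X in continuous X]eq_fun do rewrite -circle_inv.
apply: (@circle_continuous _ (fun w => c * (G (r%:C * w) / w))) => w w1.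
have [|l hl] := @Gr r w r01; first by rewrite w1 invf_gt1.
have w0' : id w != 0 by rewrite -nc_gt0 w1.
eexists; exact: (has_cderivM (has_cderiv_cst c w) (has_cderiv_div hl (has_cderiv_id w) w0')).
Qed.

Let pi2 : 0 < 2 * pi :> R. Proof. by rewrite mulr_gt0// pi_gt0. Qed.

Lemma schwarz_deriv : nc k <= 1.
Proof.
apply/ler_addgt0Pl => e e0.
suff h (r : R) : 0 < r < 1 -> r * nc k <= 1.
  have K0 : 0 < nc k + 1 by rewrite ltr_wpDl ?nc_ge0.
  pose r := Num.max (1 / 2) (1 - e / (nc k + 1)).
  have r1 : 0 < r < 1 by rewrite lt_max gt_max; apply/andP; split; rewrite ?ltrBlDr ?ltrDl ?divr_gt0//=; lra.
  have rr : 1 - e / (nc k + 1) <= r by rewrite le_max lexx orbT.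
  have q : e / (nc k + 1) * nc k <= e.
    by rewrite mulrAC -mulrA ler_piMr ?ltW// ltr_pdivrMr// mul1r ltrDl.
  have := h _ r1; have := ler_wpM2r (nc_ge0 k) rr; lra.
move=> r01; have /andP[r0 r1] := r01.
have -> : r * nc k = nc (r%:C * k) by rewrite ncM nc_real gtr0_norm.
apply: Re_unit_max => // c c1.
rewrite -(ler_pM2l pi2) -(fourier_coef1 c r01) mulr1.
have E2 : 2 * pi = \int[mu]_(t in `[0, 0 + 2 * pi]) (1 : R).
  by rewrite Rintegral_cst_itv ?add0r ?subr0 ?mul1r// ltW.
rewrite [leRHS]E2.
apply: le_Rintegral => //; [exact/integrable_within/cont| |by move=> t _; exact: schwarz_mean].
by apply: integrable_within => x; exact: cvg_cst.
Qed.

(** With [u] the real part of [c * G (r w) / w] on the circle, [1 - u] is nonnegative with average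
    at least [1 - nc k]. The lower bound [q] of the Poisson kernel (Harnack) keeps at least the
    proportion [q] of this average at [v]. Thus a derivative of modulus below 1 at the origin
    improves Schwarz's inequality everywhere. *)
Lemma schwarz_dilated v (r : R) : 0 < r < 1 -> nc v < 1 -> v != 0 ->
  nc (G (r%:C * v)) <= nc v * (1 - (1 - nc v) / (1 + nc v) * (1 - nc k)).
Proof.
move=> r01 v1 v0; have /andP[r0 r1] := r01.
have vp : 0 < nc v by rewrite nc_gt0.
have k1 := schwarz_deriv; have k0 := nc_ge0 k.
set q := (1 - nc v) / (1 + nc v).
have q0 : 0 <= q by rewrite divr_ge0; lra.
have q1 : q <= 1 by rewrite ler_pdivrMr; lra.
rewrite [leRHS]mulrC -ler_pdivrMr// -ncV -ncM.
apply: Re_unit_max; first by nra.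
move=> c c1; rewrite -(ler_pM2l pi2) -(poisson_quotient c r01 v1 v0).
pose u t := complex.Re (c * (G (r%:C * e_ t) * cj (e_ t))).
have cu := @cont c r r01; rewrite -/u in cu.
have cp : {within `[0, 0 + 2 * pi], continuous (fun t => pk v (e_ t))}.
  exact: (@continuous_subspaceT _ _ _ (fun t => pk v (e_ t)) (continuous_pk_circle v1)).
have c_1 : {within `[0, 0 + 2 * pi], continuous (fun _ : R => 1 : R)} by move=> x; exact: cvg_cst.
have cup : {within `[0, 0 + 2 * pi], continuous (fun t => u t * pk v (e_ t))}.
  by move=> t; apply: cvgM; [exact: cu|exact: cp].
have I1 := fourier_coef1 c r01; rewrite -/u in I1.
have I0 := pk_total 0 v1.
have I2 : \int[mu]_(t in `[0, 0 + 2 * pi]) (1 - u t) = 2 * pi - 2 * pi * complex.Re (c * (r%:C * k)).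
  rewrite RintegralB_within// I1; congr (_ - _).
  by rewrite Rintegral_cst_itv ?add0r ?subr0 ?mul1r// ltW.
have I3 : q * \int[mu]_(t in `[0, 0 + 2 * pi]) (1 - u t) <=
    \int[mu]_(t in `[0, 0 + 2 * pi]) (pk v (e_ t) - u t * pk v (e_ t)).
  have cu1 : {within `[0, 0 + 2 * pi], continuous (fun t => 1 - u t)}.
    by move=> t; apply: cvgB; [exact: c_1|exact: cu].
  rewrite -RintegralZl//; last exact: integrable_within.
  apply: le_Rintegral => //.
  - by apply: integrable_within => t; apply: cvgM; [exact: cvg_cst|exact: cu1].
  - by apply: integrable_within => t; apply: cvgB; [exact: cp|exact: cup].
  move=> t _; have := schwarz_mean t r01 c1; rewrite -/(u t) => ut.
  have /andP[h _] := pk_bounds v1 (nc_circle t).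
  rewrite -/q in h; nra.
rewrite I2 RintegralB_within// I0 in I3.
have h : complex.Re (c * (r%:C * k)) <= nc k.
  apply: le_trans (ler_norm _) _; apply: le_trans (Re_le_nc _) _.
  rewrite !ncM nc_real gtr0_norm//.
  apply: (@le_trans _ _ (r * nc k)); first by rewrite ler_piMl // mulr_ge0 // ltW.
  by rewrite ler_piMl // ltW.
have h2 : q * (2 * pi * (1 - nc k)) <= q * (2 * pi - 2 * pi * complex.Re (c * (r%:C * k))).
  by rewrite ler_wpM2l// mulrBr mulr1 lerD2l lerN2 ler_pM2l.
rewrite -/u; lra.
Qed.

(** The dilated estimate is applied at [z / r], whose dilate is [z] itself, and then [r] tends to
    1. *)
Lemma schwarz_strong z : nc z < 1 ->
  nc (G z) <= nc z * (1 - (1 - nc k) * ((1 - nc z) / (1 + nc z))).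
Proof.
move=> z1; have [->|z0] := eqVneq z 0; first by rewrite G0 nc0 mul0r.
have xp : 0 < nc z by rewrite nc_gt0.
have k1 := schwarz_deriv; have k0 := nc_ge0 k.
set x := nc z in z1 xp *; set m := 1 - nc k.
have m0 : 0 <= m by rewrite /m; lra.
have m1 : m <= 1 by rewrite /m; lra.
suff h (r : R) : x < r < 1 -> r * nc (G z) <= x * (1 - m * ((r - x) / (1 + x))).
  apply/ler_addgt0Pl => e e0.
  pose d := Num.min ((1 - x) / 2) (e / 2).
  have d0 : 0 < d by rewrite lt_min !divr_gt0// subr_gt0.
  have d1 : d <= (1 - x) / 2 by rewrite ge_min lexx.
  have d2 : d <= e / 2 by rewrite ge_min lexx orbT.
  have := h (1 - d); rewrite gtrBl d0 andbT => /(_ ltac:(lra)).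
  have g1 := G1 z1; have g0 := nc_ge0 (G z).
  have -> : (1 - d - x) / (1 + x) = (1 - x) / (1 + x) - d / (1 + x) by field; rewrite gt_eqF//; lra.
  have : d / (1 + x) <= d by rewrite ler_pdivrMr; nra.
  have : 0 <= d / (1 + x) by rewrite divr_ge0; lra.
  move: (d / (1 + x)) ((1 - x) / (1 + x)) => p q p0 p1 hh.
  have : d * nc (G z) <= d by rewrite ler_piMr// ltW.
  have : x * m * p <= p.
    by rewrite ler_piMl// -[leRHS]mulr1 ler_pM// ltW.
  lra.
move=> /andP[xr r1]; have r0 : 0 < r by apply: lt_trans xr.
pose v := (r^-1)%:C * z.
have rv : r%:C * v = z by rewrite /v mulrA -rmorphM divff ?gt_eqF// rmorph1 mul1r.
have vE : nc v = x / r by rewrite /v ncM nc_real gtr0_norm ?invr_gt0// mulrC.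
have := @schwarz_dilated v r; rewrite r0 r1 rv vE => /(_ isT).
rewrite ltr_pdivrMr// mul1r => /(_ xr) h.
have v0 : v != 0 by rewrite -nc_gt0 vE divr_gt0.
have {h} := h v0; rewrite -/m => h.
have -> : x * (1 - m * ((r - x) / (1 + x))) = r * (x / r * (1 - (r - x) / (1 + x) * m)).
  by field; rewrite !gt_eqF//; lra.
rewrite ler_pM2l//; apply: le_trans h _.
apply: ler_wpM2l; first by rewrite divr_ge0 // ltW.
rewrite lerD2l lerN2; apply: ler_wpM2r => //.
have -> : (1 - x / r) / (1 + x / r) = (r - x) / (r + x).
  by field; rewrite !gt_eqF//; lra.
by rewrite ler_wpM2l ?subr_ge0 ?(ltW xr)// lef_pV2 ?posrE; lra.
Qed.

End FixedOrigin.

(** Conjugation by [mob (- a)] and [mob (f a)] moves [a] and [f a] to 0; [lam] is then the modulus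
    of the derivative at the origin. *)
Lemma schwarz_pick f a l :
  (forall w, nc w < 1 -> exists k, has_cderiv f w k) ->
  (forall w, nc w < 1 -> nc (f w) < 1) -> nc a < 1 -> has_cderiv f a l ->
  let lam := nc l * (1 - nc a ^+ 2) / (1 - nc (f a) ^+ 2) in
  lam <= 1 /\ forall z, nc z < 1 -> nc (mob (f a) (f z)) <=
    nc (mob a z) * (1 - (1 - lam) * ((1 - nc (mob a z)) / (1 + nc (mob a z)))).
Proof.
move=> fh f1 a1 fl lam; set b := f a.
have b1 : nc b < 1 by exact: f1.
have a1' : nc (- a) < 1 by rewrite ncN.
pose G w := mob b (f (mob (- a) w)).
have Gh w : nc w < 1 -> exists l, has_cderiv G w l.
  move=> w1; have v1 := nc_mob_lt1 a1' w1; have [k hk] := fh _ v1.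
  have D1 := mob_den_neq0 a1' (ltW w1).
  have D2 := mob_den_neq0 b1 (ltW (f1 _ v1)).
  eexists; exact: (has_cderiv_comp (has_cderiv_comp (has_cderiv_mob D1) hk) (has_cderiv_mob D2)).
have G1 w : nc w < 1 -> nc (G w) <= 1.
  by move=> w1; apply: ltW; apply: nc_mob_lt1 => //; apply: f1; exact: nc_mob_lt1.
have m0 : mob (- a) 0 = a by rewrite mob0 opprK.
have G0 : G 0 = 0 by rewrite /G m0 mobaa.
pose k := (1 - nc b ^+ 2)%:C / (1 - cj b * b) ^+ 2 * (l * ((1 - nc (- a) ^+ 2)%:C / (1 - cj (- a) * 0) ^+ 2)).
have Gk : has_cderiv G 0 k.
  have D1 := mob_den_neq0 a1' (ltac:(by rewrite nc0) : nc 0 <= 1).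
  have D2 := mob_den_neq0 b1 (ltW b1).
  apply: (has_cderiv_comp (has_cderiv_comp (has_cderiv_mob D1) _)); rewrite m0//.
  exact: has_cderiv_mob.
have kE : nc k = lam.
  have b2 : 0 < 1 - nc b ^+ 2 by rewrite subr_gt0 nc_sqr_lt1.
  have a2 : 0 < 1 - nc a ^+ 2 by rewrite subr_gt0 nc_sqr_lt1.
  rewrite /k; have -> : 1 - cj b * b = (1 - nc b ^+ 2)%:C by rewrite one_sub_ncE mulrC.
  rewrite mulr0 subr0 expr1n divr1 ncN expr2 !ncM ncV ncM !nc_real.
  rewrite !gtr0_norm// /lam -/b; field.
  by rewrite gt_eqF.
split; first by rewrite -kE; exact: schwarz_deriv Gh G1 G0 Gk.
move=> z z1; have := schwarz_strong Gh G1 G0 Gk (nc_mob_lt1 a1 z1).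
by rewrite kE /G mobK// ltW.
Qed.

(** For [x] the pseudohyperbolic distance and [d] the hyperbolic one, [x / (1 - x)] is
    [(e^d - 1) / 2]. This quantity shrinks by a factor independent of [x], whereas the gain on [x]
    itself degenerates as [x] tends to 1. *)
Lemma odds_contraction (x x' m : R) : 0 <= x < 1 -> 0 <= m <= 1 ->
  x' <= x * (1 - m * ((1 - x) / (1 + x))) ->
  x' < 1 /\ x' / (1 - x') <= x / (1 - x) * (1 - m / 3).
Proof.
move=> /andP[x0 x1] /andP[m0 m1] h.
(* Since [1 + x <= 2], this polynomial dominates the given bound, and [1 - X] factors. *)
pose X := x * (1 - m * (1 - x) / 2).
have hX : x' <= X.
  apply: le_trans h _; rewrite ler_wpM2l// lerD2l lerN2 -mulrA ler_wpM2l//.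
  by rewrite ler_wpM2l; [|lra|rewrite lef_pV2 ?posrE; lra].
have XE : 1 - X = (1 - x) * (1 + x * m / 2) by rewrite /X; field.
have X1 : 0 < 1 - X by rewrite XE mulr_gt0; nra.
split; first by lra.
apply: (@le_trans _ _ (X / (1 - X))).
  by rewrite ler_pdivrMr ?ler_pdivlMr// 1?mulrAC ?ler_pdivlMr//; nra.
rewrite ler_pdivrMr// XE.
have -> : x / (1 - x) * (1 - m / 3) * ((1 - x) * (1 + x * m / 2)) = x * ((1 - m / 3) * (1 + x * m / 2)).
  by field; rewrite gt_eqF; lra.
by rewrite /X ler_wpM2l//; nra.
Qed.

End Schwarz.

(** * Smoothing by the Poisson kernel *)

Section Kernel.
Context {R : realType}.
Local Notation C := R[i].
Local Notation nc := (@Normc.normc R).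
Local Notation e_ := (@circle_point R).
Local Notation mu := (@lebesgue_measure R).
Local Notation cj := (@conjc R).
Implicit Types (a b c k v z w : C).

Definition pkr (r x : R) : R := (1 - r ^+ 2) / (1 + r ^+ 2 - 2 * r * cos x).

Lemma pkrE (r s t : R) : pk (r%:C * e_ s) (e_ t) = pkr r (s - t).
Proof.
rewrite /pk /pkr ncM nc_real nc_circle mulr1 real_normK ?num_real//; congr (_ / _).
rewrite nc_sqr /circle_point; simpc => /=; rewrite cosB.
transitivity ((cos t ^+ 2 + sin t ^+ 2) + r ^+ 2 * (cos s ^+ 2 + sin s ^+ 2) -
  2 * r * (cos s * cos t + sin s * sin t)); last by rewrite !cos2Dsin2 mulr1.
ring.
Qed.

Lemma pkr_den_gt0 (r x : R) : 0 <= r < 1 -> 0 < 1 + r ^+ 2 - 2 * r * cos x.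
Proof. by move=> /andP[r0 r1]; have := cos_le1 x; nra. Qed.

Lemma pkr_ge0 (r x : R) : 0 <= r < 1 -> 0 <= pkr r x.
Proof.
move=> r01; rewrite /pkr divr_ge0 ?(ltW (pkr_den_gt0 _ _))//.
by case/andP: r01 => r0 r1; nra.
Qed.

Lemma continuous_pkr (r : R) : 0 <= r < 1 -> continuous (pkr r).
Proof.
move=> r01 x; apply: cvgM; first exact: cvg_cst.
apply: cvgV; first by rewrite gt_eqF// pkr_den_gt0.
apply: cvgB; first exact: cvg_cst.
by apply: cvgM; [exact: cvg_cst|exact: continuous_cos].
Qed.

(** The denominator of [pkr r x] is [(1 - r) ^+ 2 + 2 * r * (1 - cos x)]; the square is dropped and
    [x] is replaced by the smallest angle [d] of the tail. *)
Definition pkr_tail (r d : R) : R := (1 - r ^+ 2) / (2 * r * (1 - cos d)).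

Lemma cos_lt1 (d : R) : 0 < d <= pi -> cos d < 1.
Proof.
move=> /andP[d0 dpi]; rewrite -[ltRHS]cos0 ltr_cos// in_itv/= ?(ltW d0)// lexx/=.
exact: pi_ge0.
Qed.

Lemma pkr_tail_ge (r d x : R) : 0 < r < 1 -> 0 < d <= pi -> d <= `|x| <= pi ->
  pkr r x <= pkr_tail r d.
Proof.
move=> /andP[r0 r1] /andP[d0 dpi] /andP[dx xpi].
have c1 : cos d < 1 by apply: cos_lt1; rewrite d0.
have cc : cos x <= cos d.
  rewrite -cos_norm; move: dx; rewrite le_eqVlt => /predU1P[->//|dx].
  by rewrite ltW// ltr_cos// in_itv/= ?(ltW d0)//= normr_ge0.
have D0 : 0 < 1 + r ^+ 2 - 2 * r * cos x by apply: pkr_den_gt0; rewrite ltW.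
rewrite /pkr /pkr_tail ler_wpM2l//; first by nra.
rewrite lef_pV2 ?posrE//; first by nra.
by rewrite !mulr_gt0// subr_gt0.
Qed.

Lemma continuous_pkr_shift (r t : R) : 0 <= r < 1 -> continuous (fun s => pkr r (s - t)).
Proof.
move=> r01 s; apply: (@continuous_comp _ _ _ (fun s => s - t)).
  by apply: cvgB; [exact: cvg_id|exact: cvg_cst].
exact: continuous_pkr.
Qed.

Lemma pkr_total (r t c : R) : 0 < r < 1 ->
  \int[mu]_(s in `[c, c + 2 * pi]) pkr r (s - t) = 2 * pi.
Proof.
move=> /andP[r0 r1]; rewrite -[RHS](@pk_total _ (r%:C * e_ t) c); last first.
  by rewrite ncM nc_real nc_circle mulr1 gtr0_norm.
by apply: eq_Rintegral => s _; rewrite -pkrE pk_sym ?nc_circle.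
Qed.

(** The total mass over a period is [2 * pi], and outside [[t - d, t + d]] the kernel is at most
    [pkr_tail r d] on two pieces of length [pi - d]. Taking the period centred at [t] keeps these
    pieces within distance [pi] of [t]. *)
Lemma pkr_mass (r d al be t : R) : 0 < r < 1 -> 0 < d <= pi -> al <= t <= be ->
  2 * pi * (1 - pkr_tail r d) <= \int[mu]_(s in `[al - d, be + d]) pkr r (s - t).
Proof.
move=> r01 dpi /andP[alt tbe]; have /andP[r0 r1] := r01; have /andP[d0 dp] := dpi.
have r01' : 0 <= r < 1 by rewrite ltW.
pose f s := pkr r (s - t); rewrite -[leRHS]/(\int[mu]_(s in `[al - d, be + d]) f s).
have cf p q : {within `[p, q], continuous f}.
  by apply: continuous_subspaceT; exact: continuous_pkr_shift.
have f0 p q : 0 <= \int[mu]_(s in `[p, q]) f s.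
  by apply: Rintegral_ge0 => s _; exact: pkr_ge0.
have T := pkr_total t (t - pi) r01; rewrite -/f in T.
have tl p q : p <= q -> (forall s, p <= s <= q -> d <= `|s - t| <= pi) ->
    \int[mu]_(s in `[p, q]) f s <= pkr_tail r d * (q - p).
  move=> pq h; rewrite -Rintegral_cst_itv//; apply: le_Rintegral => //.
  - exact: integrable_within.
  - by apply: integrable_within => x; exact: cvg_cst.
  - by move=> s /=; rewrite in_itv/= => /h; exact: pkr_tail_ge.
have h1 : \int[mu]_(s in `[t - pi, t - d]) f s <= pkr_tail r d * (pi - d).
  apply: le_trans (tl _ _ _ _) _; first by lra.
    by move=> s hs; rewrite ler0_norm; lra.
  by rewrite (_ : t - d - (t - pi) = pi - d)//; ring.
have h2 : \int[mu]_(s in `[t + d, t - pi + 2 * pi]) f s <= pkr_tail r d * (pi - d).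
  apply: le_trans (tl _ _ _ _) _; first by lra.
    by move=> s hs; rewrite ger0_norm; lra.
  by rewrite (_ : t - pi + 2 * pi - (t + d) = pi - d)//; ring.
have t0 : 0 <= pkr_tail r d.
  by rewrite divr_ge0 ?mulr_ge0 ?subr_ge0 ?ltW ?cos_lt1//; nra.
have b1 : t - pi <= t - d by lra.
have b2 : t - d <= t - pi + 2 * pi by lra.
have b3 : t - d <= t + d by lra.
have b4 : t + d <= t - pi + 2 * pi by lra.
have b5 : al - d <= t - d by lra.
have b6 : t - d <= be + d by lra.
have b7 : t + d <= be + d by lra.
rewrite (Rintegral_split b1 b2 (cf _ _)) (Rintegral_split b3 b4 (cf _ _)) in T.
rewrite (Rintegral_split b5 b6 (cf _ _)) (Rintegral_split b3 b7 (cf _ _)).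
have p0 := f0 (al - d) (t - d); have q0 := f0 (t + d) (be + d).
have u : pkr_tail r d * (pi - d) <= pkr_tail r d * pi by rewrite ler_wpM2l//; lra.
move: (pi : R) (pkr_tail r d) p0 q0 T h1 h2 u.
move: (\int[mu]_(s in `[al - d, t - d]) f s) (\int[mu]_(s in `[t - d, t + d]) f s)
  (\int[mu]_(s in `[t + d, be + d]) f s) (\int[mu]_(s in `[t - pi, t - d]) f s) => A B E F p.
move: (\int[mu]_(s in `[t + d, t - p + 2 * p]) f s) => G.
move=> *; lra.
Qed.

(** For every [t] in [D], the kernel centred at [phi t] has almost all its mass in the widened
    interval; Tonelli then exchanges the integrals. A constraint on [t] is thereby traded for an
    average over the centre [s]. *)
Lemma smoothing_bound (r d al be : R) (D : set R) (phi w : R -> R) :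
  0 < r < 1 -> 0 < d <= pi -> pkr_tail r d <= 1 -> measurable D ->
  measurable_fun setT phi -> measurable_fun setT w -> (forall t, 0 <= w t) ->
  (forall t, D t -> al <= phi t <= be) ->
  ((2 * pi * (1 - pkr_tail r d))%:E * \int[mu]_(t in D) (w t)%:E <=
   \int[mu]_(s in `[(al - d)%R, (be + d)%R]) \int[mu]_(t in D) (pkr r (s - phi t) * w t)%:E)%E.
Proof.
move=> r01 dpi tl1 mD mphi mw w0 hphi; have r01' : 0 <= r < 1 by case/andP: r01 => /ltW ->.
set S := `[al - d, be + d]%classic.
have mS : measurable S by exact: measurable_itv.
pose F (st : R * R) : \bar R := (\1_S st.1 * (\1_D st.2 * (pkr r (st.1 - phi st.2) * w st.2)))%:E.
have mF : measurable_fun setT F.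
  apply/measurable_EFinP; apply: measurable_funM.
    by apply: measurableT_comp => //; exact: measurable_indic.
  apply: measurable_funM.
    by apply: measurableT_comp => //; exact: measurable_indic.
  apply: measurable_funM.
    apply: (measurableT_comp (continuous_measurable_fun (continuous_pkr r01'))).
    apply: measurable_funB; first exact: measurable_fst.
    by apply: measurableT_comp => //; exact: measurable_snd.
  by apply: measurableT_comp => //; exact: measurable_snd.
have F0 st : (0 <= F st)%E.
  rewrite lee_fin; apply: mulr_ge0; first by rewrite indicE.
  by apply: mulr_ge0; [rewrite indicE|rewrite mulr_ge0 ?pkr_ge0].
have := @fubini_tonelli _ _ _ _ R mu mu F mF F0.
have -> : (\int[mu]_x \int[mu]_y F (x, y))%E =
   (\int[mu]_(s in S) \int[mu]_(t in D) (pkr r (s - phi t) * w t)%:E)%E.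
  rewrite [RHS]integral_mkcond; apply: eq_integral => s _; rewrite patchE.
  case: ifPn => sS; last first.
    by rewrite integral0_eq// => t _; rewrite /F indicE (negbTE sS) mul0r.
  rewrite [RHS]integral_mkcond; apply: eq_integral => t _; rewrite patchE /F !indicE sS mul1r.
  by case: ifPn => tD; rewrite ?mul1r ?mul0r.
move=> ->.
rewrite -ge0_integralZl//; last 3 first.
- by apply/measurable_EFinP; exact: measurable_funTS.
- by move=> t _; rewrite lee_fin.
- by rewrite lee_fin mulr_ge0 ?subr_ge0// mulr_ge0// pi_ge0.
have FE t : (\int[mu]_x F (x, t))%E =
    (\1_D t * (w t * \int[mu]_(s in S) pkr r (s - phi t)))%:E.
  have cf : {within S, continuous (fun s => pkr r (s - phi t))}.
    by apply: continuous_subspaceT; exact: continuous_pkr_shift.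
  rewrite mulrA EFinM /Rintegral fineK; last exact/integrable_fin_num/integrable_within.
  rewrite -ge0_integralZl//; last 3 first.
  - by apply: (measurable_int mu); exact: integrable_within.
  - by move=> s _; rewrite lee_fin pkr_ge0.
  - by rewrite lee_fin mulr_ge0// indicE.
  rewrite [RHS]integral_mkcond; apply: eq_integral => s _; rewrite patchE /F.
  case: ifPn => sS; last by rewrite indicE (negbTE sS) mul0r.
  by rewrite [\1_S _]indicE sS mul1r -EFinM mulrCA mulrC mulrA mulrAC.
rewrite [leLHS]integral_mkcond; apply: ge0_le_integral => //.
- move=> t _; rewrite patchE; case: ifPn => // _.
  by rewrite mule_ge0// ?lee_fin// mulr_ge0 ?subr_ge0// mulr_ge0// pi_ge0.
- apply/measurable_restrict => //; rewrite setTI.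
  apply: measurable_funTS; apply: emeasurable_funM => //.
  by apply/measurable_EFinP.
- exact: measurable_fun_fubini_tonelli_G.
- move=> t _; rewrite FE patchE; case: ifPn => tD; last by rewrite indicE (negbTE tD) mul0r.
  rewrite indicE tD mul1r -EFinM lee_fin mulrC ler_wpM2l//.
  by apply: pkr_mass => //; apply: hphi; exact: set_mem.
Qed.

End Kernel.

(** * Harmonic measure and its transport by inner functions *)

Section HarmonicMeasure.
Context {R : realType}.
Local Notation C := R[i].
Local Notation nc := (@Normc.normc R).
Local Notation e_ := (@circle_point R).
Local Notation mu := (@lebesgue_measure R).
Implicit Types (a b z w : C).

(** The default 0 off the disc keeps the density nonnegative, so [harmonic_measure z] is a measure
    for every [z]; the restriction to [[0, 2 * pi[] counts each boundary point once. *)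
Definition poisson_density z (t : R) : R :=
  if (nc z < 1) && (0 <= t < 2 * pi) then pk z (e_ t) else 0.

(* harmonic measure of the disc seen from [z], in the angular coordinate and
   with total mass [2 pi] *)
Definition harmonic_measure z (B : set R) : \bar R :=
  (\int[mu]_(t in B) (poisson_density z t)%:E)%E.

Local Notation hm := harmonic_measure.

Lemma poisson_density_ge0 z t : 0 <= poisson_density z t.
Proof.
by rewrite /poisson_density; case: ifPn => // /andP[z1 _]; rewrite ltW// pk_gt0 ?nc_circle.
Qed.

Lemma measurable_poisson_density z : measurable_fun setT (poisson_density z).
Proof.
rewrite /poisson_density; have [z1|z1] := boolP (nc z < 1); last exact: measurable_cst.
have -> : (fun t : R => if true && (0 <= t < 2 * pi) then pk z (e_ t) else 0) =
    (fun t => \1_(`[0, 2 * pi[%classic) t * pk z (e_ t)).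
  apply/funext => t; rewrite indicE mem_setE in_itv/=.
  by case: ifPn; rewrite ?mul1r ?mul0r.
apply: measurable_funM; first exact: measurable_indic.
exact: (continuous_measurable_fun (continuous_pk_circle z1)).
Qed.

Let density_measurableE z D : measurable_fun D (EFin \o poisson_density z).
Proof.
apply/measurable_EFinP; apply: measurable_funTS; exact: measurable_poisson_density.
Qed.

Let hm0 z : hm z set0 = 0%E.
Proof. by rewrite /harmonic_measure integral_set0. Qed.

Let hm_ge0 z B : (0 <= hm z B)%E.
Proof. by apply: integral_ge0 => t _; rewrite lee_fin poisson_density_ge0. Qed.

Let hm_sigma_additive z : semi_sigma_additive (hm z).
Proof.
move=> /= A mA tA mUA.
rewrite /harmonic_measure ge0_integral_bigcup//.
- by apply: is_cvg_ereal_nneg_natsum_cond => n _ _; exact: hm_ge0.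
- exact: density_measurableE.
- by move=> x _; rewrite lee_fin poisson_density_ge0.
Qed.

HB.instance Definition _ z := isMeasure.Build _ _ _ (hm z) (hm0 z) (@hm_ge0 z) (@hm_sigma_additive z).

Lemma harmonic_measure_itv z (al be : R) : nc z < 1 -> 0 <= al -> be <= 2 * pi ->
  hm z `[al, be] = (\int[mu]_(t in `[al, be]) pk z (e_ t))%:E.
Proof.
move=> z1 al0 be2; rewrite /Rintegral fineK; last first.
  apply: integrable_fin_num => //; apply: integrable_within.
  exact: (continuous_subspaceT (continuous_pk_circle z1)).
have mP (a b : R) : measurable_fun `[a, b[%classic (fun t => (pk z (e_ t))%:E).
  apply/measurable_EFinP; apply: measurable_funTS.
  exact: (continuous_measurable_fun (continuous_pk_circle z1)).
rewrite /harmonic_measure -(@integral_itv_bndo_bndc _ (BLeft al) be _ (@density_measurableE z _)).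
rewrite -(@integral_itv_bndo_bndc _ (BLeft al) be _ (mP _ _)).
apply: eq_integral => t; rewrite inE/= in_itv/= => /andP[h1 h2].
by rewrite /poisson_density z1 (le_trans al0 h1)/= (lt_le_trans h2 be2).
Qed.

Lemma harmonic_measureI z B : hm z (B `&` `[0, 2 * pi[) = hm z B.
Proof.
rewrite /harmonic_measure integral_mkcondr; apply: eq_integral => t _; rewrite patchE.
case: ifPn => //; rewrite notin_setE/= in_itv/= => /negP/negbTE h.
by rewrite /poisson_density h andbF.
Qed.

Lemma harmonic_measure_total z : nc z < 1 -> hm z setT = (2 * pi)%:E.
Proof.
move=> z1; have mP : measurable_fun `[0, 2 * pi[%classic (EFin \o poisson_density z).
  exact: density_measurableE.
rewrite -harmonic_measureI setTI /hm integral_itv_bndo_bndc//.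
rewrite -/(hm z `[0, 2 * pi]) harmonic_measure_itv//.
by have := pk_total 0 z1; rewrite add0r => ->.
Qed.

Lemma harmonic_measure_fin_num z B : nc z < 1 -> measurable B -> hm z B \is a fin_num.
Proof.
move=> z1 mB; rewrite ge0_fin_numE//; apply: (@le_lt_trans _ _ (hm z setT)).
  by apply: le_measure; rewrite ?inE.
by rewrite harmonic_measure_total// ltry.
Qed.

Lemma harmonic_measure_harnack b z (x : R) B : nc b < 1 -> nc z < 1 ->
  nc (mob b z) <= x -> x < 1 -> measurable B ->
  (hm z B <= ((1 + x) / (1 - x))%:E * hm b B)%E.
Proof.
move=> b1 z1 xb x1 mB.
have x0 : 0 <= x by apply: le_trans xb; exact: nc_ge0.
have c0 : 0 <= (1 + x) / (1 - x) by rewrite divr_ge0; lra.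
rewrite /harmonic_measure -ge0_integralZl//.
apply: ge0_le_integral => //.
- by move=> t _; rewrite lee_fin poisson_density_ge0.
- exact: density_measurableE.
- by apply: emeasurable_funM => //; exact: density_measurableE.
- move=> t _; rewrite -EFinM lee_fin /poisson_density b1 z1/=.
  case: ifPn => _; last by rewrite mulr0.
  have /andP[_ h] := pk_harnack b1 z1 (nc_circle t) (erefl _).
  apply: le_trans h _; apply: ler_wpM2r; first by rewrite ltW// pk_gt0 ?nc_circle.
  have p0 := nc_ge0 (mob b z).
  by rewrite ler_pdivrMr; [rewrite mulrAC ler_pdivlMr; nra|lra].
- exact: density_measurableE.
- by move=> t _; rewrite lee_fin poisson_density_ge0.
Qed.

Lemma pk0_circle t : pk 0 (e_ t) = 1.
Proof. by rewrite /pk nc0 subr0 nc_circle expr0n/= subr0 expr1n divr1. Qed.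

Lemma harmonic_measure0 B : measurable B -> hm 0 B = mu (B `&` `[0, 2 * pi[).
Proof.
move=> mB; rewrite -harmonic_measureI /hm.
rewrite (eq_integral (cst 1%E)); first by rewrite integral_cst ?mul1e//; exact: measurableI.
move=> t; rewrite inE/= in_itv/= => -[_ h].
by rewrite /poisson_density nc0 ltr01 h pk0_circle.
Qed.

Lemma harmonic_measure_null z B : nc z < 1 -> measurable B ->
  mu (B `&` `[0, 2 * pi[) = 0%E -> hm z B = 0%E.
Proof.
move=> z1 mB B0; apply/eqP; rewrite eq_le hm_ge0 andbT.
have z0 : nc (mob 0 z) < 1 by apply: nc_mob_lt1 => //; rewrite nc0.
have := @harmonic_measure_harnack 0 z _ B _ z1 (lexx _) z0 mB.
by rewrite harmonic_measure0// B0 mule0; apply; rewrite nc0.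
Qed.

(** The invariance of harmonic measure known as Loewner's lemma, with every [z] as base point. It is
    stable under composition, so the compositions inherit it from the individual maps and their own
    radial limits are never studied. *)
Definition transports (g : R -> R) (F : C -> C) : Prop :=
  [/\ measurable_fun setT g, forall t, 0 <= g t < 2 * pi,
      forall z, nc z < 1 -> nc (F z) < 1 &
      forall z B, nc z < 1 -> measurable B -> hm z (g @^-1` B) = hm (F z) B].

Lemma transports_comp g h F G : transports g F -> transports h G ->
  transports (h \o g) (G \o F).
Proof.
move=> [mg g0 F1 gF] [mh h0 G1 hG]; split.
- exact: measurableT_comp.
- by move=> t; exact: h0.
- by move=> z z1; apply: G1; exact: F1.
- move=> z B z1 mB; rewrite comp_preimage gF ?hG//; first exact: F1.
  by rewrite -[X in measurable X]setTI; exact: mh.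
Qed.

Lemma transports_null g F z B : transports g F -> nc z < 1 -> measurable B ->
  mu (B `&` `[0, 2 * pi[) = 0%E -> hm z (g @^-1` B) = 0%E.
Proof.
by move=> [mg g0 F1 gF] z1 mB B0; rewrite gF//; apply: harmonic_measure_null => //; exact: F1.
Qed.

End HarmonicMeasure.

(** * Angular coordinate of a point of the circle *)

Section Angle.
Context {R : realType}.
Local Notation e_ := (@circle_point R).
Local Notation nc := (@Normc.normc R).

Lemma sqr_le1_norm (x : R) : (x ^+ 2 <= 1) = (`|x| <= 1).
Proof. by rewrite -[in RHS](@ler_pXn2r _ 2%N) ?nnegrE// real_normK ?num_real// expr1n. Qed.

Definition angle (x y : R) : R := if 0 <= y then acos x else 2 * pi - acos x.

(** The second hypothesis excludes [x = 1] with [y < 0], where the formula would give the forbidden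
    value [2 * pi]. *)
Lemma angle_bounds x y : -1 <= x <= 1 -> (y < 0 -> -1 < x < 1) -> 0 <= angle x y < 2 * pi.
Proof.
move=> x1 xy; have p0 := pi_gt0 R; rewrite /angle; case: ifPn => y0.
  by rewrite acos_ge0//= (le_lt_trans (acos_lepi x1))//; lra.
have /andP[h1 h2] := xy (ltac:(by rewrite ltNge)).
have g1 : acos x < pi by apply: acos_ltpi; rewrite h1 ltW.
have g2 : 0 < acos x by apply: acos_gt0; rewrite h2 ltW.
by apply/andP; split; lra.
Qed.

Lemma circle_point_angle x y : x ^+ 2 + y ^+ 2 = 1 -> e_ (angle x y) = x +i* y.
Proof.
move=> xy; have x1 : -1 <= x <= 1 by rewrite -ler_norml -sqr_le1_norm; have := sqr_ge0 y; lra.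
have ac : cos (acos x) = x by rewrite acosK// in_itv.
have sc : sin (acos x) = `|y| by rewrite sin_acos// -sqrtr_sqr; congr Num.sqrt; lra.
rewrite /angle /circle_point; case: ifPn => y0.
  by rewrite ac sc ger0_norm.
have {}y0 : y < 0 by rewrite ltNge.
rewrite [2 * pi]mulr_natl cosB sinB cos2pi sin2pi ac sc ltr0_norm//.
by congr (_ +i* _); ring.
Qed.

Lemma circle_pointP (z : R[i]) : nc z = 1 -> exists2 t, 0 <= t < 2 * pi & e_ t = z.
Proof.
move=> z1; have := nc_sqr z; rewrite z1 expr1n; case: z z1 => x y _ /= /esym xy.
exists (angle x y); last exact: circle_point_angle.
have x1 : -1 <= x <= 1 by rewrite -ler_norml -sqr_le1_norm; have := sqr_ge0 y; lra.
apply: angle_bounds => // y0; have y2 : 0 < y ^+ 2 by rewrite exprn_even_gt0//= lt_eqF.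
by apply/andP; split; nra.
Qed.

(** As [acos] is decreasing, the preimage of a ray above [x] is the preimage under [u] of the ray
    below [cos x]; values of [x] outside [[0, pi[] give everything or nothing. *)
Lemma measurable_acos_comp (u : R -> R) : measurable_fun setT u ->
  (forall t, -1 <= u t <= 1) -> measurable_fun setT (fun t => acos (u t)).
Proof.
move=> mu_ u1; apply: (measurability _ (RGenOInfty.measurableE R)) => //.
move=> _ [_ [x ->] <-]; rewrite setTI.
have [x0|x0] := ltP x 0.
  rewrite (_ : _ @^-1` _ = setT) //; apply/seteqP; split => // t _ /=.
  by rewrite in_itv/= andbT (lt_le_trans x0)// acos_ge0.
have [xpi|xpi] := leP pi x.
  rewrite (_ : _ @^-1` _ = set0) //; apply/seteqP; split => // t /=.
  by rewrite in_itv/= andbT => /(le_lt_trans xpi); rewrite ltNge acos_lepi.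
rewrite (_ : _ @^-1` _ = u @^-1` `]-oo, (cos x)[).
  by rewrite -[X in measurable X]setTI; exact: mu_.
have xI : x \in `[0, pi] by rewrite in_itv/= x0 ltW.
apply/seteqP; split => t /=; rewrite !in_itv/= andbT.
  by move=> h; rewrite -[u t]acosK ?in_itv//= ltr_cos ?in_itv/= ?acos_ge0 ?acos_lepi// x0 ltW.
by move=> h; move: h; rewrite -{1}[u t]acosK ?in_itv//= ltr_cos ?in_itv/= ?acos_ge0 ?acos_lepi// x0 ltW.
Qed.

Lemma measurable_angle (u v : R -> R) : measurable_fun setT u -> measurable_fun setT v ->
  (forall t, -1 <= u t <= 1) -> measurable_fun setT (fun t => angle (u t) (v t)).
Proof.
move=> mu_ mv u1; apply: measurable_fun_ifT => //.
- by apply: measurable_fun_ler.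
- exact: measurable_acos_comp.
- by apply: measurable_funB => //; exact: measurable_acos_comp.
Qed.

End Angle.

(** * Radial limits along a sequence of radii *)

Section Radial.
Context {R : realType}.
Local Notation C := R[i].
Local Notation e_ := (@circle_point R).
Local Notation nc := (@Normc.normc R).
Local Notation mu := (@lebesgue_measure R).
Implicit Types (f : C -> C) (z w : C).

Lemma unit_discE z : unit_disc z <-> nc z < 1.
Proof. by rewrite /unit_disc /= normCE ltcR. Qed.

Lemma unit_circleE z : unit_circle z <-> nc z = 1.
Proof. by rewrite /unit_circle /= normCE; split => [[]|->]. Qed.

Lemma radial_limit_eps f z : radial_dom f z -> forall e : R, 0 < e ->
  exists2 d : R, 0 < d & forall r : R, 1 - d < r < 1 ->
    nc (f (r%:C * z) - radial_ext f z) <= e.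
Proof.
move=> [_ cf] e e0; have e0C : 0 < e%:C :> C by rewrite ltcR.
move: cf => /cvgrPdist_le/(_ e%:C e0C).
rewrite near_withinE /= => /nbhs_ballP[d d0 hd]; exists d => // r /andP[h1 h2].
have := hd r; rewrite /ball /= gtr0_norm ?subr_gt0// => /(_ _ h2).
rewrite ltrBlDl -ltrBlDr => /(_ h1).
by rewrite normCE lecR ncBC.
Qed.

(** A sequence replaces the continuous radial limit, as pointwise limits of measurable functions and
    dominated convergence both call for sequences. The shift by two keeps all radii strictly between
    0 and 1. *)
Definition radius_seq (k : nat) : R := 1 - k.+2%:R^-1.

Lemma radius_seq_itv k : 0 < radius_seq k < 1.
Proof.
have h0 : 0 < k.+2%:R^-1 :> R by rewrite invr_gt0.
have h1 : k.+2%:R^-1 < 1 :> R by rewrite invf_lt1// ltr1n.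
by rewrite /radius_seq subr_gt0 h1 gtrBl h0.
Qed.

Lemma radius_seq_near d : 0 < d -> \forall k \near \oo, 1 - d < radius_seq k < 1.
Proof.
move=> d0; have := near_infty_natSinv_lt (PosNum d0); apply: filterS => k /= h.
have /andP[_ ->] := radius_seq_itv k; rewrite andbT /radius_seq ltrD2l ltrN2.
by apply: le_lt_trans h; rewrite lef_pV2 ?posrE// ler_nat.
Qed.

End Radial.

Section HerglotzKernel.
Context {R : realType}.
Local Notation C := R[i].
Local Notation e_ := (@circle_point R).
Local Notation nc := (@Normc.normc R).
Local Notation mu := (@lebesgue_measure R).
Implicit Types (f : C -> C) (z w : C).

(** For [r < 1] the pole is off the closed disc, so this is bounded and differentiable at boundary
    points too; its real part is a Poisson kernel, symmetric in the two boundary points. *)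
Definition herglotz (r s : R) (w : C) : C := (e_ s + r%:C * w) / (e_ s - r%:C * w).

Lemma herglotz_den r s w : 0 <= r < 1 -> nc w <= 1 -> e_ s - r%:C * w != 0.
Proof.
move=> /andP[r0 r1] w1; rewrite -nc_gt0.
have := ncD (e_ s - r%:C * w) (r%:C * w); rewrite subrK nc_circle ncM nc_real ger0_norm//.
have : r * nc w <= r by rewrite ler_piMr.
lra.
Qed.

Lemma Re_herglotz r s w : 0 <= r < 1 -> nc w <= 1 ->
  complex.Re (herglotz r s w) = pk (r%:C * w) (e_ s).
Proof.
move=> r01 w1; have d0 := herglotz_den s r01 w1.
have d1 : nc (e_ s - r%:C * w) ^+ 2 != 0 by rewrite expf_neq0// nc_eq0.
move: d1 d0 (nc_circle s); rewrite /pk /herglotz.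
move: (e_ s) (r%:C * w) => u v d1 d0 u1.
have c0 : conjc (u - v) != 0 by rewrite -nc_eq0 nc_conj nc_eq0.
have -> : (u + v) / (u - v) = ((nc (u - v) ^+ 2)^-1)%:C * ((u + v) * conjc (u - v)).
  rewrite realCV -mul_conj; move: (conjc _) c0 => m m0; field.
  by rewrite d0 m0.
rewrite Re_realM mulrC; congr (_ / _).
have -> : 1 = nc u ^+ 2 by rewrite u1 expr1n.
by rewrite !nc_sqr; case: u {d1 d0 u1 c0} => p q; case: v => p' q'; simpc => /=; ring.
Qed.

Lemma has_cderiv_herglotz r s w : 0 <= r < 1 -> nc w <= 1 ->
  exists l, has_cderiv (herglotz r s) w l.
Proof.
move=> r01 w1; have d0 := herglotz_den s r01 w1.
have h := has_cderivM (has_cderiv_cst r%:C w) (has_cderiv_id w).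
have h1 := has_cderivD (has_cderiv_cst (e_ s) w) h.
have h2 := has_cderivD (has_cderiv_cst (e_ s) w) (has_cderivM (has_cderiv_cst (- 1) w) h).
eexists; have := has_cderiv_div h1 h2; rewrite /= mulN1r => /(_ d0).
by apply: (has_cderiv_ext ltr01) => v _; rewrite /herglotz mulN1r.
Qed.

Lemma Re_herglotz_bounds r s w : 0 <= r < 1 -> nc w <= 1 ->
  0 <= complex.Re (herglotz r s w) <= (1 + r) / (1 - r).
Proof.
move=> r01 w1; rewrite Re_herglotz//; have /andP[r0 r1] := r01.
have rw : nc (r%:C * w) <= r by rewrite ncM nc_real ger0_norm// ler_piMr.
have rw1 := le_lt_trans rw r1.
have n0 := nc_ge0 (r%:C * w).
have /andP[_ h] := pk_bounds rw1 (nc_circle s).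
rewrite ltW ?pk_gt0 ?nc_circle//=; apply: le_trans h _.
by rewrite ler_pdivrMr; [rewrite mulrAC ler_pdivlMr; nra|lra].
Qed.

End HerglotzKernel.

(** * A Borel version of the boundary map *)

Section InnerAngle.
Context {R : realType}.
Local Notation C := R[i].
Local Notation e_ := (@circle_point R).
Local Notation nc := (@Normc.normc R).
Local Notation mu := (@lebesgue_measure R).
Local Notation hm := (@harmonic_measure R).
Variable f : C -> C.
Hypothesis f_inner : inner_function f.
Implicit Types (z w : C).

Lemma inner_holo w : nc w < 1 -> exists l, has_cderiv f w l.
Proof.
move=> w1; case: f_inner => h _ _; exists (cderiv f w).
by apply: derivable_has_cderiv; apply: h; apply/unit_discE.
Qed.

Lemma inner_disc w : nc w < 1 -> nc (f w) < 1.
Proof. by move=> w1; case: f_inner => _ h _; apply/unit_discE/h/unit_discE. Qed.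

Lemma inner_radial : exists N : set R, [/\ measurable N, mu N = 0%E &
  forall t, 0 <= t < 2 * pi -> ~ N t ->
    radial_dom f (e_ t) /\ nc (radial_ext f (e_ t)) = 1].
Proof.
case: f_inner => _ _ [N [mN N0 hN]]; exists N; split => // t t2 Nt.
apply: contrapT => h; apply: Nt; apply: hN; split => //; split.
  by apply/unit_circleE; exact: nc_circle.
by move=> [h1 h2]; apply: h; split => //; apply/unit_circleE.
Qed.

Lemma measurable_radial_approx k : 
  measurable_fun `[0, 2 * pi[%classic (fun t => complex.Re (f ((radius_seq k)%:C * e_ t))) /\
  measurable_fun `[0, 2 * pi[%classic (fun t => complex.Im (f ((radius_seq k)%:C * e_ t))).
Proof.
have r01 := @radius_seq_itv R k.
have sub : `[0, 2 * pi[%classic `<=` (`[0, 2 * pi]%classic : set R).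
  by apply: subset_itvl; rewrite bnd_simp.
split.
- apply: (@measurable_funS _ _ _ _ `[0, 2 * pi]%classic) => //.
  apply: subspace_continuous_measurable_fun => //.
  by apply: (continuous_on_circles r01) => w /andP[_]; exact: inner_holo.
- apply: (@measurable_funS _ _ _ _ `[0, 2 * pi]%classic) => //.
  have -> : (fun t => complex.Im (f ((radius_seq k)%:C * e_ t))) =
     (fun t => complex.Re ((fun w => - 'i * f w) ((radius_seq k)%:C * e_ t))).
    by apply/funext => t /=; case: (f _) => x y; simpc.
  apply: subspace_continuous_measurable_fun => //.
  apply: (@continuous_on_circles _ (fun w => - 'i * f w) _ _ _ _ r01) => w /andP[_ /inner_holo[l hl]].
  by eexists; exact: (has_cderivM (has_cderiv_cst (- 'i) w) hl).
Qed.

Lemma radius_seq_cvg t : radial_dom f (e_ t) -> forall e : R, 0 < e ->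
  \forall k \near \oo, nc (f ((radius_seq k)%:C * e_ t) - radial_ext f (e_ t)) <= e.
Proof.
move=> ft e e0; have [d d0 hd] := radial_limit_eps ft e0.
by apply: filterS (radius_seq_near d0) => k; exact: hd.
Qed.

(* the boundary map in the angular coordinate, made Borel by an arbitrary
   choice on a null set *)
Lemma inner_angle : exists (g : R -> R) (N : set R),
  [/\ measurable_fun setT g, forall t, 0 <= g t < 2 * pi, measurable N, mu N = 0%E &
  forall t, 0 <= t < 2 * pi -> ~ N t ->
    radial_dom f (e_ t) /\ radial_ext f (e_ t) = e_ (g t)].
Proof.
have [N [mN N0 hN]] := inner_radial.
pose D := `[0, 2 * pi[%classic `\` N.
have mD : measurable D by apply: measurableD.
have DN t : D t -> radial_dom f (e_ t) /\ nc (radial_ext f (e_ t)) = 1.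
  by move=> [h1 h2]; apply: hN => //; move: h1; rewrite /= in_itv.
have Dsub : D `<=` `[0, 2 * pi[%classic by move=> t [].
pose u t := complex.Re (radial_ext f (e_ t)); pose v t := complex.Im (radial_ext f (e_ t)).
have mu_ : measurable_fun D u.
  apply: (@measurable_fun_cvg _ _ _ _ (fun k t => complex.Re (f ((radius_seq k)%:C * e_ t)))).
    by move=> k; apply: (measurable_funS _ Dsub (measurable_radial_approx k).1).
  move=> t /DN[rt _]; apply/cvgrPdist_le => e e0; apply: filterS (radius_seq_cvg rt e0) => k h.
  by rewrite distrC -ReB; apply: le_trans (Re_le_nc _) h.
have mv : measurable_fun D v.
  apply: (@measurable_fun_cvg _ _ _ _ (fun k t => complex.Im (f ((radius_seq k)%:C * e_ t)))).
    by move=> k; apply: (measurable_funS _ Dsub (measurable_radial_approx k).2).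
  move=> t /DN[rt _]; apply/cvgrPdist_le => e e0; apply: filterS (radius_seq_cvg rt e0) => k h.
  by rewrite distrC -ImB; apply: le_trans (Im_le_nc _) h.
(* Off [D] both coordinates become 0, which still yields an angle in [[0, 2 * pi[], so the map is
   defined everywhere. *)
have mu' : measurable_fun setT (u \_ D) by exact: ((measurable_restrictT u mD).1 mu_).
have mv' : measurable_fun setT (v \_ D) by exact: ((measurable_restrictT v mD).1 mv).
have uv t : D t -> u t ^+ 2 + v t ^+ 2 = 1.
  by move=> /DN[_ h]; rewrite /u /v -nc_sqr h expr1n.
have u1 t : -1 <= (u \_ D) t <= 1.
  rewrite patchE; case: ifPn => tD; last by rewrite lerN10 ler01.
  have := uv t (set_mem tD); rewrite -ler_norml -sqr_le1_norm; have := sqr_ge0 (v t); lra.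
exists (fun t => angle ((u \_ D) t) ((v \_ D) t)), N; split => //.
- exact: measurable_angle.
- move=> t; apply: angle_bounds => //; rewrite !patchE; case: ifPn => tD; last by rewrite ltxx.
  move=> v0; have := uv t (set_mem tD).
  have v2 : 0 < v t ^+ 2 by rewrite exprn_even_gt0//= lt_eqF.
  by move=> h; apply/andP; split; nra.
- move=> t t2 Nt; have tD : D t by split => //=; rewrite in_itv.
  have [h1 h2] := DN t tD; split => //.
  rewrite !patchE mem_set// circle_point_angle ?uv//.
  by rewrite /u /v; case: (radial_ext _ _).
Qed.

End InnerAngle.

(** * Upper bound for preimages of closed arcs *)

Section BoundaryPoisson.
Context {R : realType}.
Local Notation C := R[i].
Local Notation e_ := (@circle_point R).
Local Notation nc := (@Normc.normc R).
Local Notation mu := (@lebesgue_measure R).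
Local Notation hm := (@harmonic_measure R).
Implicit Types (z w : C).

Lemma le_of_le_addM (A B K d0 : R) : 0 < d0 -> 0 <= K ->
  (forall d, 0 < d <= d0 -> A <= B + d * K) -> A <= B.
Proof.
move=> d00 K0 h; apply/ler_addgt0Pl => e e0.
have K1 : 0 < K + 1 by rewrite ltr_wpDl.
pose d := Num.min d0 (e / (K + 1)).
have d1 : 0 < d <= d0 by rewrite lt_min d00 divr_gt0//= ge_min lexx.
have d2 : d <= e / (K + 1) by rewrite ge_min lexx orbT.
apply: le_trans (h _ d1) _; rewrite addrC lerD2r.
apply: le_trans (ler_wpM2r K0 d2) _.
by rewrite mulrAC -mulrA ler_piMr ?ltW// ltr_pdivrMr// mul1r ltrDl.
Qed.

Lemma pkr_tail_le (r d : R) : 1 / 2 <= r < 1 -> 0 < d <= pi ->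
  pkr_tail r d <= (1 - r) * (2 / (1 - cos d)).
Proof.
move=> /andP[r0 r1] dpi; have c1 := cos_lt1 dpi.
rewrite /pkr_tail ler_pdivrMr; last by rewrite !mulr_gt0//; lra.
have -> : (1 - r) * (2 / (1 - cos d)) * (2 * r * (1 - cos d)) = 4 * r * (1 - r).
  by field; rewrite subr_eq0 gt_eqF.
nra.
Qed.

Lemma smoothing_bound_le (r d al be : R) (D : set R) (phi w : R -> R) (h : R -> \bar R) :
  0 < r < 1 -> 0 < d <= pi -> pkr_tail r d <= 1 -> measurable D ->
  measurable_fun setT phi -> measurable_fun setT w -> (forall t, 0 <= w t) ->
  (forall t, D t -> al <= phi t <= be) ->
  measurable_fun `[al - d, be + d] h ->
  (forall s, (\int[mu]_(t in D) (pkr r (s - phi t) * w t)%:E <= h s)%E) ->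
  ((2 * pi * (1 - pkr_tail r d))%:E * \int[mu]_(t in D) (w t)%:E <=
   \int[mu]_(s in `[(al - d)%R, (be + d)%R]) h s)%E.
Proof.
move=> r01 dpi tl1 mD mphi mw w0 hphi mh hh.
have r01' : 0 <= r < 1 by case/andP: r01 => /ltW ->.
apply: le_trans (smoothing_bound r01 dpi tl1 mD mphi mw w0 hphi) _.
pose F (st : R * R) : \bar R := (\1_D st.2 * (pkr r (st.1 - phi st.2) * w st.2))%:E.
have mF : measurable_fun setT F.
  apply/measurable_EFinP; apply: measurable_funM.
    by apply: measurableT_comp => //; exact: measurable_indic.
  apply: measurable_funM.
    apply: (measurableT_comp (continuous_measurable_fun (continuous_pkr r01'))).
    apply: measurable_funB; first exact: measurable_fst.
    by apply: measurableT_comp => //; exact: measurable_snd.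
  by apply: measurableT_comp => //; exact: measurable_snd.
have F0 st : (0 <= F st)%E.
  by rewrite lee_fin; apply: mulr_ge0; [rewrite indicE|rewrite mulr_ge0 ?pkr_ge0].
have E s : (\int[mu]_t F (s, t))%E = (\int[mu]_(t in D) (pkr r (s - phi t) * w t)%:E)%E.
  rewrite [RHS]integral_mkcond; apply: eq_integral => t _; rewrite patchE /F indicE.
  by case: ifPn => tD; rewrite ?mul1r ?mul0r.
apply: ge0_le_integral => //.
- by move=> s _; rewrite -E; exact: integral_ge0.
- apply: measurable_funTS; rewrite -(funext E).
  exact: (@measurable_fun_fubini_tonelli_F _ _ _ _ R mu F mF F0).
Qed.

Variable f : C -> C.
Hypothesis f_inner : inner_function f.
Variables (g : R -> R) (N : set R).
Hypothesis mg : measurable_fun setT g.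
Hypothesis g_itv : forall t, 0 <= g t < 2 * pi.
Hypothesis mN : measurable N.
Hypothesis N0 : mu N = 0%E.
Hypothesis gN : forall t, 0 <= t < 2 * pi -> ~ N t ->
    radial_dom f (e_ t) /\ radial_ext f (e_ t) = e_ (g t).

(* The mean value property over the boundary values of [f], by dominated
   convergence along the radii. *)
Lemma boundary_poisson r s z : 0 <= r < 1 -> nc z < 1 ->
  (\int[mu]_t (pkr r (s - g t) * poisson_density z t)%:E)%E =
  (2 * pi * complex.Re (herglotz r s (f z)))%:E.
Proof.
move=> r01 z1; have /andP[r0 r1] := r01.
pose F k t : R := complex.Re (herglotz r s (f ((radius_seq k)%:C * e_ t))) * pk z (e_ t).
pose L t : R := pkr r (s - g t) * pk z (e_ t).
have fD w : nc w < 1 -> nc (f w) <= 1 by move=> w1; apply: ltW; exact: (inner_disc f_inner).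
have hol w : nc w < 1 -> exists l, has_cderiv (fun w => herglotz r s (f w)) w l.
  move=> w1; have [l hl] := inner_holo f_inner w1.
  have [k hk] := has_cderiv_herglotz s r01 (fD _ w1).
  by eexists; exact: (has_cderiv_comp hl hk).
have rkC k t : nc ((radius_seq k)%:C * e_ t) < 1.
  by have /andP[h1 h2] := @radius_seq_itv R k; rewrite ncM nc_real nc_circle mulr1 gtr0_norm.
transitivity (\int[mu]_(t in `[0%R, (2 * pi)%R[) (L t)%:E)%E.
  rewrite [RHS]integral_mkcond; apply: eq_integral => t _; rewrite patchE mem_setE in_itv/=.
  by rewrite /poisson_density z1/=; case: ifPn; rewrite ?mulr0.
have cF k : {within `[0, 2 * pi], continuous (F k)}.
  move=> t; apply: cvgM.
    have := @continuous_on_circles _ (fun w => herglotz r s (f w)) 1 (radius_seq k) 0 (2 * pi) (radius_seq_itv k).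
    by apply=> w /andP[_]; exact: hol.
  exact: (continuous_subspaceT (continuous_pk_circle z1)).
have mF k : measurable_fun `[0, 2 * pi[%classic (EFin \o F k).
  apply/measurable_EFinP; apply: (@measurable_funS _ _ _ _ `[0, 2 * pi]%classic) => //.
    by apply: subset_itvl; rewrite bnd_simp.
  by apply: subspace_continuous_measurable_fun => //; exact: cF.
have mL : measurable_fun `[0, 2 * pi[%classic (EFin \o L).
  apply/measurable_EFinP; apply: measurable_funTS; apply: measurable_funM.
    apply: (measurableT_comp (continuous_measurable_fun (continuous_pkr r01))).
    by apply: measurable_funB => //; exact: measurable_cst.
  exact: (continuous_measurable_fun (continuous_pk_circle z1)).
have IF k : (\int[mu]_(t in `[0%R, (2 * pi)%R[) (EFin \o F k) t)%E =
    (2 * pi * complex.Re (herglotz r s (f ((radius_seq k)%:C * z))))%:E.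
  have := @poisson_disc _ (fun w => herglotz r s (f w)) z (radius_seq k) 0 z1 (radius_seq_itv k) hol.
  rewrite add0r /Rintegral => <-; rewrite fineK; last first.
    by apply: integrable_fin_num => //; exact: (integrable_within (cF k)).
  exact: (@integral_itv_bndo_bndc _ (BLeft 0) (2 * pi) _ (mF k)).
pose M : R := (1 + r) / (1 - r) * ((1 + nc z) / (1 - nc z)).
have mu_fin : (mu (`[0%R, (2 * pi)%R[%classic : set R) < +oo)%E.
  by rewrite lebesgue_measure_itv/=; case: ifPn => // _; rewrite -EFinB ltry.
have herg_cvg w (a : nat -> C) : nc w <= 1 ->
    (forall e : R, 0 < e -> \forall k \near \oo, nc (a k - w) <= e) ->
    complex.Re (herglotz r s (a k)) @[k --> \oo] --> complex.Re (herglotz r s w).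
  move=> w1 aw; have [l hl] := has_cderiv_herglotz s r01 w1.
  apply/cvgrPdist_le => e e0; have [d d0 hd] := has_cderiv_cont hl e0.
  apply: filterS (aw (d / 2) (divr_gt0 d0 (ltr0Sn R 1))) => k hk.
  rewrite distrC -ReB; apply: le_trans (Re_le_nc _) (ltW (hd _ _)).
  by apply: le_lt_trans hk _; rewrite ltr_pdivrMr// ltr_pMr// ltr1n.
(* By the symmetry of the kernel on the circle, the boundary value of the Herglotz real part is the
   kernel centred at [g t]. *)
have LE t : L t = complex.Re (herglotz r s (e_ (g t))) * pk z (e_ t).
  by rewrite /L Re_herglotz ?nc_circle// pk_sym ?nc_circle// pkrE.
have H1 : {ae mu, forall t, `[0, 2 * pi[%classic t ->
    (EFin \o F k) t @[k --> \oo] --> (EFin \o L) t}.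
  exists N; split => // t /=; apply: contra_notP => Nt; rewrite in_itv/= => t2.
  have [rt et] := gN t2 Nt.
  have w1 : nc (radial_ext f (e_ t)) <= 1 by rewrite et nc_circle.
  apply/fine_cvgP; split; first by apply: nearW.
  rewrite LE -et /=; apply: cvgM; last exact: cvg_cst.
  by apply: herg_cvg => // e e0; exact: radius_seq_cvg.
have H2 : mu.-integrable `[0, 2 * pi[%classic (cst M%:E).
  apply: (@measurable_bounded_integrable _ _ _ _ (cst M)) => //.
  exact: bounded_cst.
have H3 : {ae mu, forall t k, `[0, 2 * pi[%classic t -> (`|(EFin \o F k) t| <= cst M%:E t)%E}.
  apply: aeW => t k _; rewrite /= lee_fin normrM.
  have /andP[a1 a2] := Re_herglotz_bounds s r01 (fD _ (rkC k t)).
  have /andP[b1 b2] := pk_circle_bound t z1.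
  by rewrite ger0_norm// [X in _ * X]ger0_norm// ler_pM.
have [_ _ h] := @dominated_convergence _ _ R mu _ (measurable_itv _) (fun k => EFin \o F k) (EFin \o L) (cst M%:E) mF mL H1 H2 H3.
apply: cvg_unique h _ => //.
apply/fine_cvgP; split; first by apply: nearW => k /=; rewrite IF.
have -> : fine \o (fun k => \int[mu]_(t in `[0%R, (2 * pi)%R[) (EFin \o F k) t)%E =
   (fun k => 2 * pi * complex.Re (herglotz r s (f ((radius_seq k)%:C * z)))).
  by apply/funext => k /=; rewrite IF.
apply: cvgM; first exact: cvg_cst.
apply: herg_cvg => [|e e0]; first exact: fD.
have [l hl] := inner_holo f_inner z1.
have [d d0 hd] := has_cderiv_cont hl e0.
apply: filterS (@radius_seq_near R d d0) => k /andP[k1 k2]; apply/ltW/hd.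
have -> : (radius_seq k)%:C * z - z = ((radius_seq k) - 1)%:C * z.
  by case: (z) => p q; simpc; congr (_ +i* _); ring.
rewrite ncM nc_real ltr0_norm ?subr_lt0// opprB.
apply: le_lt_trans (_ : 1 - radius_seq k < d); last by lra.
by apply: ler_piMr; [rewrite subr_ge0 ltW|exact: ltW].
Qed.

(** Smoothing with [phi = g] and the density seen from [z]. Enlarging the inner integral to all [t]
    only increases it, and [boundary_poisson] then evaluates it. *)
Lemma boundary_itv_le_smoothed r d (al be : R) z : 0 < r < 1 -> 0 < d <= pi ->
  pkr_tail r d <= 1 -> al <= be -> nc z < 1 ->
  (1 - pkr_tail r d) * fine (hm z (g @^-1` `[al, be])) <=
  \int[mu]_(s in `[al - d, be + d]) pk (r%:C * f z) (e_ s).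
Proof.
move=> r01 dpi tl1 albe z1; have r01' : 0 <= r < 1 by case/andP: r01 => /ltW ->.
have mB : measurable (g @^-1` `[al, be]%classic) by rewrite -[X in measurable X]setTI; exact: mg.
have p0 := pi_gt0 R.
have fz1 := inner_disc f_inner z1.
have rf1 : nc (r%:C * f z) < 1.
  have /andP[r0 r1] := r01; rewrite ncM nc_real gtr0_norm//.
  by apply: le_lt_trans fz1; rewrite ler_piMl ?nc_ge0// ltW.
have cP : {within `[al - d, be + d], continuous (fun s => pk (r%:C * f z) (e_ s))}.
  exact: (continuous_subspaceT (continuous_pk_circle rf1)).
rewrite -(@ler_pM2l _ (2 * pi)) ?mulr_gt0// mulrA -lee_fin EFinM fineK; last exact: harmonic_measure_fin_num.
have -> : (2 * pi * \int[mu]_(s in `[(al - d), (be + d)]) pk (r%:C * f z) (e_ s))%:E =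
   (\int[mu]_(s in `[(al - d)%R, (be + d)%R]) (2 * pi * pk (r%:C * f z) (e_ s))%:E)%E.
  rewrite EFinM /Rintegral fineK; last first.
    by apply: integrable_fin_num => //; exact: (integrable_within cP).
  rewrite -ge0_integralZl//.
  - exact: (measurable_int mu (integrable_within cP)).
  - by move=> s _; rewrite lee_fin ltW// pk_gt0 ?nc_circle.
  - by rewrite lee_fin mulr_ge0// ltW.
apply: (@smoothing_bound_le r d al be _ g (poisson_density z)) => //.
- exact: measurable_poisson_density.
- exact: poisson_density_ge0.
- apply/measurable_EFinP; apply: measurable_funM; first exact: measurable_cst.
  by apply: subspace_continuous_measurable_fun.
move=> s.
apply: (@le_trans _ _ (\int[mu]_t (pkr r (s - g t) * poisson_density z t)%:E)%E).
  apply: ge0_subset_integral => //.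
  - apply/measurable_EFinP; apply: measurable_funM.
      apply: (measurableT_comp (continuous_measurable_fun (continuous_pkr r01'))).
      by apply: measurable_funB => //; exact: measurable_cst.
    exact: measurable_poisson_density.
  - by move=> t _; rewrite lee_fin mulr_ge0 ?pkr_ge0 ?poisson_density_ge0.
by rewrite boundary_poisson// Re_herglotz// ltW.
Qed.

(** The two limits are taken in a fixed order: for given [d] the kernel tail vanishes as [r] tends
    to 1, and only afterwards does the widening [d] tend to 0. *)
Lemma boundary_itv_le (al be : R) z : 0 <= al -> al <= be -> be <= 2 * pi -> nc z < 1 ->
  (hm z (g @^-1` `[al, be]) <= hm (f z) `[al, be])%E.
Proof.
move=> al0 albe be2 z1; have b1 := inner_disc f_inner z1; set b := f z.
have mB : measurable (g @^-1` `[al, be]%classic) by rewrite -[X in measurable X]setTI; exact: mg.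
rewrite -(@fineK _ (hm z _)); last exact: harmonic_measure_fin_num.
rewrite harmonic_measure_itv// lee_fin; set A := fine _; set H := Rintegral _ _ _.
have p0 := pi_gt0 R.
have A0 : 0 <= A by rewrite fine_ge0.
have H0 : 0 <= H by apply: Rintegral_ge0 => t _; rewrite ltW// pk_gt0 ?nc_circle.
pose M := (1 + nc b) / (1 - nc b).
have M0 : 0 <= M by have nb0 := nc_ge0 b; rewrite divr_ge0; lra.
have cP p q : {within `[p, q], continuous (fun s => pk b (e_ s))}.
  exact: (continuous_subspaceT (continuous_pk_circle b1)).
have Pb p q : p <= q -> \int[mu]_(s in `[p, q]) pk b (e_ s) <= M * (q - p).
  move=> pq; apply: le_trans (ler_norm _) _; apply: le_norm_Rintegral => // t _.
  by have /andP[h1 h2] := pk_circle_bound t b1; rewrite ger0_norm.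
apply: (@le_of_le_addM _ _ (2 * M) pi) => //; first by rewrite mulr_ge0.
move=> d dpi; have /andP[d0 dp] := dpi.
have c1 := cos_lt1 dpi.
pose c := 2 / (1 - cos d).
have cpos : 0 < c by rewrite divr_gt0// subr_gt0.
pose k := (1 - nc b)^-1.
have k0 : 0 < k by rewrite invr_gt0 subr_gt0.
pose W := H + d * (2 * M).
have W0 : 0 <= W by rewrite addr_ge0// mulr_ge0 ?(ltW d0)// mulr_ge0.
(* The thresholds on [dl = 1 - r] serve [pkr_tail_le], a kernel tail at most 1, and a distance
   [x <= 1 / 2] from [b] to [r b], for which [(1 + x) / (1 - x) <= 1 + 4 * x]. *)
apply: (@le_of_le_addM _ _ (c * A + 4 * k * W) (Num.min (1 / 2) (Num.min (1 / c) (1 / (2 * k))))).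
- by rewrite !lt_min; apply/and3P; split; apply: divr_gt0 => //; apply: mulr_gt0.
- by rewrite addr_ge0// mulr_ge0 ?(ltW cpos)// mulr_ge0// (ltW k0).
move=> dl /andP[dl0]; rewrite !le_min => /and3P[h1 h2 h3].
pose r := 1 - dl.
have r01 : 0 < r < 1 by rewrite /r; apply/andP; split; lra.
have rh : 1 / 2 <= r < 1 by rewrite /r; apply/andP; split; lra.
have rE : 1 - r = dl by rewrite /r; ring.
have t1 : pkr_tail r d <= dl * c by have := pkr_tail_le rh dpi; rewrite rE.
have t2 : dl * c <= 1 by rewrite -ler_pdivlMr.
have x1 : dl * k <= 1 / 2.
  by move: h3; rewrite ler_pdivlMr ?mulr_gt0//; lra.
have := boundary_itv_le_smoothed r01 dpi (le_trans t1 t2) albe z1; rewrite -/A -/b => hA.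
have rb : nc (r%:C * b) < 1.
  have /andP[r0 r1] := r01; rewrite ncM nc_real gtr0_norm//.
  by apply: le_lt_trans b1; rewrite ler_piMl ?nc_ge0// ltW.
have xb : nc (mob b (r%:C * b)) <= dl * k.
  have /andP[r0 r1] := r01.
  have -> : mob b (r%:C * b) = (- dl%:C * b) / (1 - conjc b * (r%:C * b)).
    congr (_ / _); rewrite /r; case: (b) => p q; simpc; congr (_ +i* _); ring.
  rewrite ncM ncV ncM ncN nc_real gtr0_norm// -mulrA ler_wpM2l ?(ltW dl0)//.
  have D0 : 1 - nc b <= nc (1 - conjc b * (r%:C * b)).
    have := ncD (1 - conjc b * (r%:C * b)) (conjc b * (r%:C * b)); rewrite subrK nc1.
    have : nc (conjc b * (r%:C * b)) <= nc b.
      by rewrite ncM nc_conj ler_piMr ?nc_ge0// ltW.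
    lra.
  have D1 : 0 < 1 - nc b by rewrite subr_gt0.
  apply: (@le_trans _ _ (1 * k)); last by rewrite mul1r.
  apply: ler_pM; [exact: nc_ge0|by rewrite invr_ge0 nc_ge0|exact: ltW|].
  by rewrite lef_pV2 ?posrE//; apply: lt_le_trans D0.
have hB : \int[mu]_(s in `[al - d, be + d]) pk (r%:C * b) (e_ s) <= (1 + 4 * (dl * k)) * W.
  apply: (@le_trans _ _ ((1 + 4 * (dl * k)) * \int[mu]_(s in `[al - d, be + d]) pk b (e_ s))).
    rewrite -RintegralZl//; last exact: (integrable_within (cP _ _)).
    apply: le_Rintegral => //.
    - apply: integrable_within; exact: (continuous_subspaceT (continuous_pk_circle rb)).
    - apply: integrable_within => t; apply: cvgM; [exact: cvg_cst|exact: cP].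
    move=> s _; have /andP[_ h] := pk_harnack b1 rb (nc_circle s) (erefl _).
    apply: le_trans h _; apply: ler_wpM2r; first by rewrite ltW// pk_gt0 ?nc_circle.
    have n0 := nc_ge0 (mob b (r%:C * b)).
    by rewrite ler_pdivrMr; nra.
  rewrite ler_wpM2l//; first by rewrite addr_ge0// mulr_ge0// mulr_ge0// ltW.
  have b1' : al - d <= al by lra.
  have b2' : al <= be + d by lra.
  have b3' : be <= be + d by lra.
  rewrite (Rintegral_split b1' b2' (cP _ _)) (Rintegral_split albe b3' (cP _ _)) -/H.
  have := Pb _ _ b1'; have := Pb _ _ b3'; rewrite /W.
  have -> : be + d - be = d by ring.
  have -> : al - (al - d) = d by ring.
  lra.
have := le_trans hA hB.
have : (1 - dl * c) * A <= (1 - pkr_tail r d) * A by rewrite ler_wpM2r// lerD2l lerN2.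
rewrite /W; move: (d * (2 * M)) => V; nra.
Qed.

End BoundaryPoisson.

(** * Transport of harmonic measure by the boundary map *)

Section InnerBoundaryMap.
Context {R : realType}.
Local Notation C := R[i].
Local Notation e_ := (@circle_point R).
Local Notation nc := (@Normc.normc R).
Local Notation mu := (@lebesgue_measure R).
Local Notation hm := (@harmonic_measure R).
Implicit Types (z w : C).

Lemma harmonic_measure_setC z (A : set R) : nc z < 1 -> measurable A ->
  (hm z A + hm z (~` A) = (2 * pi)%:E)%E.
Proof.
move=> z1 mA; rewrite -measureU ?setICr//; last exact: measurableC.
by rewrite setUv; exact: harmonic_measure_total.
Qed.

Lemma harmonic_measure_ray_closed z (x : R) : nc z < 1 ->
  (hm z `[0%R, x] <= hm z `]-oo, x[)%E.
Proof.
move=> z1; rewrite /harmonic_measure -integral_itv_bndo_bndc; last first.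
  apply/measurable_EFinP; apply: measurable_funTS; exact: measurable_poisson_density.
apply: ge0_subset_integral => //.
- apply/measurable_EFinP; apply: measurable_funTS; exact: measurable_poisson_density.
- by move=> t _; rewrite lee_fin poisson_density_ge0.
- by apply: subset_itvr; rewrite bnd_simp.
Qed.

Lemma inner_transports (f : C -> C) (g : R -> R) (N : set R) : inner_function f ->
  measurable_fun setT g -> (forall t, 0 <= g t < 2 * pi) ->
  measurable N -> mu N = 0%E ->
  (forall t, 0 <= t < 2 * pi -> ~ N t ->
    radial_dom f (e_ t) /\ radial_ext f (e_ t) = e_ (g t)) ->
  transports g f.
Proof.
move=> f_inner mg g2 mN N0 gN; split => //; first exact: inner_disc.
move=> z B z1 mB; have b1 := inner_disc f_inner z1; set b := f z in b1 *.
have pre A : measurable A -> measurable (g @^-1` A).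
  by move=> mA; rewrite -[X in measurable X]setTI; exact: mg.
pose m1 := measure_function_pushforward__canonical__measure_function_Measure (hm z) mg.
have p0 := pi_gt0 R.
have bnd (al be : R) : 0 <= al -> al <= be -> be <= 2 * pi ->
    (hm z (g @^-1` `[al, be]) <= hm b `[al, be])%E.
  by move=> *; apply: (boundary_itv_le f_inner mg mN N0 gN).
apply: (@measure_unique _ R _ (@RGenInftyO.G R) (fun k => `]-oo, k%:R[%classic) _ _ _ _ m1 (hm b)) => //.
- exact: RGenInftyO.measurableE.
- move=> _ _ [x ->] [y ->]; exists (Num.min x y).
  apply/seteqP; split => t /=; rewrite !in_itv/= lt_min; first by move=> [-> ->].
  by move=> /andP[].
- by move=> k; exists k%:R.
- apply/seteqP; split => // x _; exists (Num.Def.archi_bound `|x|) => //=.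
  by rewrite in_itv/=; apply: le_lt_trans (ler_norm x) (archi_boundP _).
- move=> _ [x ->]; rewrite /m1 /= /pushforward.
  (* Rays form a generating family closed under intersection. Those ending outside []0, 2 * pi]]
     carry no mass or all of it for both measures. *)
  have [x0|x0] := leP x 0.
    rewrite -[RHS]harmonic_measureI (_ : `]-oo, x[%classic `&` _ = set0); last first.
      by apply/seteqP; split => // t /=; rewrite !in_itv/= => -[h1 /andP[h2 _]]; move: (le_lt_trans h2 h1); rewrite ltNge x0.
    rewrite (_ : g @^-1` _ = set0) ?measure0//.
    by apply/seteqP; split => // t /=; rewrite in_itv/= => h; have /andP[h2 _] := g2 t; move: (le_lt_trans h2 h); rewrite ltNge x0.
  have [x2|x2] := leP x (2 * pi); last first.
    rewrite -[RHS]harmonic_measureI (_ : `]-oo, x[%classic `&` `[0, 2 * pi[ = setT `&` `[0, 2 * pi[); last first.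
      apply/seteqP; split=> t /=; rewrite !in_itv/= => -[h1 h2]; split => //.
      by have /andP[_ h3] := h2; exact: lt_trans x2.
    rewrite harmonic_measureI harmonic_measure_total// (_ : g @^-1` _ = setT) ?harmonic_measure_total//.
    by apply/seteqP; split => // t _ /=; rewrite in_itv/=; have /andP[_ h2] := g2 t; exact: lt_trans x2.
  have mP : measurable (`]-oo, x[%classic : set R) by exact: measurable_itv.
  have P1 : (hm z (g @^-1` `]-oo, x[) <= hm b `]-oo, x[)%E.
    apply: le_trans (harmonic_measure_ray_closed x b1).
    apply: le_trans (bnd 0 x _ _ _); rewrite ?(ltW x0)//.
    apply: le_measure; rewrite ?inE; [exact: (pre _ mP)|exact: (pre _ (measurable_itv _))|].
    by move=> t /=; rewrite !in_itv/= => h; have /andP[-> _] := g2 t; exact: ltW.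
  have P2 : (hm z (~` (g @^-1` `]-oo, x[)) <= hm b (~` `]-oo, x[))%E.
    apply: (@le_trans _ _ (hm b `[x, 2 * pi])).
      apply: le_trans (bnd x (2 * pi) _ _ _); rewrite ?(ltW x0)//.
      apply: le_measure; rewrite ?inE; [exact: (measurableC (pre _ mP))|exact: (pre _ (measurable_itv _))|].
      by move=> t /=; rewrite !in_itv/= => /negP; rewrite -leNgt => ->; have /andP[_ /ltW] := g2 t.
    apply: le_measure; rewrite ?inE; [exact: measurable_itv|exact: measurableC|].
    by move=> t /=; rewrite !in_itv/= => /andP[h _]; apply/negP; rewrite -leNgt.
  have E1 := harmonic_measure_setC z1 (pre _ mP).
  have E2 := harmonic_measure_setC b1 mP.
  move: P1 P2 E1 E2.
  rewrite -(@fineK _ (hm z (g @^-1` `]-oo, x[))); last exact: (harmonic_measure_fin_num z1 (pre _ mP)).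
  rewrite -(@fineK _ (hm z (~` (g @^-1` `]-oo, x[)))); last exact: (harmonic_measure_fin_num z1 (measurableC (pre _ mP))).
  rewrite -(@fineK _ (hm b `]-oo, x[)); last exact: harmonic_measure_fin_num.
  rewrite -(@fineK _ (hm b (~` `]-oo, x[))); last exact: (harmonic_measure_fin_num b1 (measurableC mP)).
  rewrite -!EFinD !lee_fin => P1 P2 [E1] [E2]; congr (_%:E).
  by apply/eqP; rewrite eq_le P1/= -(lerD2r (fine (hm b (~` `]-oo, x[)))) E2 -E1 lerD2l.
- move=> k; rewrite -ge0_fin_numE//; apply: harmonic_measure_fin_num => //.
  exact: (pre _ (measurable_itv _)).
Qed.

Theorem inner_boundary_map (f : C -> C) : inner_function f ->
  exists (g : R -> R) (N : set R), [/\ transports g f, measurable N, mu N = 0%E &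
  forall t, 0 <= t < 2 * pi -> ~ N t ->
    radial_dom f (e_ t) /\ radial_ext f (e_ t) = e_ (g t)].
Proof.
move=> f_inner; have [g [N [mg g2 mN N0 gN]]] := inner_angle f_inner.
by exists g, N; split => //; exact: inner_transports gN.
Qed.

End InnerBoundaryMap.

(** * Correlation of hitting events *)

Section PairBound.
Context {R : realType}.
Local Notation C := R[i].
Local Notation e_ := (@circle_point R).
Local Notation nc := (@Normc.normc R).
Local Notation mu := (@lebesgue_measure R).
Local Notation hm := (@harmonic_measure R).
Implicit Types (a z w : C).

(** Uses [1 - cos q = 2 * sin (q / 2) ^+ 2] and the mean value theorem for [sin], whose derivative
    is at least [cos 1] on this range. It makes the kernel tail at angle [q] quantitative. *)
Lemma one_sub_cos_ge (q : R) : 0 < q <= 1 -> q ^+ 2 * (cos 1 ^+ 2 / 2) <= 1 - cos q.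
Proof.
move=> /andP[q0 q1]; have c1 := cos1_gt0 R.
have p2 := pihalf_ge1 R.
have q20 : 0 < q / 2 by rewrite divr_gt0.
have [x] : exists2 x, x \in `]0, q / 2[ & sin (q / 2) - sin 0 = cos x * (q / 2 - 0).
  apply: (@MVT R sin cos 0 (q / 2) q20).
  by apply: continuous_subspaceT; exact: continuous_sin.
rewrite in_itv/= => /andP[x0 x1]; rewrite sin0 !subr0 => sE.
have cx : cos 1 <= cos x.
  by rewrite ltW// ltr_cos ?in_itv/=; lra.
have -> : 1 - cos q = 2 * sin (q / 2) ^+ 2.
  rewrite -[q in cos q](divfK (_ : (2 : R) != 0))// mulr_natr cos_mulr2n cos2sin2.
  by rewrite mulrnBl; ring.
rewrite sE exprMn.
have : cos 1 ^+ 2 <= cos x ^+ 2 by rewrite lerXn2r ?nnegrE// ltW// (lt_le_trans c1).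
have q2 : 0 < q ^+ 2 by rewrite exprn_gt0.
move=> h; have -> : 2 * (cos x ^+ 2 * (q / 2) ^+ 2) = q ^+ 2 * (cos x ^+ 2 / 2) by field.
by rewrite ler_pM2l// ler_pM2r// invr_gt0.
Qed.

Lemma mob_angle_arc a (th1 th2 : R) : nc a < 1 -> th1 < th2 ->
  \int[mu]_(t in `[th1, th2]) pk a (e_ t) = mob_angle a th2 - mob_angle a th1.
Proof.
move=> a1 th12; rewrite /Rintegral (@continuous_FTC2 R _ (mob_angle a)) => [| |||]//.
- exact: (continuous_subspaceT (continuous_pk_circle a1)).
- have cF : continuous (mob_angle a).
    move=> t; apply: differentiable_continuous; apply/derivable1_diffP.
    by have [] := is_derive_mob_angle t a1.
  split; first by move=> t _; have [] := is_derive_mob_angle t a1.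
  + by apply: cvg_at_right_filter; exact: cF.
  + by apply: cvg_at_left_filter; exact: cF.
- move=> t _; rewrite derive1E; have dA := is_derive_mob_angle t a1.
  exact: derive_val.
Qed.

(** The point of smoothing in the coordinate [mob_angle a]: a kernel centred at [s], weighted by the
    density seen from [a], is again a harmonic density, seen from a point at distance [r] from
    [a]. *)
Lemma poisson_density_change a (r s t : R) : nc a < 1 -> 0 < r < 1 ->
  pkr r (s - mob_angle a t) * poisson_density a t =
  poisson_density (mob (- a) (r%:C * e_ s)) t.
Proof.
move=> a1 /andP[r0 r1]; have a1' : nc (- a) < 1 by rewrite ncN.
have rs : nc (r%:C * e_ s) < 1 by rewrite ncM nc_real nc_circle mulr1 gtr0_norm.
have z1 := nc_mob_lt1 a1' rs.
rewrite /poisson_density a1 z1/=; case: ifP => _; last by rewrite mulr0.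
have := pk_mob a1 z1 (nc_circle t).
rewrite mobNK ?(ltW rs)// mob_angleE// pkrE => ->.
by rewrite divfK// gt_eqF// pk_gt0 ?nc_circle.
Qed.

Lemma arc_correlation_bound : exists2 K : R, 0 < K &
  forall a (h : R -> R) (F : C -> C) (th1 th2 : R) (J : set R) (q : R),
  nc a < 1 -> transports h F -> 0 <= th1 -> th1 < th2 -> th2 <= 2 * pi ->
  measurable J -> 0 < q <= 1 ->
  (forall z, nc z < 1 -> nc (mob (F a) (F z)) < 1 /\
     nc (mob (F a) (F z)) / (1 - nc (mob (F a) (F z))) <=
     q ^+ 6 * (nc (mob a z) / (1 - nc (mob a z)))) ->
  2 * pi * fine (hm a (`[th1, th2] `&` h @^-1` J)) <=
  fine (hm (F a) J) * (fine (hm a `[th1, th2]) + K * q).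
Proof.
pose c := cos 1 ^+ 2 / 2 : R.
have c0 : 0 < c by rewrite divr_gt0// exprn_gt0// cos1_gt0.
have c1 : c <= 1 / 2.
  by rewrite ler_pM2r ?invr_gt0// expr_le1 ?cos_le1// ltW// cos1_gt0.
have pi0 := pi_gt0 R.
pose L := 12 / c + 2.
have L0 : 0 < L by rewrite addr_gt0// divr_gt0.
(* The first term settles the case [c / 4 <= q]; the second bounds the linear part of
   [(1 + L * q) * (pn + 2 * q)], where [pn <= 2 * pi] and [q <= 1]. *)
pose K := 8 * pi / c + (2 + (2 * pi + 2) * L).
have K1 : 0 < 8 * pi / c by rewrite divr_gt0// mulr_gt0.
have K2 : 0 < (2 + (2 * pi + 2) * L) by rewrite addr_gt0// mulr_gt0// addr_gt0// mulr_gt0.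
exists K; first by rewrite addr_gt0.
move=> a h F th1 th2 J q a1 tr th10 th12 th22 mJ /andP[q0 q1] contr.
have [mh h0 F1 hF] := tr.
have b1 := F1 _ a1; set b := F a in b1 contr *.
have mhJ : measurable (h @^-1` J) by rewrite -[X in measurable X]setTI; exact: mh.
have mI : measurable (`[th1, th2]%classic : set R) by exact: measurable_itv.
have mD : measurable (`[th1, th2] `&` h @^-1` J) by exact: measurableI.
set pm := fine (hm b J); set pn := fine (hm a `[th1, th2]).
set X := fine _.
have fX := harmonic_measure_fin_num a1 mD.
have pm0 : 0 <= pm by rewrite fine_ge0.
have pn0 : 0 <= pn by rewrite fine_ge0.
have pnE : pn = mob_angle a th2 - mob_angle a th1.
  by rewrite /pn harmonic_measure_itv// /= mob_angle_arc.
have pn2 : pn <= 2 * pi.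
  rewrite -lee_fin fineK; last exact: harmonic_measure_fin_num.
  by rewrite -(harmonic_measure_total a1); apply: le_measure; rewrite ?inE.
have X0 : 0 <= X by rewrite fine_ge0.
have Xpm : X <= pm.
  rewrite -lee_fin !fineK//; last exact: harmonic_measure_fin_num.
  by rewrite -hF//; apply: le_measure; rewrite ?inE//; apply: subIsetr.
(* For [q] bounded below the error term alone exceeds [2 * pi], and [X <= pm] suffices. *)
have [qc|qc] := leP (c / 4) q.
  apply: (@le_trans _ _ (pm * (8 * pi / c * q))).
    rewrite mulrC; apply: ler_pM => //; first by rewrite mulr_ge0// ltW.
    have -> : 2 * pi = 8 * pi / c * (c / 4) by field; rewrite gt_eqF.
    by rewrite ler_pM2l.
  rewrite ler_wpM2l// /K mulrDl.
  by have := mulr_gt0 K2 q0; lra.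
(* Smoothing at radius [1 - q^3] and angle [q] costs [O(q)] in the tail of the
   kernel, and the contraction [q^6] leaves [O(q^3)] in Harnack's inequality. *)
pose r := 1 - q ^+ 3.
have q3 : 0 < q ^+ 3 by rewrite exprn_gt0.
have q38 : q ^+ 3 <= q by rewrite -[leRHS]expr1 ler_wiXn2l// ltW.
have r01 : 0 < r < 1 by rewrite /r; apply/andP; split; lra.
have rh : 1 / 2 <= r < 1 by rewrite /r; apply/andP; split; lra.
have p2 := pihalf_ge1 R.
have dpi : 0 < q <= pi by rewrite q0/=; lra.
set tau := pkr_tail r q.
have tau1 : tau <= 2 * q / c.
  apply: le_trans (pkr_tail_le rh dpi) _.
  have cq := one_sub_cos_ge (ltac:(by rewrite q0) : 0 < q <= 1).
  have cq0 : 0 < q ^+ 2 * c by rewrite mulr_gt0// exprn_gt0.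
  have -> : 1 - r = q ^+ 3 by rewrite /r; ring.
  have -> : 2 * q / c = q ^+ 3 * (2 / (q ^+ 2 * c)).
    by field; rewrite !gt_eqF.
  rewrite ler_pM2l// ler_pM2l// lef_pV2 ?posrE//.
  exact: lt_le_trans cq.
have tauh : 2 * q / c <= 1 / 2 by rewrite ler_pdivrMr//; lra.
have tau0 : 0 <= tau.
  have := cos_lt1 dpi; move/andP: r01 => [r0 r1] cq.
  by rewrite /tau /pkr_tail divr_ge0 ?mulr_ge0 ?subr_ge0 ?(ltW cq) ?(ltW r0)//; nra.
pose H := ((1 + 2 * q ^+ 3) * pm)%:E : \bar R.
have key := @smoothing_bound_le R r q (mob_angle a th1) (mob_angle a th2)
  (`[th1, th2] `&` h @^-1` J) (mob_angle a) (poisson_density a) (fun=> H) r01 dpi.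
have mA : measurable_fun setT (mob_angle a).
  apply: continuous_measurable_fun => t; apply: differentiable_continuous.
  by apply/derivable1_diffP; have [] := is_derive_mob_angle t a1.
have {}key := key _ mD mA (measurable_poisson_density a) (poisson_density_ge0 a).
have : (((2 * pi * (1 - tau))%:E * hm a (`[th1, th2] `&` h @^-1` J))%E <=
   (\int[mu]_(s in `[(mob_angle a th1 - q)%R, (mob_angle a th2 + q)%R]) H)%E)%E.
  apply: key.
  - by apply: le_trans tau1 (le_trans tauh _); lra.
  - move=> t [] /=; rewrite in_itv/= => /andP[t1 t2] _.
    have mono := ltW_homo (mob_angle_lt a1).
    by rewrite !mono.
  - exact: measurable_cst.
  move=> s; under eq_integral do rewrite poisson_density_change//.
  set z := mob (- a) _.
  have rs : nc (r%:C * e_ s) = r.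
    by case/andP: r01 => r0 r1; rewrite ncM nc_real nc_circle mulr1 gtr0_norm.
  have r1 : r < 1 by case/andP: r01.
  have a1' : nc (- a) < 1 by rewrite ncN.
  have z1 : nc z < 1 by apply: nc_mob_lt1; rewrite ?rs.
  (* The arc condition has already limited the range of [s]; dropping it leaves a preimage under
     [h], which transport evaluates. *)
  apply: (@le_trans _ _ (hm z (h @^-1` J))).
    change (hm z (`[th1, th2] `&` h @^-1` J) <= hm z (h @^-1` J))%E.
    by apply: le_measure; rewrite ?inE//; exact: subIsetr.
  rewrite hF//; have [Y1 Yo] := contr z z1.
  apply: le_trans (harmonic_measure_harnack b1 (F1 _ z1) (lexx _) Y1 mJ) _.
  rewrite -(@fineK _ (hm b J)); last exact: harmonic_measure_fin_num.
  rewrite -EFinM lee_fin -/pm ler_wpM2r//.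
  have za : mob a z = r%:C * e_ s by rewrite /z mobNK// rs ltW.
  move: Yo; rewrite za rs; set Y := nc (mob b (F z)) in Y1 *.
  have -> : 1 - r = q ^+ 3 by rewrite /r; ring.
  move=> Yo; have -> : (1 + Y) / (1 - Y) = 1 + 2 * (Y / (1 - Y)).
    by field; rewrite subr_eq0 gt_eqF.
  rewrite lerD2l ler_wpM2l//; apply: le_trans Yo _.
  have -> : q ^+ 6 * (r / q ^+ 3) = q ^+ 3 * r by field; rewrite gt_eqF.
  by rewrite ler_piMr ?ltW.
have A12 : mob_angle a th1 < mob_angle a th2 by exact: mob_angle_lt.
rewrite integral_cst; last exact: measurable_itv.
rewrite /= lebesgue_measure_itv/= lte_fin ifT; last by lra.
rewrite -(fineK fX) -EFinD -!EFinM lee_fin -/X.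
have -> : mob_angle a th2 + q + - (mob_angle a th1 - q) = pn + 2 * q by rewrite pnE; ring.
move=> main.
have pi2 : 0 < 2 * pi :> R by rewrite mulr_gt0.
have E1 : 2 * pi * X <= (1 + 2 * tau) * ((1 + 2 * q ^+ 3) * pm * (pn + 2 * q)).
  have t1 : 1 <= (1 + 2 * tau) * (1 - tau) by nra.
  apply: (@le_trans _ _ ((1 + 2 * tau) * (2 * pi * (1 - tau) * X))).
    have -> : (1 + 2 * tau) * (2 * pi * (1 - tau) * X) = (2 * pi * X) * ((1 + 2 * tau) * (1 - tau)) by ring.
    by rewrite ler_peMr// mulr_ge0// ltW.
  by rewrite ler_wpM2l// addr_ge0// mulr_ge0.
apply: le_trans E1 _.
have -> : (1 + 2 * tau) * ((1 + 2 * q ^+ 3) * pm * (pn + 2 * q)) =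
  pm * ((1 + 2 * tau) * (1 + 2 * q ^+ 3) * (pn + 2 * q)) by ring.
rewrite ler_wpM2l//.
have E2 : (1 + 2 * tau) * (1 + 2 * q ^+ 3) <= 1 + L * q.
  have u1 : 2 * tau <= 4 / c * q.
    have -> : 4 / c * q = 2 * (2 * q / c) by field; rewrite gt_eqF.
    by rewrite ler_pM2l.
  have u2 : (1 + 2 * tau) * (1 + 2 * q ^+ 3) <= (1 + 4 / c * q) * (1 + 2 * q).
    apply: ler_pM; last by rewrite lerD2l ler_pM2l.
    - by rewrite addr_ge0// mulr_ge0.
    - by rewrite addr_ge0// mulr_ge0// ltW.
    - by rewrite lerD2l.
  apply: le_trans u2 _; rewrite /L.
  have u3 : 0 < 4 / c by rewrite divr_gt0.
  have -> : 12 / c = 3 * (4 / c) by field; rewrite gt_eqF.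
  by nra.
apply: (@le_trans _ _ ((1 + L * q) * (pn + 2 * q))).
  by rewrite ler_wpM2r// addr_ge0// mulr_ge0// ltW.
have Lq0 : 0 < L * q by rewrite mulr_gt0.
have v1 : L * q * pn <= L * q * (2 * pi) by rewrite ler_pM2l.
have v2 : L * q * (2 * q) <= L * q * 2 by rewrite ler_pM2l//; lra.
have v3 : 0 < 8 * pi / c * q by rewrite mulr_gt0.
rewrite /K; nra.
Qed.

End PairBound.

(** * Second moment method *)

Section SecondMoment.
Context d (T : measurableType d) (R : realType).
Variable P : {measure set T -> \bar R}.

(** An arbitrary list of indices is allowed because the square of a sum of indicators is treated as
    a single sum over pairs. *)
Lemma integral_sum_indic (I : eqType) (s : seq I) (w : I -> R) (A : I -> set T) :
  (forall i, 0 <= w i) -> (forall i, measurable (A i)) ->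
  (forall i, P (A i) \is a fin_num) ->
  (\int[P]_t (\sum_(i <- s) w i * \1_(A i) t)%:E)%E =
  (\sum_(i <- s) w i * fine (P (A i)))%:E.
Proof.
move=> w0 mA fA; under eq_integral do rewrite -sumEFin.
rewrite ge0_integral_sum//; first last.
- by move=> i t _; rewrite lee_fin mulr_ge0// indicE.
- move=> i; apply/measurable_EFinP; apply: measurable_funM; first exact: measurable_cst.
  exact: measurable_indic.
rewrite -sumEFin; apply: eq_bigr => i _.
under eq_integral do rewrite EFinM.
rewrite ge0_integralZl//.
- by rewrite integral_indic// setIT EFinM fineK.
- by apply/measurable_EFinP; exact: measurable_indic.
- by rewrite lee_fin.
Qed.

Variables (M : R) (M0 : 0 < M) (PT : P setT = M%:E).
Variables (A : nat -> set T) (mA : forall i, measurable (A i)).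
Variables (w : nat -> R) (w01 : forall i, 0 <= w i <= 1).
Variables (c : nat -> nat -> R) (L : R).
Let p i := fine (P (A i)).
Hypothesis corr : forall i j, (i < j)%N ->
  M * fine (P (A i `&` A j)) <= p j * (p i + c i j).
Hypothesis csum : forall j, \sum_(i < j) w i * c i j <= L.
Hypothesis L0 : 0 <= L.

Let finP B : measurable B -> P B \is a fin_num.
Proof.
move=> mB; rewrite ge0_fin_numE//; apply: (@le_lt_trans _ _ (P setT)).
  by apply: le_measure; rewrite ?inE.
by rewrite PT ltry.
Qed.

Let w0 i : 0 <= w i. Proof. by case/andP: (w01 i). Qed.

Let p0 i : 0 <= p i. Proof. by rewrite fine_ge0. Qed.

Let S N := \sum_(i < N) w i * p i.

Let S2 N := \sum_(i < N) \sum_(j < N) w i * w j * fine (P (A i `&` A j)).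

(** By induction: step [N] adds one row, one column and a diagonal term. The correlation hypothesis
    controls the row and column, and [w N ^+ 2 <= w N] reduces the diagonal to the first moment. *)
Lemma second_moment_bound N : S2 N <= (1 + 2 * L / M) * S N + S N ^+ 2 / M.
Proof.
elim: N => [|N IH].
  by rewrite /S2 /S !big_ord0 mulr0 expr0n/= mul0r addr0.
have S2E : S2 N.+1 = S2 N + 2 * (w N * \sum_(i < N) w i * fine (P (A i `&` A N))) + w N ^+ 2 * p N.
  rewrite /S2 big_ord_recr/=.
  under eq_bigr do rewrite big_ord_recr/=.
  rewrite big_split/= big_ord_recr/= setIid -!addrA; congr (_ + _).
  have -> : \sum_(j < N) w N * w j * fine (P (A N `&` A j)) =
      w N * \sum_(i < N) w i * fine (P (A i `&` A N)).
    by rewrite big_distrr/=; apply: eq_bigr => i _; rewrite setIC mulrA.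
  have -> : \sum_(i < N) w i * w N * fine (P (A i `&` A N)) =
      w N * \sum_(i < N) w i * fine (P (A i `&` A N)).
    by rewrite big_distrr/=; apply: eq_bigr => i _; ring.
  by rewrite /p; ring.
have SE : S N.+1 = S N + w N * p N by rewrite /S big_ord_recr.
have cross : M * \sum_(i < N) w i * fine (P (A i `&` A N)) <= p N * S N + p N * L.
  apply: (@le_trans _ _ (\sum_(i < N) p N * (w i * p i + w i * c i N))).
    rewrite big_distrr/=; apply: ler_sum => i _.
    have := ler_wpM2l (w0 i) (corr (ltn_ord i)); rewrite mulrCA => h.
    by apply: le_trans h _; rewrite mulrCA mulrDr.
  rewrite -big_distrr/= big_split/= mulrDr; apply: lerD; first exact: lexx.
  exact: (ler_wpM2l (p0 N) (csum N)).
have S0 : 0 <= S N by apply: sumr_ge0 => i _; rewrite mulr_ge0.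
have w1 : w N ^+ 2 <= w N.
  by have /andP[a b] := w01 N; rewrite expr2 ler_piMl.
set Y := \sum_(i < N) _ in S2E cross.
have crossM : Y <= (p N * S N + p N * L) / M by rewrite ler_pdivlMr// mulrC.
rewrite S2E SE.
have q1 := ler_wpM2l (w0 N) crossM.
have q2 := ler_wpM2r (p0 N) w1.
have q3 : 0 <= (w N * p N) ^+ 2 / M by rewrite divr_ge0 ?sqr_ge0// ltW.
have -> : (1 + 2 * L / M) * (S N + w N * p N) + (S N + w N * p N) ^+ 2 / M =
  ((1 + 2 * L / M) * S N + S N ^+ 2 / M) + 2 * (w N * ((p N * S N + p N * L) / M)) +
  w N * p N + (w N * p N) ^+ 2 / M by field; rewrite gt_eqF.
lra.
Qed.

(** Chebyshev's argument: on [B] the weighted count is 0, so it deviates from its mean [k] by [k],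
    while its variance is at most linear in [S N]. *)
Lemma missing_bound N B : measurable B -> (forall i t, (i < N)%N -> B t -> ~ A i t) ->
  fine (P B) * S N <= M ^+ 2 * (1 + 2 * L / M).
Proof.
move=> mB BA; set s := S N; pose k := s / M.
have s0 : 0 <= s by apply: sumr_ge0 => i _; rewrite mulr_ge0.
have k0 : 0 <= k by rewrite divr_ge0// ltW.
have K0 : 0 <= M ^+ 2 * (1 + 2 * L / M).
  by rewrite mulr_ge0 ?sqr_ge0// addr_ge0// divr_ge0 ?mulr_ge0// ltW.
(* Integrate [k^2 1_B + 2 k X <= X^2 + k^2], valid since [X = 0] on [B]. *)
have key : k ^+ 2 * fine (P B) + 2 * k * s <= S2 N + k ^+ 2 * M.
  rewrite -lee_fin.
  pose X t := \sum_(i < N) w i * \1_(A i) t.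
  pose lhs t := k ^+ 2 * \1_B t + 2 * k * X t.
  pose rhs t := X t ^+ 2 + k ^+ 2.
  have mX : measurable_fun setT X.
    apply: measurable_sum => i; apply: measurable_funM; first exact: measurable_cst.
    exact: measurable_indic.
  have X0 t : 0 <= X t by apply: sumr_ge0 => i _; rewrite mulr_ge0// indicE.
  have IX : (\int[P]_t (X t)%:E)%E = s%:E.
    by rewrite /X /s integral_sum_indic// => i; exact: finP.
  have IX2 : (\int[P]_t (X t ^+ 2)%:E)%E = (S2 N)%:E.
    rewrite (eq_integral (fun t => (\sum_(ij <- [seq (i : 'I_N, j : 'I_N) | i <- index_enum 'I_N, j <- index_enum 'I_N])
        w ij.1 * w ij.2 * \1_(A ij.1 `&` A ij.2) t)%:E)); last first.
      move=> t _; congr (_%:E); rewrite big_allpairs/= expr2 /X big_distrl/=.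
      apply: eq_bigr => i _; rewrite big_distrr/=; apply: eq_bigr => j _.
      by rewrite indicI /=; ring.
    rewrite (integral_sum_indic _ (w := fun ij : 'I_N * 'I_N => w ij.1 * w ij.2) (A := fun ij : 'I_N * 'I_N => A ij.1 `&` A ij.2)).
    - by rewrite big_allpairs.
    - by move=> ij; rewrite mulr_ge0.
    - by move=> ij; exact: measurableI.
    - by move=> ij; apply: finP; exact: measurableI.
  have mB1 : measurable_fun setT (\1_B : T -> R) by exact: measurable_indic.
  have I1 : (\int[P]_t (k ^+ 2 * \1_B t)%:E)%E = (k ^+ 2 * fine (P B))%:E.
    under eq_integral do rewrite EFinM.
    rewrite ge0_integralZl//.
    - rewrite integral_indic// setIT [RHS]EFinM fineK//; exact: finP.
    - by apply/measurable_EFinP.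
    - by rewrite lee_fin sqr_ge0.
  have k20 : 0 <= 2 * k by rewrite mulr_ge0.
  have I2 : (\int[P]_t (2 * k * X t)%:E)%E = (2 * k * s)%:E.
    under eq_integral do rewrite EFinM.
    rewrite ge0_integralZl ?IX ?EFinM//.
    - by apply/measurable_EFinP.
    - by move=> t _; rewrite lee_fin.
  have m1 : measurable_fun setT (fun t => k ^+ 2 * \1_B t).
    by apply: measurable_funM => //; exact: measurable_cst.
  have m2 : measurable_fun setT (fun t => 2 * k * X t).
    by apply: measurable_funM => //; exact: measurable_cst.
  have m3 : measurable_fun setT (fun t => X t ^+ 2) by exact: measurable_funX.
  have g1 t : 0 <= k ^+ 2 * \1_B t by rewrite mulr_ge0 ?sqr_ge0// indicE.
  have g2 t : 0 <= 2 * k * X t by rewrite mulr_ge0.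
  have -> : (k ^+ 2 * fine (P B) + 2 * k * s)%:E = (\int[P]_t (lhs t)%:E)%E.
    under eq_integral do rewrite EFinD.
    rewrite ge0_integralD ?I1 ?I2 ?EFinD//.
    - by move=> t _; rewrite lee_fin.
    - by apply/measurable_EFinP.
    - by move=> t _; rewrite lee_fin.
    - by apply/measurable_EFinP.
  have -> : (S2 N + k ^+ 2 * M)%:E = (\int[P]_t (rhs t)%:E)%E.
    under eq_integral do rewrite EFinD.
    rewrite ge0_integralD ?IX2 ?EFinD//.
    - by rewrite integral_cst// PT EFinM.
    - by move=> t _; rewrite lee_fin sqr_ge0.
    - by apply/measurable_EFinP.
    - by move=> t _; rewrite lee_fin sqr_ge0.
  apply: ge0_le_integral => //.
  - by move=> t _; rewrite lee_fin addr_ge0.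
  - by apply/measurable_EFinP; apply: measurable_funD.
  - by apply/measurable_EFinP; apply: measurable_funD => //; exact: measurable_cst.
  move=> t _; rewrite lee_fin /lhs /rhs indicE.
  have [tB|tB] := boolP (t \in B); last first.
    by have := sqr_ge0 (X t - k); rewrite mulr0; lra.
  have -> : X t = 0.
    rewrite /X big1// => i _; rewrite indicE memNset ?mulr0//.
    by apply: BA => //; exact: set_mem.
  by rewrite mulr0 addr0 mulr1 expr0n/= add0r.
have S2b := second_moment_bound N; rewrite -/s in S2b.
have sE : s = k * M by rewrite /k divfK// gt_eqF.
have [s00|s00] := eqVneq s 0; first by rewrite -/s s00 mulr0.
have sp : 0 < s by rewrite lt_def s00.
have e1 : k ^+ 2 * fine (P B) <= (1 + 2 * L / M) * s.
  have e2 : s ^+ 2 / M = k ^+ 2 * M by rewrite sE; field; rewrite gt_eqF.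
  have e3 : 2 * k * s = 2 * (k ^+ 2 * M) by rewrite sE; ring.
  move: key S2b; rewrite e2 e3; lra.
rewrite -/s -(ler_pM2l sp).
have -> : s * (fine (P B) * s) = M ^+ 2 * (k ^+ 2 * fine (P B)) by rewrite sE; ring.
have -> : s * (M ^+ 2 * (1 + 2 * L / M)) = M ^+ 2 * ((1 + 2 * L / M) * s) by ring.
by rewrite ler_wpM2l ?sqr_ge0.
Qed.

Lemma missing_null B : measurable B -> (forall i t, B t -> ~ A i t) ->
  (forall K, exists N, K <= S N) -> P B = 0%E.
Proof.
move=> mB BA div; have fB := finP mB.
have b0 : 0 <= fine (P B) by rewrite fine_ge0.
rewrite -(fineK fB); congr (_%:E); apply/eqP; rewrite eq_le b0 andbT leNgt; apply/negP => bp.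
pose K := M ^+ 2 * (1 + 2 * L / M).
have [N hN] := div (K / fine (P B) + 1).
have := @missing_bound N B mB (fun i t _ => BA i t); rewrite -/K.
have := ler_wpM2l b0 hN; rewrite mulrDr mulr1 mulrCA divff ?gt_eqF// mulr1.
lra.
Qed.

End SecondMoment.

(** * Orbits of a forward composition *)

Section Contraction.
Context {R : realType}.
Local Notation C := R[i].
Local Notation nc := (@Normc.normc R).
Variable f : nat -> C -> C.
Hypothesis f_inner : forall n, (0 < n)%N -> inner_function (f n).

Lemma forward_comp_disc n z : nc z < 1 -> nc (forward_comp f n z) < 1.
Proof.
move=> z1; elim: n => [|n IH]//=.
exact: (inner_disc (f_inner (ltn0Sn n))).
Qed.

Let orbit0_disc n : nc (forward_comp f n 0) < 1.
Proof. by apply: forward_comp_disc; rewrite nc0. Qed.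

(** The two hyperbolic densities reproduce the quotient in [schwarz_pick], so [hyp_distortion] is
    its [lam], taken at the orbit of 0. *)
Lemma inner_step n : 0 <= 1 - hyp_distortion f n.+1 <= 1 /\
  forall z, nc z < 1 ->
    let x := nc (mob (forward_comp f n 0) z) in
    let x' := nc (mob (forward_comp f n.+1 0) (f n.+1 z)) in
    x' < 1 /\ x' / (1 - x') <= x / (1 - x) * (1 - (1 - hyp_distortion f n.+1) / 3).
Proof.
have inn := f_inner (ltn0Sn n).
set a := forward_comp f n 0; have a1 : nc a < 1 := orbit0_disc n.
have b1 : nc (f n.+1 a) < 1 := orbit0_disc n.+1.
have a2 : 0 < 1 - nc a ^+ 2 by rewrite subr_gt0 expr_lt1// nc_ge0.
have b2 : 0 < 1 - nc (f n.+1 a) ^+ 2 by rewrite subr_gt0 expr_lt1// nc_ge0.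
have der : has_cderiv (f n.+1) a (cderiv (f n.+1) a).
  apply: derivable_has_cderiv; have [hol _ _] := inn; apply: hol.
  exact/unit_discE.
have [lam1 sp] := schwarz_pick (inner_holo inn) (inner_disc inn) a1 der.
have E : hyp_distortion f n.+1 = nc (cderiv (f n.+1) a) * (1 - nc a ^+ 2) / (1 - nc (f n.+1 a) ^+ 2).
  rewrite /hyp_distortion /hyp_density /= -/a; field.
  by rewrite !gt_eqF.
rewrite -E in lam1 sp.
have lam0 : 0 <= hyp_distortion f n.+1.
  by rewrite E divr_ge0 ?mulr_ge0 ?nc_ge0// ltW.
have mu01 : 0 <= 1 - hyp_distortion f n.+1 <= 1 by apply/andP; split; lra.
split=> // z z1 x x'; apply: odds_contraction => //.
- by rewrite nc_ge0 nc_mob_lt1.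
- exact: sp.
Qed.

Lemma bernoulli (x : R) k : 0 <= x <= 1 -> 1 - x *+ k <= (1 - x) ^+ k.
Proof.
move=> /andP[x0 x1]; elim: k => [|k IH]; first by rewrite mulr0n subr0 expr0.
have e0 : 0 <= (1 - x) ^+ k by rewrite exprn_ge0// subr_ge0.
have e1 : (1 - x) ^+ k <= 1.
  by rewrite exprn_ile1 ?subr_ge0// gerBl.
have := ler_piMr x0 e1; rewrite mulrS exprS mulrBl mul1r.
set y := x *+ k in IH *; lra.
Qed.

(** The composition carrying time [n] to time [n + k]. It is applied to arbitrary points of the
    disc, namely the base points produced by smoothing, and not only to [F_n z]. *)
Fixpoint tail_comp n k : C -> C :=
  if k is j.+1 then f (n + j).+1 \o tail_comp n j else id.

Lemma tail_comp_disc n k z : nc z < 1 -> nc (tail_comp n k z) < 1.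
Proof.
move=> z1; elim: k => [|k IH]//=.
exact: (inner_disc (f_inner (ltn0Sn _))).
Qed.

Lemma tail_compE n k z :
  tail_comp n k (forward_comp f n z) = forward_comp f (n + k) z.
Proof.
elim: k => [|k IH]; first by rewrite addn0.
by rewrite addnS /= IH.
Qed.

(* [18 = 3 * 6]: the odds contract by [1 - mu / 3 <= (1 - mu / 18)^6], and
   [arc_correlation_bound] uses up a sixth power. *)
Definition contraction_rate n : R :=
  \prod_(i < n) (1 - (1 - hyp_distortion f i.+1) / 18).
Local Notation Q := contraction_rate.

Lemma contraction_rate_gt0 n : 0 < Q n.
Proof.
apply: prodr_gt0 => i _; have [/andP[? ?] _] := inner_step i; lra.
Qed.

Lemma contraction_rateS n : Q n.+1 = Q n * (1 - (1 - hyp_distortion f n.+1) / 18).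
Proof. by rewrite /contraction_rate big_ord_recr. Qed.

Lemma contraction_rate_le n k : Q (n + k) <= Q n.
Proof.
elim: k => [|k IH]; first by rewrite addn0.
rewrite addnS contraction_rateS; apply: le_trans IH.
have [/andP[? ?] _] := inner_step (n + k).
rewrite ler_piMr ?(ltW (contraction_rate_gt0 _))//; lra.
Qed.

Lemma tail_comp_contraction n k z : nc z < 1 ->
  let x := nc (mob (forward_comp f n 0) z) in
  let x' := nc (mob (forward_comp f (n + k) 0) (tail_comp n k z)) in
  x' < 1 /\ x' / (1 - x') <= (Q (n + k) / Q n) ^+ 6 * (x / (1 - x)).
Proof.
move=> z1 x; elim: k => [|k IH] /=.
  rewrite addn0 divff ?expr1n ?mul1r ?gt_eqF ?contraction_rate_gt0//.
  split; last exact: lexx.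
  exact: nc_mob_lt1.
have [/andP[m0 m1] /(_ _ (tail_comp_disc n k z1)) [x'1 step]] := inner_step (n + k).
rewrite addnS; split=> //; apply: (le_trans step).
rewrite contraction_rateS; set m := 1 - hyp_distortion _ _ in m0 m1 *.
have [y1 /= IH2] := IH.
have B : 1 - m / 3 <= (1 - m / 18) ^+ 6.
  have := @bernoulli (m / 18) 6.
  have -> : m / 18 *+ 6 = m / 3 by rewrite -mulr_natr; field.
  by apply; apply/andP; split; lra.
rewrite (mulrAC (Q _)) exprMn (mulrAC (_ ^+ 6)); apply: ler_pM.
- by rewrite divr_ge0 ?nc_ge0// subr_ge0 ltW.
- lra.
- exact: IH2.
- exact: B.
Qed.

(** Each summand equals [18 / Q (n + i).+1 - 18 / Q (n + i)], so the sum telescopes exactly and only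
    a negative term is discarded. *)
Lemma contraction_rate_telescope n j :
  \sum_(i < j) (1 - hyp_distortion f (n + i).+1) / Q (n + i).+1 <= 18 / Q (n + j).
Proof.
elim: j => [|j IH].
  by rewrite big_ord0 divr_ge0// ltW// contraction_rate_gt0.
rewrite big_ord_recr/= addnS; apply: (le_trans (lerD IH (lexx _))).
have [/andP[m0 m1] _] := inner_step (n + j).
have := contraction_rate_gt0 (n + j); rewrite contraction_rateS.
set m := 1 - hyp_distortion _ _ in m0 m1 *; set q := Q _ => q0.
rewrite le_eqVlt; apply/orP; left; apply/eqP; field.
by apply/andP; split; apply/eqP => E; lra.
Qed.

End Contraction.

Section TailDivergence.
Context {R : realType}.

(** Were the partial sums beyond [n] bounded, adding the finite head would bound the whole
    series. *)
Lemma tail_divergence (u : nat -> R) : (forall n, 0 <= u n.+1) ->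
  (\sum_(1 <= n <oo) (u n)%:E = +oo)%E ->
  forall n K, exists N, K <= \sum_(i < N) u (n + i).+1.
Proof.
move=> u0 div n K; apply: contrapT => noN.
have bd N : \sum_(i < N) u (n + i).+1 <= K.
  by rewrite leNgt; apply/negP => h; apply: noN; exists N; exact: ltW.
suff : (\sum_(1 <= n <oo) (u n)%:E <= (\sum_(i < n) u i.+1 + K)%:E)%E by rewrite div.
apply: lime_le.
  by apply: is_cvg_ereal_nneg_natsum_cond => -[|i]// _ _; rewrite lee_fin.
apply: nearW => m; rewrite sumEFin lee_fin.
apply: (@le_trans _ _ (\sum_(i < n + m) u i.+1)); last first.
  by rewrite big_split_ord/= lerD2l; exact: bd.
case: m => [|m]; first by rewrite big_geq// sumr_ge0.
rewrite big_add1/= big_mkord addnS -addSn addnC big_split_ord/= lerDl.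
exact: sumr_ge0.
Qed.

End TailDivergence.

(** * Hitting events for orbits in the angular coordinate *)

Section AngleOrbits.
Context {R : realType}.
Local Notation C := R[i].
Local Notation e_ := (@circle_point R).
Local Notation nc := (@Normc.normc R).
Local Notation mu := (@lebesgue_measure R).
Local Notation hm := (@harmonic_measure R).

(* Junk-valued outside [0, 2 pi[, so that every angle map has values there. *)
Definition base_angle (t : R) : R := t * \1_(`[0, 2 * pi[%classic) t.

Lemma base_angleE t : 0 <= t < 2 * pi -> base_angle t = t.
Proof. by move=> t2; rewrite /base_angle indicE mem_set ?mulr1//= in_itv. Qed.

Lemma transports_base_angle : transports base_angle id.
Proof.
have mb : measurable_fun setT base_angle.
  by apply: measurable_funM => //; exact: measurable_indic.
have pi0 := pi_gt0 R.
split=> // [t|z B z1 mB].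
  rewrite /base_angle indicE; have [|_] := boolP (t \in _).
    by rewrite inE/= in_itv/= mulr1.
  by rewrite mulr0 lexx/= mulr_gt0.
rewrite -harmonic_measureI -[RHS]harmonic_measureI; congr (hm z _).
have E t : `[0, 2 * pi[%classic t -> base_angle t = t.
  by rewrite /= in_itv; exact: base_angleE.
by apply/seteqP; split=> t [Bt t2]; split=> //; move: Bt; rewrite /= E.
Qed.

Variables (f : nat -> C -> C) (g : nat -> R -> R).
Hypothesis f_inner : forall n, (0 < n)%N -> inner_function (f n).
Hypothesis gf : forall n, transports (g n) (f n.+1).

Fixpoint angle_comp n k : R -> R :=
  if k is j.+1 then g (n + j) \o angle_comp n j else base_angle.

Lemma transports_angle_comp n k : transports (angle_comp n k) (tail_comp f n k).
Proof.
elim: k => [|k IH]; first exact: transports_base_angle.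
exact: transports_comp.
Qed.

Local Notation G := (angle_comp 0).
Local Notation orb n := (forward_comp f n 0).
Local Notation rate := (contraction_rate f).

Lemma angle_compE n k t : G (n + k) t = angle_comp n k (G n t).
Proof.
elim: k => [|k IH]; last by rewrite addnS /= IH.
rewrite addn0 /= base_angleE//.
by have [] := transports_angle_comp 0 n.
Qed.

Let orb_disc n : nc (orb n) < 1.
Proof. by apply: forward_comp_disc; rewrite ?nc0. Qed.

Let nc01 : nc (0 : C) < 1. Proof. by rewrite nc0. Qed.

Lemma orbit_distribution n B : measurable B -> hm 0 (G n @^-1` B) = hm (orb n) B.
Proof.
move=> mB; have [_ _ _ ->//] := transports_angle_comp 0 n.
by have := tail_compE f 0 n 0; rewrite add0n /= => ->.
Qed.

(** The Poisson kernel is at least [(1 - nc a) / (1 + nc a)], hence at least half of [1 - nc a].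
    This turns the series of the hypothesis into the divergence of the mean number of hits. *)
Lemma orbit_arc_ge n (th1 th2 : R) : 0 <= th1 -> th1 <= th2 -> th2 <= 2 * pi ->
  (th2 - th1) / 2 * (1 - nc (orb n)) <= fine (hm 0 (G n @^-1` `[th1, th2])).
Proof.
move=> th10 th12 th22; rewrite orbit_distribution; last exact: measurable_itv.
rewrite harmonic_measure_itv//=; set a := orb n.
have a1 : nc a < 1 := orb_disc n.
apply: (@le_trans _ _ (\int[mu]_(t in `[th1, th2]) ((1 - nc a) / 2))).
  rewrite Rintegral_cst_itv// [leLHS](_ : _ = (1 - nc a) / 2 * (th2 - th1))//.
  by field.
apply: le_Rintegral => //.
- by apply: integrable_within => x; exact: cvg_cst.
- by apply: integrable_within; apply: continuous_subspaceT; exact: continuous_pk_circle.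
move=> t _; have /andP[h _] := pk_bounds a1 (nc_circle t); apply: le_trans h.
have a0 := nc_ge0 a.
apply: ler_wpM2l; first by rewrite subr_ge0 ltW.
by rewrite lef_pV2 ?posrE//; lra.
Qed.

Lemma measurable_orbit_arc n (th1 th2 : R) : measurable (G n @^-1` `[th1, th2]).
Proof.
have [mG _ _ _] := transports_angle_comp 0 n.
by rewrite -[X in measurable X]setTI; apply: mG => //; exact: measurable_itv.
Qed.

Definition orbit_arc (th1 th2 : nat -> R) i : set R := G i @^-1` `[th1 i, th2 i].

(** Both events are read at time [n], where the distribution is the harmonic measure seen from
    [orb n]; the later event is then a preimage under the angle map of [tail_comp f n k],
    contracting with [q] the ratio of rates. *)
Lemma orbit_correlation : exists2 K : R, 0 < K &
  forall (th1 th2 : nat -> R), (forall n, 0 <= th1 n < th2 n) -> (forall n, th2 n <= 2 * pi) ->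
  forall n k,
  2 * pi * fine (hm 0 (orbit_arc th1 th2 n `&` orbit_arc th1 th2 (n + k))) <=
  fine (hm 0 (orbit_arc th1 th2 (n + k))) *
    (fine (hm 0 (orbit_arc th1 th2 n)) + K * (rate (n + k) / rate n)).
Proof.
have [K K0 bound] := @arc_correlation_bound R; exists K => //.
move=> th1 th2 th12 th22 n k.
have mI i : measurable (`[th1 i, th2 i]%classic : set R) by exact: measurable_itv.
have AA : orbit_arc th1 th2 n `&` orbit_arc th1 th2 (n + k) =
    G n @^-1` (`[th1 n, th2 n] `&` angle_comp n k @^-1` `[th1 (n + k)%N, th2 (n + k)%N]).
  by rewrite /orbit_arc preimage_setI; apply/seteqP; split=> t []/= h1; rewrite angle_compE.
have tr := transports_angle_comp n k; have [mh _ _ _] := tr.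
rewrite AA /orbit_arc !orbit_distribution//; last first.
  by apply: measurableI => //; rewrite -[X in measurable X]setTI; exact: mh.
have rn := contraction_rate_gt0 f_inner n; have rk := contraction_rate_gt0 f_inner (n + k).
have := bound _ _ _ (th1 n) (th2 n) `[th1 (n + k)%N, th2 (n + k)%N]%classic (rate (n + k) / rate n)
  (orb_disc n) tr; rewrite tail_compE; apply=> //.
- by case/andP: (th12 n).
- by case/andP: (th12 n).
- by rewrite divr_gt0// ler_pdivrMr// mul1r contraction_rate_le.
- by move=> z z1; exact: tail_comp_contraction.
Qed.

(** The event is that no arc is hit after time [n]. With [n] free, this yields hits at arbitrarily
    late times. *)
Lemma orbit_hits_ae (th1 : nat -> R) (l : R) n :
  0 < l -> (forall i, 0 <= th1 i) -> (forall i, th1 i + l <= 2 * pi) ->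
  (\sum_(1 <= i <oo) ((1 - hyp_distortion f i) * (1 - nc (orb i)))%:E = +oo)%E ->
  hm 0 (\bigcap_i ~` (G (n + i).+1 @^-1` `[th1 (n + i).+1, th1 (n + i).+1 + l])) = 0%E.
Proof.
move=> l0 th10 th12 div; have [K K0 corr] := orbit_correlation.
pose A i := G i @^-1` `[th1 i, th1 i + l].
have pi0 := pi_gt0 R.
have rate0 i := contraction_rate_gt0 f_inner i.
have mu01 i : 0 <= 1 - hyp_distortion f i.+1 <= 1.
  by have [] := inner_step f_inner i.
(* The weights are the [mu_i]. Telescoping bounds the weighted errors by [K * 18], with a leftover
   factor [rate (n + j).+1 / rate (n + j) <= 1]. *)
apply: (@missing_null _ _ R (hm 0) (2 * pi) _ (harmonic_measure_total nc01)
  (fun i => A (n + i).+1) _ (fun i => 1 - hyp_distortion f (n + i).+1) _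
  (fun i j => K * (rate (n + j).+1 / rate (n + i).+1)) (K * 18)).
- by rewrite mulr_gt0.
- by move=> i; exact: measurable_orbit_arc.
- by move=> i; exact: mu01.
- move=> i j ij.
  have := corr th1 (fun i => th1 i + l) _ th12 (n + i).+1 (j - i)%N.
  rewrite addSn -addnA subnKC; last exact: ltnW.
  by apply=> k; rewrite th10 ltrDl.
- move=> j; rewrite -[leRHS]mul1r.
  have -> : \sum_(i < j) (1 - hyp_distortion f (n + i).+1) * (K * (rate (n + j).+1 / rate (n + i).+1))
    = (K * rate (n + j).+1) * \sum_(i < j) (1 - hyp_distortion f (n + i).+1) / rate (n + i).+1.
    by rewrite big_distrr/=; apply: eq_bigr => i _; ring.
  apply: le_trans (ler_wpM2l _ (contraction_rate_telescope f_inner n j)) _.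
    by rewrite mulr_ge0// ltW.
  rewrite mul1r -mulrA ler_pM2l// mulrCA ler_piMr//.
  rewrite ler_pdivrMr// mul1r -(addn1 (n + j)).
  exact: contraction_rate_le.
- by rewrite mulr_ge0// ltW.
- apply: bigcap_measurable => // i _; apply: measurableC; exact: measurable_orbit_arc.
- by move=> i t Bt; exact: Bt.
move=> L; have [|N hN] := tail_divergence _ div n (L / (l / 2)).
  move=> i; case/andP: (mu01 i) => m0 _; rewrite mulr_ge0// subr_ge0 ltW//.
exists N; rewrite ler_pdivrMr ?divr_gt0// in hN; apply: le_trans hN _.
rewrite mulrC big_distrr/=; apply: ler_sum => i _.
rewrite mulrCA ler_wpM2l//; first by case/andP: (mu01 (n + i)%N).
have := @orbit_arc_ge (n + i).+1 (th1 (n + i).+1) (th1 (n + i).+1 + l).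
rewrite addrAC subrr add0r; apply=> //.
by rewrite lerDl ltW.
Qed.

End AngleOrbits.

(** * Back to boundary compositions on the circle *)

Section BoundaryOrbits.
Context {R : realType}.
Local Notation C := R[i].
Local Notation e_ := (@circle_point R).
Local Notation nc := (@Normc.normc R).
Local Notation mu := (@lebesgue_measure R).
Local Notation hm := (@harmonic_measure R).

Lemma arc_null_countable (I : countType) (A : set C) (B : I -> set R) :
  (forall k, measurable (B k)) -> (forall k, hm 0 (B k) = 0%E) ->
  (forall t, 0 <= t < 2 * pi -> A (e_ t) -> exists k, B k t) -> arc_null A.
Proof.
move=> mB B0 AB.
pose D n := if unpickle n is Some i then B i `&` `[0, 2 * pi[%classic else set0.
apply: (@negligibleS _ _ _ mu (\bigcup_n D n)).
  move=> t /= [t2 At]; have [k Bk] := AB t t2 At.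
  by exists (pickle k) => //; rewrite /D pickleK; split=> //=; rewrite in_itv.
apply: negligible_bigcup => n; rewrite /D; case: unpickle => [i|]; last exact: negligible_set0.
apply/negligibleP; last by have := B0 i; rewrite harmonic_measure0.
by apply: measurableI; [exact: mB | exact: measurable_itv].
Qed.

Lemma circle_point_lip (t : R) : exists2 d, 0 < d &
  forall s, `|s - t| < d -> nc (e_ s - e_ t) <= 2 * `|s - t|.
Proof.
have [d d0 hd] := @circle_eps R t 1 ltr01; exists d => // s /hd.
rewrite mul1r => h.
have -> : e_ s - e_ t = (e_ s - e_ t - 'i * e_ t * (s - t)%:C) + 'i * e_ t * (s - t)%:C.
  by rewrite subrK.
apply: (le_trans (ncD _ _)).
have : nc ('i * e_ t * (s - t)%:C) = `|s - t|.
  rewrite !ncM nc_circle nc_real mulr1.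
  have -> : nc 'i = 1 by rewrite /Normc.normc/= expr0n expr1n add0r sqrtr1.
  by rewrite mul1r.
lra.
Qed.

Variables (f : nat -> C -> C) (g : nat -> R -> R) (N : nat -> set R).
Hypothesis f_inner : forall n, (0 < n)%N -> inner_function (f n).
Hypothesis gf : forall n, transports (g n) (f n.+1).
Hypothesis mN : forall n, measurable (N n).
Hypothesis N0 : forall n, mu (N n) = 0%E.
Hypothesis bdry : forall n t, 0 <= t < 2 * pi -> ~ N n t ->
  radial_dom (f n.+1) (e_ t) /\ radial_ext (f n.+1) (e_ t) = e_ (g n t).

Local Notation G := (angle_comp g 0).
Local Notation orb n := (forward_comp f n 0).

Let nc01 : nc (0 : C) < 1. Proof. by rewrite nc0. Qed.

Let G_itv n t : 0 <= G n t < 2 * pi.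
Proof. by have [] := transports_angle_comp gf 0 n. Qed.

(** Angles whose orbit meets the exceptional set at time [n]. They form a null set, since transport
    pulls null sets back to null sets. *)
Let bad n := G n @^-1` N n.

Let mbad n : measurable (bad n).
Proof.
have [mG _ _ _] := transports_angle_comp gf 0 n.
by rewrite -[X in measurable X]setTI; exact: mG.
Qed.

Let bad0 n : hm 0 (bad n) = 0%E.
Proof.
apply: (transports_null (transports_angle_comp gf 0 n)) => //.
apply/eqP; rewrite -measure_le0 -(N0 n); apply: le_measure; rewrite ?inE//; last exact: mN.
by apply: measurableI; [exact: mN | exact: measurable_itv].
Qed.

Lemma boundary_compE t : 0 <= t < 2 * pi -> (forall n, ~ bad n t) ->
  forall n, boundary_comp f n (e_ t) = e_ (G n t).
Proof.
move=> t2 good; elim=> [|n IH]; first by rewrite /= base_angleE.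
have [_ E] := bdry (G_itv n t) (good n).
by rewrite /= IH E.
Qed.

Lemma boundary_dom_good t : 0 <= t < 2 * pi -> (forall n, ~ bad n t) ->
  boundary_dom f (e_ t).
Proof.
move=> t2 good n; rewrite boundary_compE//.
by have [] := bdry (G_itv n t) (good n).
Qed.

Hypothesis div :
  (\sum_(1 <= i <oo) ((1 - hyp_distortion f i) * (1 - nc (orb i)))%:E = +oo)%E.

Let miss (th : nat -> R) (l : R) n :=
  \bigcap_i ~` (G (n + i).+1 @^-1` `[th (n + i).+1, th (n + i).+1 + l]).

Let mmiss th l n : measurable (miss th l n).
Proof.
apply: bigcap_measurable => // i _; apply: measurableC.
exact: measurable_orbit_arc.
Qed.

Let hit th l n t : ~ miss th l n t ->
  exists i, th (n + i).+1 <= G (n + i).+1 t <= th (n + i).+1 + l.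
Proof.
move=> h; apply: contrapT => h'; apply: h => i _ /=; rewrite in_itv/= => H.
by apply: h'; exists i.
Qed.

(** For each [k] the circle is cut into [k.+1] equal arcs; almost every orbit hits all of these
    countably many arcs, and arbitrarily short ones surround every point. *)
Lemma orbit_dense_ae : circle_ae (fun zeta : C => boundary_dom f zeta /\
  unit_circle `<=` closure (range (fun n : nat => boundary_comp f n.+1 zeta))).
Proof.
have pi0 := pi_gt0 R.
pose l k : R := 2 * pi / k.+1%:R.
have l0 k : 0 < l k by rewrite divr_gt0// mulr_gt0.
(* For [j > k] there is no [j]-th arc; the default 0 repeats the first one, so that all pairs of
   naturals can serve as indices. *)
pose th (k j : nat) : R := if (j <= k)%N then j%:R * l k else 0.
have lE k : k.+1%:R * l k = 2 * pi by rewrite /l mulrC divfK// pnatr_eq0.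
have th0 k j : 0 <= th k j by rewrite /th; case: ifP => // _; rewrite mulr_ge0// ltW.
have th2 k j : th k j + l k <= 2 * pi.
  rewrite -(lE k) -natr1 mulrDl mul1r lerD2r /th; case: ifP => jk.
    by rewrite ler_pM2r// ler_nat.
  by rewrite mulr_ge0// ltW.
apply: (arc_null_countable (I := (nat + nat * nat)%type) (B := fun x =>
  match x with inl n => bad n | inr (k, j) => miss (fun=> th k j) (l k) 0 end)).
- by case=> [n|[k j]]; [exact: mbad|exact: mmiss].
- case=> [n|[k j]]; first exact: bad0.
  exact: (orbit_hits_ae f_inner gf).
move=> t t2 [_ bt]; apply: contrapT => noB; apply: bt.
have good n : ~ bad n t by move=> h; apply: noB; exists (inl n).
have hits k j : exists i, th k j <= G i.+1 t <= th k j + l k.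
  have [|i hi] := @hit (fun=> th k j) (l k) 0 t; last by exists i; exact: hi.
  by move=> h; apply: noB; exists (inr (k, j)).
split; first exact: boundary_dom_good.
move=> w /unit_circleE/circle_pointP[u /andP[u0 u2] <-{w}] B /nbhs_ballP[e/= e0 eB].
have e0' : 0 < complex.Re e by move: e0; rewrite ltcE => /andP[].
have eE : e = (complex.Re e)%:C.
  by move: e0; rewrite ltcE => /andP[/eqP]; case: (e) => x y /= ->.
(* An angle within [m] of [u] gives a point within [complex.Re e] of [e_ u], because [circle_point]
   is 2-Lipschitz near [u]; [k] makes the arcs shorter than [m], and [j] selects the one containing
   [u]. *)
have [d d0 hd] := circle_point_lip u.
pose m := Num.min d (complex.Re e / 2).
have m0 : 0 < m by rewrite lt_min d0 divr_gt0.
pose k := Num.truncn (2 * pi / m).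
have lk : l k < m.
  rewrite /l ltr_pdivrMr// (mulrC m) -ltr_pdivrMr//.
  have /truncn_itv/andP[_] : 0 <= 2 * pi / m by rewrite divr_ge0 ?mulr_ge0// ltW.
  by [].
pose j := Num.truncn (u / l k).
have /andP[j1 j2] : j%:R <= u / l k < j.+1%:R by apply: truncn_itv; rewrite divr_ge0// ltW.
rewrite ler_pdivlMr// in j1; rewrite ltr_pdivrMr// -natr1 mulrDl mul1r in j2.
have jk : (j <= k)%N.
  by rewrite -ltnS -(ltr_nat R) -(ltr_pM2r (l0 k)) lE (le_lt_trans j1).
have [i0] := hits k j; rewrite /th jk => /andP[i1 i2].
exists (e_ (G i0.+1 t)); split; first by exists i0; [exact: I | exact: (boundary_compE t2 good i0.+1)].
have Gu : `|G i0.+1 t - u| < m.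
  by apply: le_lt_trans lk; rewrite ler_norml; apply/andP; split; lra.
apply: eB; rewrite -ball_normE /= normCE eE ltcR ncBC.
move: Gu; rewrite lt_min => /andP[/hd h1 h2]; lra.
Qed.

Lemma Denjoy_Wolff_null : arc_null (Denjoy_Wolff_set f).
Proof.
have pi0 := pi_gt0 R.
(* The target arc lies in the half-plane opposite to [F_i(0)]: on [[0, pi / 4]] the cosine is at
   least [cos (pi / 4)], and on [[3 / 4 * pi, pi]] at most its negative. A hit therefore keeps the
   boundary orbit at distance at least [c] from [F_i(0)]. *)
pose th i : R := if complex.Re (orb i) <= 0 then 0 else 3 / 4 * pi.
have th0 i : 0 <= th i by rewrite /th; case: ifP => // _; rewrite mulr_ge0// ltW.
have th2 i : th i + pi / 4 <= 2 * pi by rewrite /th; case: ifP => _; lra.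
have l0 : 0 < pi / 4 :> R by rewrite divr_gt0.
apply: (arc_null_countable (I := (nat + nat)%type) (B := fun x =>
  match x with inl n => bad n | inr n => miss th (pi / 4) n end)).
- by case=> n; [exact: mbad|exact: mmiss].
- case=> n; first exact: bad0.
  exact: (orbit_hits_ae f_inner gf).
move=> t t2 [_ conv]; apply: contrapT => noB.
have good n : ~ bad n t by move=> h; apply: noB; exists (inl n).
pose c : R := cos (pi / 4).
have c0 : 0 < c by apply: cos_gt0_pihalf; apply/andP; split; lra.
move/cvgrPdist_lt: conv => /(_ c c0)[n _ hn].
have [m nm /andP[i1 i2]] : exists2 m, (n <= m)%N & th m <= G m t <= th m + pi / 4.
  have [|i hi] := @hit th (pi / 4) n t; first by move=> h; apply: noB; exists (inr n).
  by exists (n + i).+1; rewrite // ltnW// ltnS leq_addr.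
have := hn m nm; rewrite /= sub0r normrN ger0_norm ?nc_ge0// boundary_compE// ltNge => /negP; apply.
apply: le_trans (Re_le_nc _); rewrite ReB -[complex.Re (e_ _)]/(cos _).
have cos_le (x y : R) : 0 <= x -> x <= y -> y <= pi -> cos y <= cos x.
  move=> x0 xy y1; move: xy; rewrite le_eqVlt => /predU1P[->//|xy].
  by rewrite ltW// ltr_cos// in_itv/=; apply/andP; split; lra.
move: i1 i2; rewrite /th; case: ifPn => [a0|]; last rewrite -ltNge => a0.
  rewrite add0r => i1 i2; apply: le_trans (ler_norm _).
  have : c <= cos (G m t) by apply: cos_le => //; lra.
  lra.
move=> i1 i2; rewrite -normrN opprB; apply: le_trans (ler_norm _).
have : cos (G m t) <= cos (3 / 4 * pi) by apply: cos_le; lra.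
have -> : 3 / 4 * pi = pi - pi / 4 :> R by field.
rewrite cosB cospi sinpi mul0r addr0 mulN1r -/c; lra.
Qed.

End BoundaryOrbits.

Unset Implicit Arguments.
Set Strict Implicit.
Set Printing Implicit Defensive.

Theorem theoremF (R : realType) (f : nat -> R[i] -> R[i])
  (f_inner : forall n : nat, (0 < n)%N -> inner_function (f n))
  (mu : nat -> R)
  (muE : forall n : nat, (0 < n)%N -> mu n = 1 - hyp_distortion f n)
  (mu_sum : (\sum_(1 <= n <oo)
     (mu n * (1 - Normc.normc (forward_comp f n 0)))%:E = +oo)%E) :
  circle_ae (fun zeta : R[i] =>
    boundary_dom f zeta /\
    unit_circle `<=` closure (range (fun n : nat => boundary_comp f n.+1 zeta)))
  /\ arc_null (Denjoy_Wolff_set f).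
Proof.
have /choice[gN gNP] : forall n, exists gN : (R -> R) * set R,
    [/\ transports gN.1 (f n.+1), measurable gN.2, lebesgue_measure gN.2 = 0%E &
     forall t, 0 <= t < 2 * pi -> ~ gN.2 t ->
       radial_dom (f n.+1) (circle_point t) /\
       radial_ext (f n.+1) (circle_point t) = circle_point (gN.1 t)].
  move=> n; have [g [N gN]] := inner_boundary_map (f_inner n.+1 (ltn0Sn n)).
  by exists (g, N).
have tr n : transports (gN n).1 (f n.+1) by case: (gNP n).
have mN n : measurable (gN n).2 by case: (gNP n).
have N0 n : lebesgue_measure (gN n).2 = 0%E by case: (gNP n).
have bd n : forall t, 0 <= t < 2 * pi -> ~ (gN n).2 t ->
    radial_dom (f n.+1) (circle_point t) /\
    radial_ext (f n.+1) (circle_point t) = circle_point ((gN n).1 t) by case: (gNP n).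
(* The identity for [mu] holds from index 1 on, exactly the range of the series. *)
have div : (\sum_(1 <= i <oo) ((1 - hyp_distortion f i) *
    (1 - Normc.normc (forward_comp f i 0)))%:E = +oo)%E.
  rewrite -mu_sum; apply: congr_lim; apply/funext => n.
  by apply: eq_big_nat => i /andP[i1 _]; rewrite muE.
split; first exact: (orbit_dense_ae f_inner tr mN N0 bd div).
exact: (Denjoy_Wolff_null f_inner tr mN N0 bd div).
Qed.
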